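(* Let $A$ be a field or $\mathbb Z$. Let $X$ be a projective scheme over $A$, $\mathcal L$ a line bundle over $X$ very ample over $A$, and $i:Y\to X$ a hyperplane section with respect to $\mathcal L$. Let $(D_YX,\mathcal L')$ be the deformation to the projective completion of the cone associated to $(X,Y,\mathcal L)$, endowed with its natural transverse action of $\mathbb G_m$. Then, for $n\gg0$: 1. $H^0(D_YX,\mathcal L'^{\otimes n})$ can be decomposed into subspaces $E_{l,n}$, $-n\le l\le n$, where $\mathbb G_m$ acts on $E_{l,n}$ by the character $\lambda\mapsto\lambda^{n+l}$. 2. The fiber $D_YX_\infty$ over $\infty$ is stable by the action of $\mathbb G_m$, hence the action restricts to $\mathbb V_{D_YX_\infty}(\mathcal L')$; and $H^0(D_YX_\infty,\mathcal L'^{\otimes n})$ can be decomposed into subspaces $F_{l,n}$, $0\le l\le n$, where $\mathbb G_m$ acts on $F_{l,n}$ by the character $\lambda\mapsto\lambda^{n+l}$. 3. The restriction $r_1$ of $H^0(D_YX,\mathcal L'^{\otimes n})$ to the fiber over $1$ (which is $(X,\mathcal L)$) and the restriction $r_\infty$ to the fiber over $\infty$ induce, for $0\le l\le n$, commutative diagrams: there are maps $\phi_{l,n}:r_1(E_{l,n})\to F_{l,n}$ with $\phi_{l,n}\circ r_1=r_\infty$ on $E_{l,n}$. Furthermore, for $n\gg0$, $r_1(E_{l+1,n})\subset r_1(E_{l,n})$, $r_1(E_{0,n})=H^0(X,\mathcal L^{\otimes n})$, and the $\phi_{l,n}$ induce isomorphisms from $r_1(E_{l,n})/r_1(E_{l+1,n})$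 to $F_{l,n}$ (for $0\le l\le n$, with $E_{n+1,n}=0$).
   Context: Let $S_\bullet=\bigoplus_{n\ge 0} H^0(X,\mathcal L^{\otimes n})$. A closed immersion $i:Y\to X$ is a *hyperplane section with respect to $\mathcal L$* if the graded ideal $I_\bullet\subset S_\bullet$ associated to $i$ is generated in degree 1. Write $\mathbb P^1_A=\mathrm{Proj}\,A[u,t]$, $0=\{u=0\}$, $\infty=\{t=0\}$, $1=[1:1]$. $D_YX\to\mathbb P^1_A$ is obtained by gluing $X\times_A\mathrm{Spec}\,A[u/t]$ over $\{u\ne\infty\}$ with $\mathrm{Proj}\,S'_\bullet$ over $\{u\neq0\}$, where $S'_\bullet=\bigoplus_{l\in\mathbb Z}I_\bullet^l(t/u)^{-l}$ ($I_\bullet^l=S_\bullet$ for $l\le0$; grading induced from $S_\bullet$), via the canonical identification of both with $X\times(\mathbb A^1_A-\{0\})$ over $\{u\ne0,\infty\}$. Let $t_1,\dots,t_M\in H^0(X,\mathcal L)$ generate $I_\bullet$ and $s_0,\dots,s_N\in H^0(X,\mathcal L)$ induce a closed immersion $X\to\mathbb P^N_A$. The map $(x,u)\mapsto([s_0(x):\dots:s_N(x):ut_1(x):\dots:ut_M(x)],[u:1])$ from $X\times\mathbb A^1_A$ to $\mathbb P^{N+M}_A\times_A\mathbb P^1_A$ extends to $D_YX$, and $\mathcal L'$ is the pullback to $D_YX$ of $\mathcal O_{\mathbb P^{N+M}}(1)\boxtimes\mathcal O_{\mathbb P^1}(1)$ (independent of choices; its restriction to the fiber over $1$ is $(X,\mathcal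 L)$). For a line bundle $\mathcal M$ on $Z$, $\mathbb V_Z(\mathcal M)=\mathrm{Spec}_Z\bigoplus_{n\ge0}\mathcal M^{\otimes n}$. The *natural transverse action* of $\mathbb G_m$ on $D_YX$ and $\mathbb V_{D_YX}(\mathcal L')$ (equivariant over $\mathbb P^1_A$ with its natural action $[u:t]\mapsto[\lambda u:t]$) is induced by the action of $\lambda$ on $\mathbb P^{N+M}_A\times\mathbb P^1_A$, $([x_0:\dots:x_{N+M}],[u:t])\mapsto([x_0:\dots:x_N:\lambda x_{N+1}:\dots:\lambda x_{N+M}],[\lambda u:t])$, and on $\mathbb V(\mathcal O(1)\boxtimes\mathcal O(1))$, $\mu(x_0,\dots,x_{N+M})\otimes(u,t)\mapsto\mu(x_0,\dots,x_N,\lambda x_{N+1},\dots,\lambda x_{N+M})\otimes(\lambda u,t)$. The induced action on sections sends $P_1(x_0,\dots,x_N,y_1,\dots,y_M)\otimes P_2(u,t)$ to $P_1(x_0,\dots,x_N,\lambda y_1,\dots,\lambda y_M)\otimes P_2(\lambda u,t)$, where $y_j=x_{N+j}$. *)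

(* Defs.v *)
From HB Require Import structures.
From mathcomp Require Import all_boot all_order all_algebra.
From mathcomp Require Import boolp classical_sets functions cardinality fsbigop.
From mathcomp Require Import topology.
From mathcomp Require mpoly.
(* mpoly's notations are incompatible with those of the topology library. *)
Import -(notations) mpoly.

Set Implicit Arguments.
Unset Strict Implicit.
Unset Printing Implicit Defensive.

Import GRing.Theory.
Local Open Scope classical_set_scope.
Local Open Scope ring_scope.

(** * Sheaves and locally ringed spaces

  A sheaf on [T] is given by its étalé space: the family [F] of its stalks, and
  the predicate [reg s x] stating that the (arbitrary) family of germs [s]
  coincides near [x] with a section of the sheaf.  The sections over an open
  set [U] are the families [s] with [reg s x] for all [x] in [U], two families
  being identified when they agree on [U]. *)

Record is_sheaf (T : topologicalType) (F : T -> Type)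
    (reg : (forall x, F x) -> T -> Prop) : Prop := IsSheaf {
  reg_near : forall s x, reg s x -> \forall y \near x, reg s y;
  reg_ext : forall s s' x,
    (\forall y \near x, s y = s' y) -> reg s x -> reg s' x;
  reg_germ : forall x a, exists s, reg s x /\ s x = a;
  reg_eq : forall s s' x, reg s x -> reg s' x -> s x = s' x ->
    \forall y \near x, s y = s' y
}.

Definition is_unit (R : comNzRingType) (a : R) : Prop := exists b, a * b = 1.

(* Locally ringed spaces over Spec A; the structure morphism to Spec A is given
   by the A-algebra structure of the structure sheaf. *)
Record lrs (A : comNzRingType) := Lrs {
  space :> topologicalType;
  stalk : space -> comAlgType A;
  reg : (forall x, stalk x) -> space -> Prop;
  reg_sheaf : is_sheaf reg;
  regC : forall (a : A) x, reg (fun y => a%:A) x;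
  regD : forall s t x, reg s x -> reg t x -> reg (fun y => s y + t y) x;
  regM : forall s t x, reg s x -> reg t x -> reg (fun y => s y * t y) x;
  stalk_local : forall x (a : stalk x), is_unit a \/ is_unit (1 - a)
}.
Arguments stalk {A} l x : rename.
Arguments reg {A l} s x : rename.

Definition functions (A : comNzRingType) (Z : lrs A) := forall x, stalk Z x.

Record mor (A : comNzRingType) (Z W : lrs A) := Mor {
  mfun :> Z -> W;
  mfun_continuous : continuous mfun;
  comor : forall x, {lrmorphism stalk W (mfun x) -> stalk Z x};
  comor_reg : forall (s : functions W) x,
    reg s (mfun x) -> reg (fun y => comor y (s (mfun y))) x;
  comor_local : forall x a, is_unit (comor x a) -> is_unit a
}.
Arguments comor {A Z W} m x.

Definition pull (A : comNzRingType) (Z W : lrs A) (f : mor Z W)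
    (s : functions W) : functions Z := fun x => comor f x (s (f x)).

Section Composition.
Variables (A : comNzRingType) (Z W V : lrs A) (g : mor W V) (f : mor Z W).

Let comp_fun : Z -> V := g \o f.
Let comp_comor x : {lrmorphism stalk V (comp_fun x) -> stalk Z x} :=
  [the {lrmorphism _ -> _} of comor f x \o comor g (f x)].

Fact comp_continuous : continuous comp_fun.
Proof. by move=> x; apply: continuous_comp; exact: mfun_continuous. Qed.

Fact comp_reg (s : functions V) x :
  reg s (comp_fun x) -> reg (fun y => comp_comor y (s (comp_fun y))) x.
Proof.
move=> sr; apply: (@comor_reg _ _ _ f (fun y => comor g y (s (g y)))).
exact: comor_reg.
Qed.

Fact comp_local x a : is_unit (comp_comor x a) -> is_unit a.
Proof. by move=> u; apply: comor_local; apply: comor_local u. Qed.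

Definition comp_mor : mor Z V := Mor comp_continuous comp_reg comp_local.
End Composition.

(* Equality of morphisms: germs live in stalks depending on the base point, so
   the comorphisms are compared through arbitrary families of germs. *)
Definition mor_eq (A : comNzRingType) (Z W : lrs A) (f g : mor Z W) : Prop :=
  (forall x, f x = g x) /\ (forall s, pull f s = pull g s).

Definition mor_eq_id (A : comNzRingType) (Z : lrs A) (f : mor Z Z) : Prop :=
  (forall x, f x = x) /\ (forall s, pull f s = s).

Definition closed_immersion (A : comNzRingType) (Z W : lrs A) (f : mor Z W) :
    Prop :=
  [/\ injective f,
      closed (range f),
      forall x (V : set Z), nbhs x V ->
        exists2 U : set W, nbhs (f x) U & f @^-1` U `<=` V
    & forall x b, exists a, comor f x a = b].

Definition open_immersion (A : comNzRingType) (Z W : lrs A) (f : mor Z W) :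
    Prop :=
  [/\ injective f,
      forall x (V : set Z), nbhs x V -> nbhs (f x) (f @` V)
    & forall x, bijective (comor f x)].

(** * Schemes *)

Definition prime_ideal (R : comNzRingType) (P : set R) : Prop :=
  [/\ P 0 /\ ~ P 1,
      forall a b, P a -> P b -> P (a + b),
      forall a b, P b -> P (a * b)
    & forall a b, P (a * b) -> P a \/ P b].

(* [th] identifies the open subspace [U] with the open subscheme D(f) of Spec R:
   it identifies the points, the topology and the stalks; by the sheaf axioms it
   then identifies the structure sheaves.  Only the values of [th r] on [U] are
   relevant. *)
Record is_spec (A : comNzRingType) (Z : lrs A) (U : set Z) (R : comNzRingType)
    (f : R) (th : R -> functions Z) : Prop := IsSpec {
  spec_open : open U;
  spec_reg : forall r z, U z -> reg (th r) z;
  spec1 : forall z, U z -> th 1 z = 1;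
  specD : forall r r' z, U z -> th (r + r') z = th r z + th r' z;
  specM : forall r r' z, U z -> th (r * r') z = th r z * th r' z;
  spec_f : forall z, U z -> is_unit (th f z);
  spec_inj : forall z z', U z -> U z' ->
    (forall r, is_unit (th r z) <-> is_unit (th r z')) -> z = z';
  spec_surj : forall P, prime_ideal P -> ~ P f ->
    exists2 z, U z & forall r, P r <-> ~ is_unit (th r z);
  spec_nbhs : forall z V, U z -> nbhs z V -> exists2 r, is_unit (th r z) &
    forall y, U y -> is_unit (th r y) -> V y;
  spec_frac : forall z (c : stalk Z z), U z -> exists r q,
    is_unit (th q z) /\ c * th q z = th r z;
  spec_zero : forall z r, U z -> th r z = 0 -> exists q,
    is_unit (th q z) /\ q * r = 0
}.

Definition scheme (A : comNzRingType) (Z : lrs A) : Prop :=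
  forall z : Z, exists (U : set Z) (R : comNzRingType) th,
    U z /\ is_spec U (1 : R) th.

(* Z = W x_A Spec A[v] with first projection p, i.e. the relative spectrum of
   O_W[v]. *)
Definition is_line_over (A : comNzRingType) (Z W : lrs A) (p : mor Z W)
    (v : functions Z) : Prop :=
  (forall z, reg v z) /\
  forall (U : set W) (R : comNzRingType) th, is_spec U (1 : R) th ->
    is_spec (p @^-1` U) (1 : {poly R})
      (fun q z => \sum_(k < size q) pull p (th q`_k) z * v z ^+ k).

(* Z = G_m x_A W with second projection p and coordinate lam on G_m: the open
   subscheme where lam is invertible in the affine line over W. *)
Definition is_Gm_times (A : comNzRingType) (Z W : lrs A) (p : mor Z W)
    (lam : functions Z) : Prop :=
  (forall z, reg lam z) /\
  forall (U : set W) (R : comNzRingType) th, is_spec U (1 : R) th ->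
    is_spec (p @^-1` U) ('X : {poly R})
      (fun q z => \sum_(k < size q) pull p (th q`_k) z * lam z ^+ k).

(** * Line bundles

  A line bundle L is given together with its tensor powers, as the sheaf of
  graded algebras S = (+)_(n >= 0) L^n whose relative spectrum is V(L); [homog n]
  is the summand of degree n.  The fibre of L at x is generated by e when the
  stalk of S is the polynomial algebra O_x[e] with its grading. *)

Definition generator (R : comNzRingType) (B : comAlgType R)
    (homog : nat -> set B) (e : B) : Prop :=
  bijective (horner_alg e) /\
  forall n w, homog n w <-> exists c : R, w = c *: e ^+ n.

Record line_bundle (A : comNzRingType) (Z : lrs A) := LineBundle {
  alg : forall x : Z, comAlgType (stalk Z x);
  homog : forall x, nat -> set (alg x);
  lreg : (forall x, alg x) -> Z -> Prop;
  lreg_sheaf : is_sheaf lreg;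
  lreg1 : forall x, lreg (fun y => 1) x;
  lregD : forall s t x, lreg s x -> lreg t x -> lreg (fun y => s y + t y) x;
  lregM : forall s t x, lreg s x -> lreg t x -> lreg (fun y => s y * t y) x;
  lregZ : forall (a : functions Z) s x,
    reg a x -> lreg s x -> lreg (fun y => a y *: s y) x;
  locally_trivial : forall x, exists2 e, lreg e x &
    \forall y \near x, generator (@homog y) (e y)
}.
Arguments alg {A Z} l x.
Arguments homog {A Z l x}.
Arguments lreg {A Z l}.

Definition germs (A : comNzRingType) (Z : lrs A) (L : line_bundle Z) : Type :=
  forall x : Z, alg L x.

Section GermsAlgebra.
Variables (A : comNzRingType) (Z : lrs A) (L : line_bundle Z).
Local Notation G := (germs L).
Implicit Types s t r : G.

HB.instance Definition _ := gen_eqMixin G.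
HB.instance Definition _ := gen_choiceMixin G.

Let addA : associative (fun s t : G => (fun x => s x + t x) : G).
Proof. by move=> s t r; apply: functional_extensionality_dep => x; rewrite addrA. Qed.
Let addC : commutative (fun s t : G => (fun x => s x + t x) : G).
Proof. by move=> s t; apply: functional_extensionality_dep => x; rewrite addrC. Qed.
Let add0 : left_id ((fun x => 0) : G) (fun s t : G => (fun x => s x + t x) : G).
Proof. by move=> s; apply: functional_extensionality_dep => x; rewrite add0r. Qed.
Let addN : left_inverse ((fun x => 0) : G) (fun s : G => (fun x => - s x) : G)
  (fun s t : G => (fun x => s x + t x) : G).
Proof. by move=> s; apply: functional_extensionality_dep => x; rewrite addNr. Qed.

HB.instance Definition _ := GRing.isZmodule.Build G addA addC add0 addN.

Let mulA : associative (fun s t : G => (fun x => s x * t x) : G).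
Proof. by move=> s t r; apply: functional_extensionality_dep => x; rewrite mulrA. Qed.
Let mulC : commutative (fun s t : G => (fun x => s x * t x) : G).
Proof. by move=> s t; apply: functional_extensionality_dep => x; rewrite mulrC. Qed.
Let mul1 : left_id ((fun x => 1) : G) (fun s t : G => (fun x => s x * t x) : G).
Proof. by move=> s; apply: functional_extensionality_dep => x; rewrite mul1r. Qed.
Let mulD : left_distributive (fun s t : G => (fun x => s x * t x) : G)
  (fun s t : G => (fun x => s x + t x) : G).
Proof. by move=> s t r; apply: functional_extensionality_dep => x; rewrite mulrDl. Qed.

HB.instance Definition _ :=
  GRing.Zmodule_isComPzRing.Build G mulA mulC mul1 mulD.

Let scale (a : A) s : G := fun x => (a%:A : stalk Z x) *: s x.
Let scaleA a b s : scale a (scale b s) = scale (a * b) s.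
Proof.
apply: functional_extensionality_dep => x; rewrite /scale !scalerA.
by rewrite -scalerAl mul1r scalerA.
Qed.
Let scale1 : left_id 1 scale.
Proof.
by move=> s; apply: functional_extensionality_dep => x; rewrite /scale !scale1r.
Qed.
Let scaleDr : right_distributive scale +%R.
Proof.
by move=> a s t; apply: functional_extensionality_dep => x; rewrite /scale scalerDr.
Qed.
Let scaleDl s : {morph scale^~ s : a b / a + b}.
Proof.
by move=> a b; apply: functional_extensionality_dep => x; rewrite /scale !scalerDl.
Qed.

HB.instance Definition _ :=
  GRing.Zmodule_isLmodule.Build A G scaleA scale1 scaleDr scaleDl.
End GermsAlgebra.

(* H^0(Z, L^n) *)
Definition H0 (A : comNzRingType) (Z : lrs A) (L : line_bundle Z) (n : nat) :
    set (germs L) :=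
  [set s | forall x, lreg s x /\ homog n (s x)].
Arguments H0 {A Z} L n.

(* A morphism of graded algebras over f carrying local generators of M to local
   generators of L, i.e. an isomorphism of L with the pullback f^*M. *)
Record lbmor (A : comNzRingType) (Z W : lrs A) (f : mor Z W)
    (L : line_bundle Z) (M : line_bundle W) := LBMor {
  lbfun : forall x, {rmorphism alg M (f x) -> alg L x};
  lbfunZ : forall x (a : stalk W (f x)) w,
    lbfun x (a *: w) = comor f x a *: lbfun x w;
  lbfun_reg : forall (s : germs M) x,
    lreg s (f x) -> lreg (fun y => lbfun y (s (f y))) x;
  lbfun_generator : forall x w,
    generator homog w -> generator homog (lbfun x w)
}.

Definition lpull (A : comNzRingType) (Z W : lrs A) (f : mor Z W)
    (L : line_bundle Z) (M : line_bundle W) (phi : lbmor f L M)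
    (s : germs M) : germs L := fun x => lbfun phi x (s (f x)).

(* T = L (x) M; [tmul] is the universal bilinear map L x M -> T (its values on
   pairs that are not both of degree 1 are irrelevant). *)
Record tensor_product (A : comNzRingType) (Z : lrs A)
    (T L M : line_bundle Z) := TensorProduct {
  tmul : forall x, alg L x -> alg M x -> alg T x;
  tmulDl : forall x (a b : alg L x) (c : alg M x),
    homog 1%N a -> homog 1%N b -> homog 1%N c ->
    tmul (a + b) c = tmul a c + tmul b c;
  tmulDr : forall x (a : alg L x) (b c : alg M x),
    homog 1%N a -> homog 1%N b -> homog 1%N c ->
    tmul a (b + c) = tmul a b + tmul a c;
  tmulZl : forall x (k : stalk Z x) (a : alg L x) (b : alg M x),
    homog 1%N a -> homog 1%N b -> tmul (k *: a) b = k *: tmul a b;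
  tmulZr : forall x (k : stalk Z x) (a : alg L x) (b : alg M x),
    homog 1%N a -> homog 1%N b -> tmul a (k *: b) = k *: tmul a b;
  tmul_generator : forall x (a : alg L x) (b : alg M x),
    generator homog a -> generator homog b -> generator homog (tmul a b);
  tmul_reg : forall (s : germs L) (t : germs M) x,
    lreg s x -> lreg t x -> lreg (fun y => tmul (s y) (t y)) x
}.

Definition tsec (A : comNzRingType) (Z : lrs A) (T L M : line_bundle Z)
    (b : tensor_product T L M) (s : germs L) (t : germs M) : germs T :=
  fun x => tmul b (s x) (t x).

(* w, in the stalk of L^n, is a generator of L^n *)
Definition nonvanishing (A : comNzRingType) (Z : lrs A) (L : line_bundle Z)
    (z : Z) (n : nat) (w : alg L z) : Prop :=
  exists e c, [/\ generator homog e, is_unit c & w = c *: e ^+ n].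
Arguments nonvanishing {A Z L z} n w.

(** * Proj *)

(* The operations and the homogeneous components of a graded ring; this is all
   that is needed to describe its Proj. *)
Record graded_ring := GradedRing {
  gcar :> zmodType;
  gmul : gcar -> gcar -> gcar;
  gdeg : nat -> set gcar
}.
Arguments gmul {g}.
Arguments gdeg {g}.

(* The homogeneous elements of a homogeneous prime ideal not containing the
   irrelevant ideal. *)
Definition homogeneous_prime (R : graded_ring) (P : set R) : Prop :=
  [/\ P 0,
      forall n a b, gdeg n a -> gdeg n b -> P a -> P b -> P (a + b),
      forall n m a b, gdeg n a -> gdeg m b -> P b -> P (gmul a b),
      forall n m a b, gdeg n a -> gdeg m b -> P (gmul a b) -> P a \/ P b
    & exists n a, [/\ (0 < n)%N, gdeg n a & ~ P a]].

(* (Z, O) = (Proj R, O(1)), for R such that Proj R is covered by the D_+(f) with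
   f of degree 1 (so that O(1) is a line bundle with powers O(n)); [th] maps
   a homogeneous element of degree n to the corresponding section of O(n). *)
Record is_proj (A : comNzRingType) (Z : lrs A) (O : line_bundle Z)
    (R : graded_ring) (th : R -> germs O) : Prop := IsProj {
  proj_sec : forall n a, gdeg n a -> H0 O n (th a);
  projD : forall n a b, gdeg n a -> gdeg n b -> th (a + b) = th a + th b;
  projM : forall n m a b, gdeg n a -> gdeg m b ->
    th (gmul a b) = th a * th b;
  proj_irrelevant : forall z, exists n a,
    [/\ (0 < n)%N, gdeg n a & nonvanishing n (th a z)];
  proj_inj : forall z z',
    (forall n a, gdeg n a ->
      (nonvanishing n (th a z) <-> nonvanishing n (th a z'))) -> z = z';
  proj_surj : forall P, homogeneous_prime P ->
    exists z, forall n a, gdeg n a -> (P a <-> ~ nonvanishing n (th a z));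
  proj_nbhs : forall z V, nbhs z V -> exists n a,
    [/\ (0 < n)%N, gdeg n a, nonvanishing n (th a z)
      & forall y, nonvanishing n (th a y) -> V y];
  proj_frac : forall z (c : stalk Z z), exists n a b,
    [/\ gdeg n a, gdeg n b, nonvanishing n (th b z)
      & c *: th b z = th a z];
  proj_zero : forall z n a, gdeg n a -> th a z = 0 -> exists m b,
    [/\ gdeg m b, nonvanishing m (th b z) & gmul b a = 0]
}.

Definition poly_ring (A : comNzRingType) (n : nat) : graded_ring :=
  @GradedRing (mpoly.mpoly n A) *%R
    (fun d => [set q | q \is mpoly.ishomog1 d mpoly.mdeg]).

(* (P, O) = (P^(n-1)_A, O(1)) with homogeneous coordinates x_0, ..., x_(n-1). *)
Definition is_projective_space (A : comNzRingType) (n : nat) (P : lrs A)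
    (O : line_bundle P) (x : 'I_n -> germs O) : Prop :=
  @is_proj A P O (poly_ring A n)
    (fun q z => mpoly.mmap (fun a : A => (a%:A : stalk P z)%:A)
                           (fun j => x j z) q).

Definition projective (A : comNzRingType) (X : lrs A) : Prop :=
  exists (n : nat) (P : lrs A) (O : line_bundle P) (x : 'I_n.+1 -> germs O)
    (f : mor X P), is_projective_space x /\ closed_immersion f.

(* [s_0 : ... : s_N] is a closed immersion of X in P^N_A (in particular L is the
   pullback of O(1)). *)
Definition induces_closed_immersion (A : comNzRingType) (X : lrs A)
    (L : line_bundle X) (N : nat) (s : 'I_N.+1 -> germs L) : Prop :=
  exists (P : lrs A) (O : line_bundle P) (x : 'I_N.+1 -> germs O)
    (f : mor X P) (phi : lbmor f L O),
    [/\ is_projective_space x, closed_immersion f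
      & forall j, lpull phi (x j) = s j].

(* For X projective, an immersion of X in P^N_A is a closed immersion. *)
Definition very_ample (A : comNzRingType) (X : lrs A) (L : line_bundle X) :
    Prop :=
  exists (N : nat) (s : 'I_N.+1 -> germs L), induces_closed_immersion s.

(** * Hyperplane sections and the extended Rees algebra *)

Section Ideal.
Variables (A : comNzRingType) (X Y : lrs A) (i : mor Y X) (L : line_bundle X).

(* I_n: the sections of L^n whose restriction to Y is zero *)
Definition ideal (n : nat) : set (germs L) :=
  [set s | H0 L n s /\ forall y, exists e c,
     [/\ generator homog e, s (i y) = c *: e ^+ n & comor i y c = 0]].

Definition hyperplane_section : Prop :=
  forall n s, ideal n s ->
    match n with
    | 0 => s = 0
    | m.+1 => exists k (a b : 'I_k -> germs L),
        (forall j, ideal 1 (a j) /\ H0 L m (b j)) /\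
        s = \sum_j a j * b j
    end.

Definition generates_ideal (M : nat) (t : 'I_M -> germs L) : Prop :=
  (forall j, ideal 1 (t j)) /\
  forall n s, ideal n s ->
    match n with
    | 0 => s = 0
    | m.+1 => exists b : 'I_M -> germs L,
        (forall j, H0 L m (b j)) /\ s = \sum_j t j * b j
    end.

(* the degree n part of the l-th power of the ideal I of S *)
Fixpoint ideal_pow (l n : nat) : set (germs L) :=
  match l with
  | 0 => H0 L n
  | l'.+1 => [set s | exists k (d : 'I_k -> nat) (a b : 'I_k -> germs L),
      (forall j, [/\ (d j <= n)%N, ideal (d j) (a j)
                   & ideal_pow l' (n - d j) (b j)]) /\
      s = \sum_j a j * b j]
  end.

Definition ideal_powz (l : int) (n : nat) : set (germs L) :=
  match l with Posz k => ideal_pow k n | Negz _ => H0 L n end.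

(* S' = (+)_l I^l tau^(-l), inside the Laurent polynomials over S: the family a
   stands for the sum of the a_l tau^(-l). *)
Definition rees : graded_ring :=
  @GradedRing (int -> germs L)
    (fun a b k => \sum_(l \in [set: int]) a l * b (k - l))
    (fun n => [set a | finite_set [set l | a l <> 0] /\
                       forall l, ideal_powz l n (a l)]).

Definition rees_tau : rees := fun l => if l == -1 then 1 else 0.
End Ideal.

(** * The deformation to the projective completion of the cone *)

(* sum_l v^l p^*(a_l), the function v being invertible at z with inverse v' *)
Definition laurent_eval (A : comNzRingType) (U X : lrs A) (p : mor U X)
    (L0 : line_bundle U) (L : line_bundle X) (phi : lbmor p L0 L) (z : U)
    (v v' : stalk U z) (a : int -> germs L) : alg L0 z :=
  \sum_(l \in [set: int])
    (match l with Posz k => v ^+ k | Negz k => v' ^+ k.+1 end) *: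
    lpull phi (a l) z.

Section Deformation.
Variables (A : comNzRingType) (X Y : lrs A) (i : mor Y X) (L : line_bundle X).
Variables (N M : nat) (s : 'I_N.+1 -> germs L) (t : 'I_M -> germs L).

Record deformation := Deformation {
  (* X x Spec A[v], where v = u/t *)
  U0 : lrs A;
  U0p : mor U0 X;
  U0v : functions U0;
  U0_line : is_line_over U0p U0v;
  U0L : line_bundle U0;
  U0pL : lbmor U0p U0L L;
  (* Proj S', where tau = t/u *)
  U1 : lrs A;
  U1O : line_bundle U1;
  U1th : rees i L -> germs U1O;
  U1_proj : is_proj U1th;
  U1tau : functions U1;
  U1tauE : forall z, U1th (rees_tau i L) z = (U1tau z)%:A;
  (* their gluing along v <> 0 and tau <> 0: on the overlap, the quotient of
     elements a and b of degree n of S' is the quotient of the corresponding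
     sections of L^n on X x Spec A[v, 1/v], with tau = 1/v *)
  DYX :> lrs A;
  j0 : mor U0 DYX;
  j1 : mor U1 DYX;
  j0_open : open_immersion j0;
  j1_open : open_immersion j1;
  cover : forall d, range j0 d \/ range j1 d;
  overlap0 : forall z, range j1 (j0 z) <-> is_unit (U0v z);
  overlap1 : forall z, range j0 (j1 z) <-> is_unit (U1tau z);
  gluing : forall z0 z1, j0 z0 = j1 z1 -> forall n (a b : rees i L),
    gdeg n a -> gdeg n b -> nonvanishing n (U1th b z1) ->
    forall (c : functions DYX) v', U0v z0 * v' = 1 ->
    pull j1 c z1 *: U1th b z1 = U1th a z1 ->
    pull j0 c z0 *: laurent_eval U0pL (U0v z0) v' b =
      laurent_eval U0pL (U0v z0) v' a;
  (* the projection to P^1, with homogeneous coordinates [u : t] *)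
  P1 : lrs A;
  P1O : line_bundle P1;
  P1x : 'I_2 -> germs P1O;
  P1_space : is_projective_space P1x;
  toP1 : mor DYX P1;
  L2 : line_bundle DYX;
  toP1L : lbmor toP1 L2 P1O;
  su := lpull toP1L (P1x ord0);
  st := lpull toP1L (P1x ord_max);
  toP1_U0 : forall z (c : functions DYX),
    pull j0 c z = U0v z -> su (j0 z) = c (j0 z) *: st (j0 z);
  toP1_U1 : forall z (c : functions DYX),
    pull j1 c z = U1tau z -> st (j1 z) = c (j1 z) *: su (j1 z);
  (* the projection to P^(N+M), extending [s_0 : ... : s_N : v t_1 : ... : v t_M]
     from X x Spec A[v] *)
  PNM : lrs A;
  PNMO : line_bundle PNM;
  PNMx : 'I_(N.+1 + M) -> germs PNMO;
  PNM_space : is_projective_space PNMx;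
  toPNM : mor DYX PNM;
  L1 : line_bundle DYX;
  toPNML : lbmor toPNM L1 PNMO;
  sx j := lpull toPNML (PNMx (lshift M j));
  sy j := lpull toPNML (PNMx (rshift N.+1 j));
  j0L : lbmor j0 U0L L1;
  toPNM_x : forall j, lpull j0L (sx j) = lpull U0pL (s j);
  toPNM_y : forall j, lpull j0L (sy j) =
    (fun z => U0v z *: lpull U0pL (t j) z);
  (* L' = O(1) (x) O(1) restricted to DYX *)
  L' : line_bundle DYX;
  L'_tensor : tensor_product L' L1 L2
}.

Arguments U0p d0 : clear implicits.
Arguments U0v d0 : clear implicits.
Arguments j0 d0 : clear implicits.
Arguments j1 d0 : clear implicits.
Arguments toP1 d0 : clear implicits.
Arguments toPNM d0 : clear implicits.
Arguments su d0 : clear implicits.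
Arguments st d0 : clear implicits.
Arguments sx d0 j : clear implicits.
Arguments sy d0 j : clear implicits.
Arguments L' d0 : clear implicits.
Arguments L'_tensor d0 : clear implicits.

Variable D : deformation.

(* The fibre over 1 = [1 : 1], i.e. v = 1, identified with (X, L) by means of
   the section sigma of X x Spec A[v] -> X. *)
Record fibre_one := FibreOne {
  sigma : mor X (U0 D);
  sigma_section : mor_eq_id (comp_mor (U0p D) sigma);
  sigma_one : pull sigma (U0v D) = fun x => 1;
  oneL : lbmor (comp_mor (j0 D) sigma) L (L' D);
  oneLE : forall j, lpull oneL (tsec (L'_tensor D) (sx D j) (st D)) = s j
}.

(* The fibre over infinity = {t = 0}: the closed subscheme defined by t, i.e. by
   the function h with t = h u. *)
Record fibre_infty := FibreInfty {
  Dinf :> lrs A;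
  kinf : mor Dinf D;
  kinf_closed : closed_immersion kinf;
  kinf_range : forall d, range kinf d <-> ~ nonvanishing 1 (st D d);
  kinf_ideal : forall z (c : stalk D (kinf z)), comor kinf z c = 0 <->
    exists b h, st D (kinf z) = h *: su D (kinf z) /\ c = b * h;
  Linf : line_bundle Dinf;
  kinfL : lbmor kinf Linf (L' D)
}.

(* The action a : G_m x D -> D together with its lift to V(L'), i.e. an
   isomorphism of a^*L' with pr^*L'. *)
Record transverse_action := TransverseAction {
  GD : lrs A;
  GDpr : mor GD D;
  GDlam : functions GD;
  GD_prod : is_Gm_times GDpr GDlam;
  GDL : line_bundle GD;
  GDprL : lbmor GDpr GDL (L' D);
  act : mor GD D;
  actL : lbmor act GDL (L' D);
  act_xt : forall j, let w := tsec (L'_tensor D) (sx D j) (st D) in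
    lpull actL w = lpull GDprL w;
  act_xu : forall j, let w := tsec (L'_tensor D) (sx D j) (su D) in
    lpull actL w = (fun z => GDlam z *: lpull GDprL w z);
  act_yt : forall j, let w := tsec (L'_tensor D) (sy D j) (st D) in
    lpull actL w = (fun z => GDlam z *: lpull GDprL w z);
  act_yu : forall j, let w := tsec (L'_tensor D) (sy D j) (su D) in
    lpull actL w = (fun z => GDlam z ^+ 2 *: lpull GDprL w z)
}.

Arguments kinf f : clear implicits.
Arguments kinfL f : clear implicits.
Arguments GDpr t : clear implicits.
Arguments GDprL t : clear implicits.
Arguments GDlam t : clear implicits.
Arguments act t : clear implicits.
Arguments actL t : clear implicits.

(* G_m x D_infty and the morphism id x kinf to G_m x D, with the induced
   morphism of line bundles. *)
Record Gm_fibre_infty (G : transverse_action) (K : fibre_infty) :=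
  GmFibreInfty {
  GK : lrs A;
  GKpr : mor GK K;
  GKlam : functions GK;
  GK_prod : is_Gm_times GKpr GKlam;
  GKL : line_bundle GK;
  GKprL : lbmor GKpr GKL (Linf K);
  GKk : mor GK (GD G);
  GKk_pr : mor_eq (comp_mor (GDpr G) GKk) (comp_mor (kinf K) GKpr);
  GKk_lam : pull GKk (GDlam G) = GKlam;
  GKkL : lbmor GKk GKL (GDL G);
  GKkLE : forall r,
    lpull GKkL (lpull (GDprL G) r) = lpull GKprL (lpull (kinfL K) r)
}.
Arguments GKpr {G K} g.
Arguments GKlam {G K} g.
Arguments GKprL {G K} g.
Arguments GKk {G K} g.
Arguments GKkL {G K} g.
End Deformation.
Arguments U0v {A X Y i L N M s t} d0 : rename.
Arguments U1th {A X Y i L N M s t} d0 : rename.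
Arguments U1tau {A X Y i L N M s t} d0 : rename.
Arguments P1x {A X Y i L N M s t} d0 : rename.
Arguments PNMx {A X Y i L N M s t} d0 : rename.
Arguments su {A X Y i L N M s t} d0 : rename.
Arguments st {A X Y i L N M s t} d0 : rename.
Arguments sx {A X Y i L N M s t} d0 j : rename.
Arguments sy {A X Y i L N M s t} d0 j : rename.
Arguments GDlam {A X Y i L N M s t D} t0 : rename.
Arguments GKlam {A X Y i L N M s t D G K} g : rename.


(** * Weight decompositions *)

(* G_m acts on the section r by the character lambda |-> lambda^m *)
Definition has_weight (A : comNzRingType) (G Z : lrs A) (pr a : mor G Z)
    (lam : functions G) (LG : line_bundle G) (L : line_bundle Z)
    (prL : lbmor pr LG L) (aL : lbmor a LG L) (m : nat) (r : germs L) : Prop :=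
  forall w, lpull aL r w = lam w ^+ m *: lpull prL r w.

Definition submodule (A : comNzRingType) (V : lmodType A) (E : set V) : Prop :=
  E 0 /\ forall (a : A) x y, E x -> E y -> E (a *: x + y).

Definition direct_sum (A : comNzRingType) (V : lmodType A) (K : nat)
    (E : 'I_K -> set V) (H : set V) : Prop :=
  (forall k, submodule (E k) /\ E k `<=` H) /\
  forall x, H x -> exists! e : 'I_K -> V,
    (forall k, E k (e k)) /\ x = \sum_k e k.

Definition field_or_Z (A : comNzRingType) : Prop :=
  (forall a : A, a != 0 -> exists b, a * b = 1) \/
  (exists f : {rmorphism int -> A}, bijective f).

(* Main.v *)
(* On X x Spec A[v] the bundle L' is the pullback of L, and E_(l,n) consists of the sections
   v^(n+l) a with a in the degree n part of I^l; such a section extends to D_Y X because over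
   Proj S' it becomes the element a tau^(-l) of S'.  Conversely, for n >> 0 a section of L'^n
   restricts over Proj S' to an element of S' of degree n, a finite sum of terms a_l tau^(-l),
   where l <= n since I is generated in degree 1, and regularity along v = 0 forces l >= -n.
   On E_(l,n) the restriction to the fibre at 1 is a, and the restriction to the fibre at
   infinity is the class of a tau^(-l) modulo tau S', which vanishes iff a lies in I^(l+1).

   That sections come from S', and that an element of S' vanishing on the fibre at infinity
   lies in tau S', both in large degree, is obtained without cohomology from a saturation
   property of Noetherian graded modules: for submodules N' of N, in large degree, an element
   of N multiplied into N' by powers of the variables lies in N', and a family of elements
   n_k of N such that the fractions n_k / x_k^K agree modulo N' comes from a single element
   of N. *)
From HB Require Import structures.
Require Import Defs.
From mathcomp Require Import all_boot all_order all_algebra.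
From mathcomp Require Import boolp classical_sets functions cardinality fsbigop.
From mathcomp Require Import topology ring zify.
From mathcomp Require mpoly.
Import -(notations) mpoly.

Set Implicit Arguments.
Unset Strict Implicit.
Unset Printing Implicit Defensive.

Import Order.TTheory GRing.Theory Num.Theory.
Local Open Scope classical_set_scope.
Local Open Scope ring_scope.

(** * Ascending chain conditions *)

(** The Noetherian input comes from A alone: its ideals are principal, so modules spanned by
    finitely many elements, and by Hilbert's argument those generated from them by commuting
    operators, satisfy the chain condition. However, neither S nor S' is given by finitely many
    generators: the monomials in the s_j span H^0(X, L^n) only for n at least some n0.
    Multiplication by the s_j^n0 embeds S' in finitely many copies of a finitely generated module,
    and the chain condition descends along this embedding.

    The data identify L' with the pullback of L only over X x Spec A[v]. Its identification with
    O(1) over Proj S' and the weights of the action are carried to the points at infinity by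
    density: the fibre there is locally cut out by the nonzerodivisor tau.

    Stalks depend on the point, and gluing only provides equalities of points. Germs are therefore
    handled as values of arbitrary families on the whole space, and many statements quantify over
    such families instead of transporting a germ along an equality. *)

Section AscendingChains.
Variables (A : comNzRingType) (V : lmodType A).

Lemma submoduleB (E : set V) u v : submodule E -> E u -> E v -> E (u - v).
Proof. by move=> [_ EL] Eu Ev; rewrite addrC -scaleN1r; apply: EL. Qed.

Lemma submoduleD (E : set V) u v : submodule E -> E u -> E v -> E (u + v).
Proof. by move=> [_ EL] Eu Ev; rewrite -[u]scale1r; apply: EL. Qed.

Lemma submodule_sum (E : set V) I (l : seq I) (P : pred I) (w : I -> V) :
  submodule E -> (forall i, P i -> E (w i)) -> E (\sum_(i <- l | P i) w i).
Proof.
move=> Es Ew; apply: big_ind => //; first exact: (proj1 Es).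
by move=> u v; exact: submoduleD.
Qed.

Lemma submoduleZ (E : set V) a u : submodule E -> E u -> E (a *: u).
Proof. by move=> [E0 EL] Eu; rewrite -[_ *: _]addr0; apply: EL. Qed.

Lemma chain_mono T (J : nat -> set T) : (forall k, J k `<=` J k.+1) ->
  forall k l, (k <= l)%N -> J k `<=` J l.
Proof.
move=> JS k l /subnK <-; elim: (l - k)%N => [|m IH] //=.
by rewrite addSn; apply: subset_trans IH _.
Qed.

Variable op : nat -> V -> V.
Hypothesis op_linear : forall i a u v, op i (a *: u + v) = a *: op i u + op i v.
Hypothesis opC : forall i j v, op i (op j v) = op j (op i v).

(** The operators [op i] with i < r act as the variables of a polynomial ring over A, so stable sets
    are the submodules over that ring, which is never formed. *)
Definition stable (r : nat) (J : set V) : Prop :=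
  submodule J /\ forall i v, (i < r)%N -> J v -> J (op i v).

Definition acc (r : nat) (W : set V) : Prop :=
  forall J : nat -> set V, (forall k, stable r (J k)) ->
    (forall k, J k `<=` J k.+1) -> (forall k, J k `<=` W) ->
    exists k1, forall k, (k1 <= k)%N -> J k `<=` J k1.

Lemma op0 i : op i 0 = 0.
Proof. by have := op_linear i (-1) 0 0; rewrite scaler0 addr0 scaleN1r addNr. Qed.

Lemma opD i u v : op i (u + v) = op i u + op i v.
Proof. by rewrite -[u]scale1r op_linear !scale1r. Qed.

Lemma iter_op_linear i j a u v :
  iter j (op i) (a *: u + v) = a *: iter j (op i) u + iter j (op i) v.
Proof. by elim: j => //= j ->; rewrite op_linear. Qed.

Lemma op_iterC i j k v : op k (iter j (op i) v) = iter j (op i) (op k v).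
Proof. by elim: j => //= j <-; rewrite opC. Qed.

Lemma op_sum i m (w : 'I_m -> V) : op i (\sum_(j < m) w j) = \sum_(j < m) op i (w j).
Proof. exact: (big_morph (op i) (opD i) (op0 i)). Qed.

Section HilbertStep.
Variables (r : nat) (W : set V).
Hypothesis (Wst : stable r W).

(** Values of polynomials of degree below d in the new variable [op r], with coefficients in W. The
    coefficients of such a value are not unique. *)
Definition poly_below (d : nat) : set V :=
  [set v | exists w : nat -> V, (forall j, W (w j)) /\
     v = \sum_(j < d) iter j (op r) (w j)].

Definition poly_ext : set V := [set v | exists d, poly_below d v].

Let Wsub : submodule W := proj1 Wst.

Lemma poly_below_stable d : stable r (poly_below d).
Proof.
split; last first.
  move=> i v ir [w [Ww ->]]; exists (op i \o w); split.
    by move=> j; apply: (proj2 Wst).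
  by rewrite op_sum; apply: eq_bigr => j _ /=; rewrite op_iterC.
split.
  exists (fun=> 0); split; first by move=> _; exact: (proj1 Wsub).
  rewrite big1 // => j _; elim: (j : nat) => //= k ->; exact: op0.
move=> a u v [w [Ww ->]] [w' [Ww' ->]].
exists (fun j => a *: w j + w' j); split; first by move=> j; exact: (proj2 Wsub).
rewrite scaler_sumr -big_split /=; apply: eq_bigr => j _.
by rewrite iter_op_linear.
Qed.

Lemma poly_belowS d : poly_below d `<=` poly_below d.+1.
Proof.
move=> v [w [Ww ->]]; exists (fun j => if (j < d)%N then w j else 0); split.
  by move=> j; case: ifP => // _; exact: (proj1 Wsub).
rewrite big_ord_recr /= ltnn.
rewrite (_ : iter d _ 0 = 0) ?addr0; last by elim: (d) => //= k ->; exact: op0.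
by apply: eq_bigr => j _; rewrite ltn_ord.
Qed.

Lemma poly_below_mono d e : (d <= e)%N -> poly_below d `<=` poly_below e.
Proof. exact: chain_mono poly_belowS d e. Qed.

Lemma poly_below_op d v : poly_below d v -> poly_below d.+1 (op r v).
Proof.
move=> [w [Ww ->]]; exists (fun j => if j is k.+1 then w k else 0); split.
  by case=> [|k] //; exact: (proj1 Wsub).
by rewrite big_ord_recl /= add0r op_sum.
Qed.

Lemma poly_ext_stable : stable r.+1 poly_ext.
Proof.
split.
  split; first by exists 0%N; exact: (proj1 (proj1 (poly_below_stable 0))).
  move=> a u v [d ud] [e ve]; exists (maxn d e).
  apply: (proj2 (proj1 (poly_below_stable _))).
    exact: poly_below_mono (leq_maxl _ _) _ ud.
  exact: poly_below_mono (leq_maxr _ _) _ ve.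
move=> i v; rewrite ltnS leq_eqVlt => /orP[/eqP ->|ir] [d vd].
  by exists d.+1; exact: poly_below_op.
by exists d; apply: (proj2 (poly_below_stable d)).
Qed.

Lemma poly_ext_sub : W `<=` poly_ext.
Proof.
move=> w Ww; exists 1%N; exists (fun=> w); split => //.
by rewrite big_ord_recl big_ord0 /= addr0.
Qed.

(** Hilbert's argument on leading coefficients. As polynomial representations are not unique, a
    leading coefficient in degree d is any w in W for which J k contains (op r)^d w plus some
    element of lower degree. *)
Lemma acc_poly_ext : acc r W -> acc r.+1 poly_ext.
Proof.
move=> Wacc J Jst JS JW.
have Jsub k : submodule (J k) := proj1 (Jst k).
have Jop k v : J k v -> J k (op r v) by apply: (proj2 (Jst k)).
pose lead k d : set V := [set w | W w /\
  exists2 u, poly_below d u & J k (iter d (op r) w + u)].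
have lead_st k d : stable r (lead k d).
  have [Bsub Bop] := poly_below_stable d.
  split.
    split.
      split; first exact: (proj1 Wsub).
      exists 0; first exact: (proj1 Bsub).
      rewrite addr0 (_ : iter d _ 0 = 0); first exact: (proj1 (Jsub k)).
      by elim: (d) => //= j ->; exact: op0.
    move=> a w w' [Ww [u Bu Ju]] [Ww' [u' Bu' Ju']].
    split; first exact: (proj2 Wsub).
    exists (a *: u + u'); first exact: (proj2 Bsub).
    rewrite iter_op_linear addrACA -scalerDr; exact: (proj2 (Jsub k)).
  move=> i w ir [Ww [u Bu Ju]]; split; first exact: (proj2 Wst).
  exists (op i u); first exact: Bop.
  by rewrite -op_iterC -opD; apply: (proj2 (Jst k)) => //; exact: ltnW.
have leadS k d : lead k d `<=` lead k.+1 d.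
  by move=> w [Ww [u Bu Ju]]; split => //; exists u => //; exact: JS.
have leadSd k d : lead k d `<=` lead k d.+1.
  move=> w [Ww [u Bu Ju]]; split => //; exists (op r u); first exact: poly_below_op.
  by rewrite /= -opD; exact: Jop.
have leadW k d : lead k d `<=` W by move=> w [].
have lead_mono k k' d d' : (k <= k')%N -> (d <= d')%N -> lead k d `<=` lead k' d'.
  move=> kk' dd'; apply: subset_trans (chain_mono (fun k => leadS k d) kk') _.
  exact: (chain_mono (leadSd k') dd').
(* The diagonal chain settles all degrees from k0 on at once. The degrees below k0 give finitely
   many chains, settled one by one in [col]. *)
have [k0 diag] : exists k0, forall k, (k0 <= k)%N -> lead k k `<=` lead k0 k0.
  apply: (Wacc (fun k => lead k k)) => // k.
  by apply: lead_mono; exact: leqnSn.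
have [k1 col] : exists k1, forall d, (d < k0)%N -> forall k, (k1 <= k)%N ->
    lead k d `<=` lead k1 d.
  elim: (k0) => [|m [k1 IH]]; first by exists 0%N.
  have [k2 k2P] := Wacc (lead^~ m) (lead_st^~ m) (leadS^~ m) (leadW^~ m).
  exists (maxn k1 k2) => d; rewrite ltnS leq_eqVlt => dm k; rewrite geq_max => /andP[k1k k2k].
  case/orP: dm => [/eqP ->|dm].
    by apply: subset_trans (k2P _ k2k) _; apply: lead_mono; rewrite ?leq_maxr.
  by apply: subset_trans (IH d dm _ k1k) _; apply: lead_mono; rewrite ?leq_maxl.
pose k2 := maxn k0 k1.
have leadE k d : (k2 <= k)%N -> lead k d `<=` lead k2 d.
  rewrite geq_max => /andP[k0k k1k]; case: (ltnP d k0) => dk0.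
    by apply: subset_trans (col d dk0 k k1k) _; apply: lead_mono; rewrite ?leq_maxr.
  apply: (@subset_trans _ (lead (maxn k d) (maxn k d))).
    by apply: lead_mono; rewrite ?leq_maxl ?leq_maxr.
  apply: subset_trans (diag _ _) _; first by rewrite leq_max k0k.
  by apply: lead_mono; rewrite ?leq_maxl.
exists k2 => k k2k v Jv.
have [d Bd] := JW _ _ Jv; elim: d v Jv Bd => [|d IH] v Jv [w [Ww vE]].
  by rewrite vE big_ord0; exact: (proj1 (Jsub k2)).
have [Bsub _] := poly_below_stable d.
have Bv : poly_below d (\sum_(j < d) iter j (op r) (w j)) by exists w.
have [_ [u Bu Ju]] : lead k2 d (w d).
  apply: (leadE k d k2k); split => //.
  exists (\sum_(j < d) iter j (op r) (w j)) => //.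
  by rewrite addrC; rewrite vE big_ord_recr in Jv.
(* Subtracting an element of J k2 with the same leading coefficient lowers the degree of v. *)
rewrite -(subrK (iter d (op r) (w d) + u) v); apply: submoduleD => //.
apply: IH.
  apply: submoduleB => //; exact: (chain_mono JS k2k).
rewrite vE big_ord_recr /= [X in _ - X]addrC opprD addrACA subrr addr0.
rewrite (_ : _ - u = \sum_(j < d) iter j (op r) (w j) - u) //.
exact: submoduleB.
Qed.
End HilbertStep.

Fixpoint ops_span (W : set V) (r : nat) : set V :=
  if r is r'.+1 then poly_ext r' (ops_span W r') else W.

Lemma ops_span_stable W r : submodule W -> stable r (ops_span W r).
Proof.
move=> Wsub; elim: r => [|r IH] /=; first by split.
exact: poly_ext_stable.
Qed.

Lemma ops_span_sub W r : submodule W -> W `<=` ops_span W r.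
Proof.
move=> Wsub; elim: r => [//|r IH] /=; apply: subset_trans IH _.
exact: poly_ext_sub.
Qed.

Lemma acc_ops_span W r : submodule W -> acc 0 W -> acc r (ops_span W r).
Proof.
move=> Wsub Wacc; elim: r => [//|r IH] /=.
by apply: acc_poly_ext => //; exact: ops_span_stable.
Qed.

(** The property shared by fields and Z from which all chain conditions below start. *)
Definition principal_ideals : Prop :=
  forall I : set A, I 0 -> (forall a x y, I x -> I y -> I (a * x + y)) ->
    exists2 g, I g & forall x, I x -> exists a, x = a * g.

Definition lin_span (g : nat -> V) (m : nat) : set V :=
  [set v | exists c : nat -> A, v = \sum_(j < m) c j *: g j].

Lemma lin_span_submodule g m : submodule (lin_span g m).
Proof.
split; first by exists (fun=> 0); rewrite big1 // => j _; rewrite scale0r.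
move=> a u v [c ->] [c' ->]; exists (fun j => a * c j + c' j).
rewrite scaler_sumr -big_split /=; apply: eq_bigr => j _.
by rewrite scalerA scalerDl.
Qed.

(** Induction on the number of generators: the coefficients of the last generator, over all stages
    of the chain, form an ideal whose generator h already occurs at some stage k0. Subtracting a
    multiple of the corresponding element leaves the span of the other generators. *)
Lemma acc_lin_span g m : principal_ideals -> acc 0 (lin_span g m).
Proof.
move=> Apid; elim: m => [|m IH] J Jst JS JW.
  exists 0%N => k _ v /JW[c ->]; rewrite big_ord0; exact: (proj1 (proj1 (Jst _))).
have Jsub k : submodule (J k) := proj1 (Jst k).
have Msub := lin_span_submodule g m.
pose I : set A := [set c | exists k u, lin_span g m u /\ J k (c *: g m + u)].
have I0 : I 0.
  exists 0%N, 0; split; first exact: (proj1 Msub).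
  by rewrite scale0r addr0; exact: (proj1 (Jsub _)).
have IL a x y : I x -> I y -> I (a * x + y).
  move=> [k [u [Mu Ju]]] [l [v [Mv Jv]]].
  exists (maxn k l), (a *: u + v); split; first exact: (proj2 Msub).
  rewrite scalerDl -scalerA addrACA -scalerDr; apply: (proj2 (Jsub _)).
    exact: chain_mono JS _ _ (leq_maxl _ _) _ Ju.
  exact: chain_mono JS _ _ (leq_maxr _ _) _ Jv.
have [h [k0 [u0 [Mu0 Ju0]]] hP] := Apid I I0 IL.
have [k1 k1P] : exists k1, forall k, (k1 <= k)%N ->
    J k `&` lin_span g m `<=` J k1 `&` lin_span g m.
  apply: IH => k; last by move=> v [].
    split => //; split; first by split; [exact: (proj1 (Jsub k))|exact: (proj1 Msub)].
    move=> a u v [Ju Mu] [Jv Mv].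
    by split; [exact: (proj2 (Jsub k))|exact: (proj2 Msub)].
  by move=> v [Jv Mv]; split => //; exact: JS.
exists (maxn k0 k1) => k; rewrite geq_max => /andP[k0k k1k] v Jv.
have [c vE] := JW _ _ Jv; rewrite big_ord_recr /= in vE.
have [a caE] : exists a, c m = a * h.
  apply: hP; exists k, (\sum_(j < m) c j *: g j); split; first by exists c.
  by rewrite addrC -vE.
set w := h *: g m + u0 in Ju0.
rewrite -(subrK (a *: w) v); apply: submoduleD => //; last first.
  by apply: submoduleZ => //; exact: chain_mono JS _ _ (leq_maxl _ _) _ Ju0.
apply: (chain_mono JS (leq_maxr k0 k1)).
suff: (J k1 `&` lin_span g m) (v - a *: w) by case.
apply: k1P k1k _ _; split.
  apply: submoduleB => //; apply: submoduleZ => //.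
  exact: chain_mono JS _ _ k0k _ Ju0.
rewrite vE /w scalerDr scalerA -caE opprD addrA addrK.
by apply: submoduleB => //; [exists c|exact: submoduleZ].
Qed.
End AscendingChains.

(** In a field any nonzero element of an ideal generates it. For Z a nonzero ideal is generated by
    the image under f of its least positive integer, by Euclidean division. *)
Lemma field_or_Z_principal (A : comNzRingType) : field_or_Z A -> principal_ideals A.
Proof.
move=> hA I I0 IL.
case: (pselect (exists2 x, I x & x != 0)) => [[x0 Ix0 x0n0]|noI]; last first.
  exists 0 => // x Ix; exists 0; rewrite mulr0; apply/eqP/negP => /negP xn0.
  by apply: noI; exists x.
case: hA => [Afield|[f [g fK gK]]].
  exists x0 => // x _; have [y x0y] := Afield _ x0n0.
  by exists (x * y); rewrite -mulrA [y * _]mulrC x0y mulr1.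
have IM a x : I x -> I (a * x) by move=> Ix; rewrite -[_ * _]addr0; apply: IL.
have fabs (z : int) : I (f z) -> I (f `|z|%N%:Z).
  case: (intP z) => [|n|n] // Iz.
  by rewrite abszN; have := IM (-1) _ Iz; rewrite mulN1r -rmorphN opprK.
pose P n := `[< (0 < n)%N /\ I (f n%:Z) >].
have exP : exists n, P n.
  exists `|g x0|%N; apply/asboolP; split; last by apply: fabs; rewrite gK.
  rewrite absz_gt0; apply: contra x0n0 => /eqP g0.
  by rewrite -(gK x0) g0 rmorph0.
case: (ex_minnP exP) => n /asboolP[n0 In] nmin.
exists (f n%:Z) => // x Ix; exists (f (g x %/ n%:Z)%Z).
rewrite -rmorphM -{1}(gK x); congr (f _).
suff mod0 : (g x %% n%:Z)%Z = 0 by rewrite {1}(divz_eq (g x) n%:Z) mod0 addr0.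
apply/eqP/negP => /negP mod0.
have Imod : I (f (g x %% n%:Z)%Z).
  have -> : (g x %% n%:Z)%Z = - (g x %/ n%:Z)%Z * n%:Z + g x.
    apply/eqP; rewrite mulNr addrC eq_sym subr_eq addrC; apply/eqP.
    exact: divz_eq.
  rewrite rmorphD rmorphM gK; exact: IL.
have nmod : (g x %% n%:Z)%Z >= 0 by rewrite modz_ge0 //; case: (n) n0.
have : P `|(g x %% n%:Z)%Z|%N.
  by apply/asboolP; split; [rewrite absz_gt0|exact: fabs].
move/nmin; rewrite leqNgt => /negP; apply.
by rewrite -ltz_nat gez0_abs // ltz_pmod // ltz_nat.
Qed.

(** * Saturation of graded submodules *)

Section Serre.
Variables (V : zmodType) (r : nat) (x : nat -> V -> V) (C : set (V -> V)).
Hypothesis xB : forall k u v, x k (u - v) = x k u - x k v.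
Hypothesis xC : forall k l v, x k (x l v) = x l (x k v).
Hypothesis CB : forall c u v, C c -> c (u - v) = c u - c v.
Hypothesis Cx : forall c k v, C c -> c (x k v) = x k (c v).

Definition subgroup (J : set V) : Prop := J 0 /\ forall u v, J u -> J v -> J (u - v).

Lemma subgroupN J u : subgroup J -> J u -> J (- u).
Proof. by move=> [J0 JB] Ju; rewrite -sub0r; apply: JB. Qed.

Lemma subgroupD J u v : subgroup J -> J u -> J v -> J (u + v).
Proof.
by move=> Js Ju Jv; rewrite -[v]opprK; apply: (proj2 Js) => //; exact: subgroupN.
Qed.

(** [C] collects operators of degree 0; in the application to S' they are the scalars of A and the
    multiplication by tau. *)
Definition graded_sub (N : nat -> set V) : Prop := forall n,
  [/\ subgroup (N n), forall c v, C c -> N n v -> N n (c v)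
    & forall k v, (k < r)%N -> N n v -> N n.+1 (x k v)].

Definition gle (N N' : nat -> set V) : Prop := forall n, N n `<=` N' n.

Definition graded_acc (N : nat -> set V) : Prop :=
  forall J : nat -> nat -> set V, (forall k, graded_sub (J k)) ->
    (forall k, gle (J k) (J k.+1)) -> (forall k, gle (J k) N) ->
    exists k1, forall k, (k1 <= k)%N -> gle (J k) (J k1).

Lemma graded_acc_sub N N1 : graded_acc N -> gle N1 N -> graded_acc N1.
Proof.
move=> Nacc N1N J Js JS JN1; apply: Nacc => // k n.
exact: subset_trans (JN1 k n) (N1N n).
Qed.

(** Noetherian induction downwards: if P failed at N0, every failure would have a strictly larger
    one, and dependent choice would build an infinite increasing chain. *)
Lemma graded_acc_ind N (P : (nat -> set V) -> Prop) : graded_acc N ->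
  (forall N', graded_sub N' -> gle N' N ->
    (forall N'', graded_sub N'' -> gle N' N'' -> gle N'' N -> ~ gle N'' N' -> P N'') ->
    P N') ->
  forall N', graded_sub N' -> gle N' N -> P N'.
Proof.
move=> Nacc step N0 N0s N0N; apply: contrapT => nP0.
pose T := {J : nat -> set V | [/\ graded_sub J, gle J N & ~ P J]}.
have [f fP] : {f : T -> T & forall t, gle (sval t) (sval (f t)) /\
    ~ gle (sval (f t)) (sval t)}.
  apply: (@choice T T (fun t t' => gle (sval t) (sval t') /\ ~ gle (sval t') (sval t))).
  move=> [J [Js JN nPJ]] /=; apply: contrapT => noJ.
  apply: nPJ; apply: step => // J' J's JJ' J'N nJ'J.
  apply: contrapT => nPJ'; apply: noJ.
  by exists (exist _ J' (And3 J's J'N nPJ')).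
pose t0 : T := exist _ N0 (And3 N0s N0N nP0).
pose J k := sval (iter k f t0).
have [k1 k1P] : exists k1, forall k, (k1 <= k)%N -> gle (J k) (J k1).
  apply: Nacc => k; rewrite /J.
  - by case: (iter k f t0) => ? [].
  - by rewrite iterS; case: (fP (iter k f t0)).
  - by case: (iter k f t0) => ? [].
have := k1P k1.+1 (leqnSn _); rewrite /J iterS.
by case: (fP (iter k1 f t0)).
Qed.

Lemma x0 k : x k 0 = 0.
Proof. by rewrite -[in LHS](subrr 0) xB subrr. Qed.

Lemma xN k v : x k (- v) = - x k v.
Proof. by rewrite -sub0r xB x0 sub0r. Qed.

Lemma xD k u v : x k (u + v) = x k u + x k v.
Proof. by rewrite -{1}[v]opprK xB xN opprK. Qed.

Lemma iter_xB k K u v : iter K (x k) (u - v) = iter K (x k) u - iter K (x k) v.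
Proof. by elim: K => //= K ->; rewrite xB. Qed.

Lemma iter_xD k K u v : iter K (x k) (u + v) = iter K (x k) u + iter K (x k) v.
Proof. by elim: K => //= K ->; rewrite xD. Qed.

Lemma iter_x0 k K : iter K (x k) 0 = 0.
Proof. by elim: K => //= K ->; rewrite x0. Qed.

Lemma x_iterC k l K v : x k (iter K (x l) v) = iter K (x l) (x k v).
Proof. by elim: K => //= K <-; rewrite xC. Qed.

Lemma iter_xC k l K L v : iter L (x k) (iter K (x l) v) = iter K (x l) (iter L (x k) v).
Proof. by elim: L => //= L ->; rewrite x_iterC. Qed.

Lemma graded_sub_iter N n k K v : graded_sub N -> (k < r)%N -> N n v ->
  N (n + K)%N (iter K (x k) v).
Proof.
move=> Ns kr Nv; elim: K => [|K IH] /=; first by rewrite addn0.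
by rewrite addnS; case: (Ns (n + K)%N) => _ _; apply.
Qed.

(* [torsion_free] and [extends_families] say that the degree n parts of the
   zeroth and first local cohomology of N/N' vanish; an element of
   H^0(Proj, (N/N')~(n)) is represented by a compatible family of its products
   with the K-th powers of the variables. *)
Definition torsion_free (N N' : nat -> set V) (n : nat) : Prop :=
  forall v, N n v -> (exists K, forall k, (k < r)%N -> N' (n + K)%N (iter K (x k) v)) ->
    N' n v.

Definition extends_families (N N' : nat -> set V) (n : nat) : Prop :=
  forall K (s : nat -> V),
    (forall k, (k < r)%N -> N (n + K)%N (s k)) ->
    (forall k l, (k < r)%N -> (l < r)%N ->
      N' (n + K + K)%N (iter K (x k) (s l) - iter K (x l) (s k))) ->
    exists2 v, N n v & forall k, (k < r)%N -> N' (n + K)%N (s k - iter K (x k) v).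

Definition saturated (N N' : nat -> set V) : Prop := exists n0, forall n, (n0 <= n)%N ->
  torsion_free N N' n /\ extends_families N N' n.

(** A compatible family is first lifted modulo N1. Its residues form a compatible family of N1
    modulo N', and lifting these corrects the first lift. *)
Lemma saturated_trans N N1 N' : graded_sub N -> graded_sub N1 -> graded_sub N' ->
  gle N1 N -> gle N' N1 -> saturated N N1 -> saturated N1 N' -> saturated N N'.
Proof.
move=> Ns N1s N's N1N N'N1 [n1 n1P] [n2 n2P]; exists (maxn n1 n2) => n.
rewrite geq_max => /andP[/n1P[T1 E1] /n2P[T2 E2]]; split.
  move=> v Nv [K Kv]; apply: T2; last by exists K.
  by apply: T1 => //; exists K => k kr; apply: N'N1; exact: Kv.
move=> K s Ns_ sC.
have [v Nv vP] := E1 K s Ns_ (fun k l kr lr => N'N1 _ _ (sC k l kr lr)).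
have [k l kr lr|w N1w wP] := E2 K (fun k => s k - iter K (x k) v) vP.
  by rewrite !iter_xB [iter K (x k) (iter _ _ v)]iter_xC opprB addrA subrK; exact: sC.
exists (v + w); first by apply: subgroupD => //; [case: (Ns n)|exact: N1N].
by move=> k kr; rewrite iter_xD opprD addrA; exact: wP.
Qed.

(** N and N' coincide in large degree, where both conditions are then trivial. *)
Lemma saturated_killed N N' : graded_acc N -> graded_sub N -> graded_sub N' ->
  gle N' N -> (forall k n v, (k < r)%N -> N n v -> N' n.+1 (x k v)) -> saturated N N'.
Proof.
move=> Nacc Ns N's N'N kill.
(* Equal to N up to degree k and to N' beyond: a submodule because the variables send N into N'.
   Stationarity of this chain gives N = N' beyond degree k1. *)
pose J k n := if (n <= k)%N then N n else N' n.
have [k1 k1P] : exists k1, forall k, (k1 <= k)%N -> gle (J k) (J k1).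
  apply: Nacc => [k n|k n v|k n]; rewrite /J.
  - have [Ng NC Nx] := Ns n; have [N'g N'C N'x] := N's n.
    case: (leqP n k) => nk; split => //; case: leqP => // nk1 k' v k'r Nv.
      exact: kill.
    by rewrite ltnNge ltnW in nk1.
  - case: (leqP n k) => [nk|_]; first by rewrite (leq_trans nk).
    by case: (leqP n k.+1) => // _ N'v; exact: (N'N n).
  - by case: (leqP n k) => _ v //; exact: (N'N n).
have NN' n : (k1 < n)%N -> N n `<=` N' n.
  move=> k1n v Nv; have := k1P n (ltnW k1n) n v.
  by rewrite /J leqnn leqNgt k1n; apply.
exists k1.+1 => n k1n; split; first by move=> v Nv _; exact: NN'.
move=> K s sN _; exists 0; first by case: (Ns n) => -[].
move=> k kr; rewrite iter_x0 subr0; apply: NN'; last exact: sN.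
exact: leq_trans k1n (leq_addr _ _).
Qed.

(** The submodule N' + x_z N. Nothing comes from degree -1, hence w = 0 in degree 0. *)
Definition add_image (z : nat) (N N' : nat -> set V) : nat -> set V := fun n =>
  [set v | exists u w, [/\ N' n u,
     (if n is m.+1 then N m w else w = 0) & v = u + x z w]].

Lemma add_image_sub z N N' : (z < r)%N -> graded_sub N -> graded_sub N' ->
  graded_sub (add_image z N N').
Proof.
move=> zr Ns N's n; have [[N'0 N'B] N'C N'x] := N's n; split.
- split.
    exists 0, 0; split => //; last by rewrite x0 addr0.
    by case: n {N'0 N'B N'C N'x} => // n; case: (Ns n) => -[].
  move=> _ _ [u [w [Nu Nw ->]]] [u' [w' [Nu' Nw' ->]]].
  exists (u - u'), (w - w'); split; first exact: N'B.
    case: n Nw Nw' {N'0 N'B N'C N'x Nu Nu'} => [-> ->|n]; first by rewrite subr0.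
    by case: (Ns n) => -[_ NB] _ _; exact: NB.
  by rewrite xB opprD addrACA.
- move=> c _ Cc [u [w [Nu Nw ->]]].
  have c0 : c 0 = 0 by rewrite -[in LHS](subrr 0) CB // subrr.
  exists (c u), (c w); split; first exact: N'C.
    case: n Nw {N'0 N'B N'C N'x Nu} => [->|n]; first by [].
    by case: (Ns n) => _ NC _; exact: NC.
  by rewrite -[x z w]opprK CB // -[- x z w]sub0r CB // c0 sub0r Cx // opprK.
- move=> k _ kr [u [w [Nu Nw ->]]].
  exists (x k u), (x k w); split; first exact: N'x.
    case: n Nw {N'0 N'B N'C N'x Nu} => [->|n Nw].
      by rewrite x0; case: (Ns 0%N) => -[].
    by case: (Ns n) => _ _; apply.
  by rewrite xD [x k (x z w)]xC.
Qed.

(* The crucial case: if x_z is injective on N/N', then a compatible family is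
   determined by its member s_z, and the vanishing of the torsion of N/(N' + x_z N)
   allows one to divide s_z by x_z repeatedly. *)
Lemma saturated_regular N N' z : graded_sub N -> graded_sub N' -> gle N' N ->
  (z < r)%N -> (forall n v, N n v -> N' n.+1 (x z v) -> N' n v) ->
  saturated N (add_image z N N') -> saturated N N'.
Proof.
move=> Ns N's N'N zr inj [n0 n0P]; exists n0 => n n0n.
have injK K m v : N m v -> N' (m + K)%N (iter K (x z) v) -> N' m v.
  elim: K => [|K IH] Nv /=; first by rewrite addn0.
  rewrite addnS => /inj H; apply: IH => //; apply: H.
  exact: graded_sub_iter.
split.
  by move=> v Nv [K Kv]; apply: (injK K) => //; exact: Kv.
move=> K s sN sC.
have Nsg m : subgroup (N m) by case: (Ns m).
have N'sg m : subgroup (N' m) by case: (N's m).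
(* Modulo N', s_z is divisible by x_z^e, by induction on e; e = K yields the required element. *)
have step e : (e <= K)%N -> exists2 v, N (n + (K - e))%N v &
    N' (n + K)%N (s z - iter e (x z) v).
  elim: e => [|e IH] eK.
    exists (s z); first by rewrite subn0; exact: sN.
    by rewrite subrr; exact: (proj1 (N'sg _)).
  have [v Nv vP] := IH (ltnW eK).
  have tf := proj1 (n0P _ (leq_trans n0n (leq_addr (K - e) n))) v Nv.
  have [|u [w [N'u Nw vE]]] := tf.
    (* The products x_k^K v lie in N' + x_z N: modulo N' they agree with x_z^(K-e) s_k, which is a
       multiple of x_z. To see this, multiply the difference by x_z^e, use the compatibility of s_k
       with s_z, and cancel x_z^e. *)
    exists K => k kr; rewrite /add_image.
    exists (iter K (x k) v - iter (K - e) (x z) (s k)),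
      (iter (K - e.+1) (x z) (s k)); split.
    - apply: (injK e).
        apply: (proj2 (Nsg _)); first exact: graded_sub_iter.
        rewrite addnAC; apply: graded_sub_iter => //; exact: sN.
      have -> : (n + (K - e) + K + e = n + K + K)%N by lia.
      rewrite iter_xB -iterD subnKC; last exact: ltnW.
      have N1 : N' (n + K + K)%N (iter K (x k) (s z - iter e (x z) v)).
        by apply: graded_sub_iter.
      have := proj2 (N'sg _) _ _ (sC k z kr zr) N1; rewrite iter_xB.
      by rewrite opprB addrC addrA subrK [iter K (x k) (iter e _ _)]iter_xC.
    - have -> : (n + (K - e) + K = (n + K + (K - e.+1)).+1)%N by lia.
      by apply: graded_sub_iter => //; exact: sN.
    - by rewrite -iterS -subSn // subSS subrK.
  have nE : (n + (K - e) = (n + (K - e.+1)).+1)%N by lia.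
  rewrite nE in N'u Nw; exists w => //.
  have -> : s z - iter e.+1 (x z) w = s z - iter e (x z) v + iter e (x z) u.
    by rewrite vE iter_xD -iterSr opprD [- iter e _ u - _]addrC addrA subrK.
  apply: subgroupD => //.
  have -> : (n + K = (n + (K - e.+1)).+1 + e)%N by lia.
  exact: graded_sub_iter.
have [v Nv vP] := step K (leqnn K); rewrite subnn addn0 in Nv.
exists v => // k kr; apply: (injK K).
  by apply: (proj2 (Nsg _)); [exact: sN|exact: graded_sub_iter].
have N1 : N' (n + K + K)%N (iter K (x k) (s z - iter K (x z) v)).
  exact: graded_sub_iter.
have := proj2 (N'sg _) _ _ N1 (sC k z kr zr).
by rewrite !iter_xB opprB addrC addrA subrK [iter K (x k) (iter K (x z) _)]iter_xC.
Qed.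

(** Induction on the number c of variables not yet known to send N into N', and for fixed c
    Noetherian induction on N'. Let N1 = (N' : x_z) in N. Either N1 = N', so that x_z is injective
    on N/N' and the larger submodule N' + x_z N is used; or N1 is strictly larger, and x_z sends N1
    into N', so that one more variable is settled for the pair N1, N'. *)
Theorem saturated_noetherian N N' : graded_acc N -> graded_sub N -> graded_sub N' ->
  gle N' N -> saturated N N'.
Proof.
suff H c z : (z + c = r)%N -> forall N N', graded_acc N -> graded_sub N ->
    graded_sub N' -> gle N' N ->
    (forall k n v, (k < z)%N -> N n v -> N' n.+1 (x k v)) -> saturated N N'.
  by move=> Nacc Ns N's N'N; exact: (H r 0%N).
elim: c z => [|c IH] z zcr {}N {}N' Nacc Ns N's N'N kill.
  by apply: saturated_killed => // k n v kr; apply: kill; rewrite -[z]addn0 zcr.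
have zr : (z < r)%N by rewrite -zcr -addSnnS leq_addr.
move: kill; pattern N'; apply: (graded_acc_ind Nacc) => // {N's N'N}N' N's N'N IHN kill.
pose N1 n := [set v | N n v /\ N' n.+1 (x z v)].
have N1s : graded_sub N1.
  move=> n; have [[N0 NB] NC Nx] := Ns n; have [[N'0 N'B] N'C N'x] := N's n.+1.
  split.
  - split; first by split; rewrite ?x0.
    by move=> u v [Nu N'u] [Nv N'v]; split; [exact: NB|rewrite xB; exact: N'B].
  - by move=> c0 v Cc [Nv N'v]; split; [exact: NC|rewrite -Cx //; exact: N'C].
  - by move=> k v kr [Nv N'v]; split; [exact: Nx|rewrite xC; exact: N'x].
have N'N1 : gle N' N1.
  by move=> n v N'v; split; [exact: (N'N n)|case: (N's n) => _ _; apply].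
have N1N : gle N1 N by move=> n v [].
case: (pselect (gle N1 N')) => N1N'.
  apply: (saturated_regular Ns N's N'N zr) => [n v Nv N'v|]; first exact: N1N'.
  have N2s := add_image_sub zr Ns N's.
  have N2N : gle (add_image z N N') N.
    move=> n _ [u [w [N'u Nw ->]]]; apply: subgroupD; first by case: (Ns n).
      exact: N'N.
    case: n Nw {N'u} => [->|n Nw]; first by rewrite x0; case: (Ns 0%N) => -[].
    by case: (Ns n) => _ _; apply.
  have N'N2 : gle N' (add_image z N N').
    move=> n v N'v; exists v, 0; split => //; last by rewrite x0 addr0.
    by case: n {N'v} => // n; case: (Ns n) => -[].
  (* If adding x_z N gains nothing, then x_z sends N into N', and N1 = N' forces N = N'. *)
  case: (pselect (gle (add_image z N N') N')) => N2N'.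
    apply: saturated_killed => // k n v kr Nv.
    apply: N'N2; case: (N's n) => _ _; apply=> //; apply: N1N'; split => //; apply: N2N'.
    by exists 0, v; split => //; [case: (N's n.+1) => -[]|rewrite add0r].
  by apply: IHN => // k n v kz Nv; apply: N'N2; exact: kill.
apply: (saturated_trans Ns N1s N's N1N N'N1).
  by apply: IHN => // k n v kz Nv; apply: N'N1; exact: kill.
apply: (IH z.+1) => //; first by rewrite addSnnS.
  exact: graded_acc_sub Nacc N1N.
move=> k n v; rewrite ltnS leq_eqVlt => /orP[/eqP ->|kz] [Nv N'v] //.
exact: kill.
Qed.
End Serre.

(** * Chain condition for graded modules embedded in finitely generated ones *)

Section GradedAcc.
Variables (A : comNzRingType) (V : lmodType A) (r q m n0 : nat).
Variables (x y psi : nat -> V -> V) (one : V).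
Hypothesis Apid : principal_ideals A.
Hypothesis x_linear : forall k a u v, x k (a *: u + v) = a *: x k u + x k v.
Hypothesis y_linear : forall k a u v, y k (a *: u + v) = a *: y k u + y k v.
Hypothesis psi_linear : forall k a u v, psi k (a *: u + v) = a *: psi k u + psi k v.
Hypothesis xC : forall k l v, x k (x l v) = x l (x k v).
Hypothesis yC : forall k l v, y k (y l v) = y l (y k v).
Hypothesis xyC : forall k l v, x k (y l v) = y l (x k v).
Hypothesis psix : forall j k v, psi j (x k v) = x k (psi j v).
Hypothesis psiy : forall j k v, psi j (y k v) = y k (psi j v).

(** The degree n part of the module generated by [one] over A[x, y], the x having degree 1 and the y
    degree 0. *)
Inductive graded_span : nat -> V -> Prop :=
| GSpan0 n : graded_span n 0
| GSpan1 : graded_span 0 one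
| GSpanL n a u v : graded_span n u -> graded_span n v -> graded_span n (a *: u + v)
| GSpanX n k v : (k < r)%N -> graded_span n v -> graded_span n.+1 (x k v)
| GSpanY n k v : (k < q)%N -> graded_span n v -> graded_span n (y k v).

Definition degree0_ops : set (V -> V) :=
  [set c | (exists a, c = *:%R a) \/ exists2 k, (k < q)%N & c = y k].

Let x0 k : x k 0 = 0. Proof. exact: (op0 x_linear). Qed.
Let y0 k : y k 0 = 0. Proof. exact: (op0 y_linear). Qed.
Let psi0 k : psi k 0 = 0. Proof. exact: (op0 psi_linear). Qed.

(** Components are indexed by the embedding [psi j] and by the degree. Keeping degrees apart reduces
    graded chains to ungraded ones. *)
Let VV : lmodType A := nat -> nat -> V.

Let opV (i : nat) (F : VV) : VV := fun j n =>
  if (i < r)%N then (if n is n'.+1 then x i (F j n') else 0) else y (i - r) (F j n).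

Let opV_linear i a (F G : VV) : opV i (a *: F + G) = a *: opV i F + opV i G.
Proof.
apply: funext => j; apply: funext => n; rewrite /opV !fctE.
case: ifP => _; last exact: y_linear.
by case: n => [|n]; [rewrite scaler0 addr0|exact: x_linear].
Qed.

Let opVC i i' (F : VV) : opV i (opV i' F) = opV i' (opV i F).
Proof.
apply: funext => j; apply: funext => n; rewrite /opV.
case: ifP => ir; case: ifP => i'r //; case: n => [|n] //; rewrite ?y0 ?xyC //.
by case: n => [|n]; rewrite ?x0 // xC.
Qed.

Let delta (j n : nat) (v : V) : VV := fun j' n' =>
  if (j' == j) && (n' == n) then v else 0.

Let omega : set VV := ops_span opV (lin_span (fun j => delta j 0 one) m) (r + q).

Let omega_stable : stable opV (r + q) omega.
Proof. by apply: ops_span_stable => //; exact: lin_span_submodule. Qed.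

Let omega_acc : acc opV (r + q) omega.
Proof.
apply: acc_ops_span => //; first exact: lin_span_submodule.
exact: acc_lin_span.
Qed.

Let delta_span n v j : (j < m)%N -> graded_span n v -> omega (delta j n v).
Proof.
have [[om0 omL] omx] := omega_stable.
move=> jm; elim=> {n v} [n||n a u v _ IHu _ IHv|n k v kr _ IH|n k v kq _ IH].
- rewrite (_ : delta _ _ _ = 0) //.
  by apply: funext => j'; apply: funext => n'; rewrite /delta; case: ifP.
- apply: ops_span_sub => //; first exact: lin_span_submodule.
  exists (fun i => (i == j)%:R); rewrite (bigD1 (Ordinal jm)) //= eqxx scale1r.
  rewrite big1 ?addr0 // => i; rewrite -val_eqE /= => /negbTE ->.
  by rewrite scale0r.
- rewrite (_ : delta _ _ _ = a *: delta j n u + delta j n v); first exact: omL.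
  apply: funext => j'; apply: funext => n'; rewrite /delta !fctE.
  by case: ifP => // _; rewrite scaler0 addr0.
- rewrite (_ : delta _ _ _ = opV k (delta j n v)).
    by apply: omx => //; rewrite (leq_trans kr) // leq_addr.
  apply: funext => j'; apply: funext => n'; rewrite /delta /opV kr.
  by case: n' => [|n']; rewrite ?andbF // eqSS; case: ifP.
- rewrite (_ : delta _ _ _ = opV (r + k) (delta j n v)).
    by apply: omx => //; rewrite ltn_add2l.
  apply: funext => j'; apply: funext => n'; rewrite /delta /opV.
  by rewrite ltnNge leq_addr /= addKn; case: ifP.
Qed.

Variable W : nat -> set V.
Hypothesis psi_inj : forall v, (forall j, (j < m)%N -> psi j v = 0) -> v = 0.
Hypothesis psiW : forall j n v, (j < m)%N -> W n v -> graded_span (n + n0) (psi j v).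

(** The [psi j] jointly embed W, with degrees shifted by n0, in m copies of the Noetherian module
    spanned by [one]; no generators of W have to be exhibited. *)
Lemma graded_acc_embedding : graded_acc r x degree0_ops W.
Proof.
move=> J Js JS JW.
pose emb (a : nat -> V) : VV := fun j n =>
  if (j < m)%N && (n0 <= n)%N then psi j (a (n - n0)%N) else 0.
(* Images of finite sequences of homogeneous elements: the bound B makes each a finite sum, hence a
   member of [omega]. *)
pose hat k : set VV := [set F | exists B (a : nat -> V),
  [/\ forall n, J k n (a n), forall n, (B <= n)%N -> a n = 0 & F = emb a]].
have Jsub k n : submodule (J k n).
  have [[J0 JB] JC _] := Js k n; split=> // a u v Ju Jv.
  rewrite -[v]opprK; apply: (JB); first by apply: JC => //; left; exists a.
  by rewrite -sub0r; apply: JB.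
have hat_stable k : stable opV (r + q) (hat k).
  split; first split.
  - exists 0%N, (fun=> 0); split=> // [n|]; first exact: (proj1 (Jsub k n)).
    by apply: funext => j; apply: funext => n; rewrite /emb psi0; case: ifP.
  - move=> a _ _ [B [u [Ju u0 ->]]] [B' [u' [Ju' u'0 ->]]].
    exists (maxn B B'), (fun n => a *: u n + u' n); split.
    + by move=> n; apply: (proj2 (Jsub k n)).
    + by move=> n; rewrite geq_max => /andP[/u0 -> /u'0 ->]; rewrite scaler0 addr0.
    + apply: funext => j; apply: funext => n; rewrite /emb !fctE.
      by case: ifP => _; rewrite ?psi_linear // scaler0 addr0.
  - move=> i _ irq [B [u [Ju u0 ->]]]; case: (ltnP i r) => ir.
      exists B.+1, (fun n => if n is n'.+1 then x i (u n') else 0); split.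
      + case=> [|n]; first exact: (proj1 (Jsub k 0%N)).
        by case: (Js k n) => _ _; apply.
      + by case=> // n; rewrite ltnS => /u0 ->.
      + apply: funext => j; apply: funext => n; rewrite /emb /opV ir.
        case: n => [|n]; first by rewrite sub0n psi0 if_same.
        case: (ltnP j m) => jm /=; last exact: x0.
        rewrite [(n0 <= n.+1)%N]leq_eqVlt ltnS; case: (n0 =P n.+1) => [->|_] /=.
          by rewrite subnn psi0 ltnn x0.
        by case: ifP => n0n; rewrite ?x0 // subSn // psix.
    exists B, (y (i - r) \o u); split.
    + move=> n; case: (Js k n) => _ JC _; apply: JC => //; right.
      by exists (i - r)%N => //; rewrite ltn_subLR.
    + by move=> n /u0 /= ->.
    + apply: funext => j; apply: funext => n; rewrite /emb /opV ltnNge ir /=.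
      by case: ifP => _; rewrite ?psiy.
have hatS k : hat k `<=` hat k.+1.
  by move=> F [B [a [Ja a0 ->]]]; exists B, a; split => // n; exact: JS.
have hatW k : hat k `<=` omega.
  move=> F [B [a [Ja a0 ->]]].
  have -> : emb a = \sum_(j < m) \sum_(n < B) delta j (n + n0) (psi j (a n)).
    apply: funext => j; apply: funext => n; rewrite /emb.
    rewrite fct_sumE fct_sumE; case: (ltnP j m) => jm /=; last first.
      rewrite big1 // => j' _; rewrite fct_sumE fct_sumE big1 // => n' _.
      by rewrite /delta gtn_eqF // (leq_trans (ltn_ord _)).
    rewrite (bigD1 (Ordinal jm)) //= [X in _ + X]big1 ?addr0; last first.
      move=> j' j'j; rewrite fct_sumE fct_sumE big1 // => n' _.
      rewrite /delta ifN // negb_and; apply/orP; left.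
      by rewrite eq_sym; rewrite -val_eqE in j'j.
    rewrite fct_sumE fct_sumE; case: leqP => n0n; last first.
      rewrite big1 // => n' _; rewrite /delta eqxx /= ifN //.
      by rewrite neq_ltn (leq_trans n0n) // leq_addl.
    case: (ltnP (n - n0) B) => nB.
      rewrite (bigD1 (Ordinal nB)) //= big1 ?addr0; last first.
        move=> n' n'n; rewrite /delta eqxx /= ifN //.
        apply: contra n'n => /eqP nE; rewrite -val_eqE /= nE addnK //.
      by rewrite /delta eqxx subnK // eqxx.
    rewrite a0 // psi0 big1 // => n' _; rewrite /delta eqxx /= ifN //.
    apply/eqP => nE; have := ltn_ord n'; rewrite ltnNge; apply/negP/negPn.
    by rewrite nE addnK in nB.
  have omS := proj1 omega_stable.
  apply: submodule_sum => // j _; apply: submodule_sum => // n _.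
  by apply: delta_span => //; apply: psiW => //; exact: JW (Ja n).
have [k1 k1P] := omega_acc hat_stable hatS hatW.
exists k1 => k kk1 n v Jv.
(* Stationarity is tested on the sequence whose only term is v, in degree n; joint injectivity then
   recovers v. *)
have [|B [a [Ja a0 aE]]] := k1P k kk1 (emb (fun n' => if n' == n then v else 0)).
  exists n.+1, (fun n' => if n' == n then v else 0); split => //.
    by move=> n'; case: eqP => [->|_] //; exact: (proj1 (Jsub k n')).
  by move=> n' nn'; rewrite gtn_eqF.
suff -> : v = a n by exact: Ja.
apply/eqP; rewrite -subr_eq0; apply/eqP/psi_inj => j jm.
have := congr1 (fun F : VV => F j (n + n0)%N) aE.
rewrite /emb jm leq_addl addnK eqxx /= => psiE.
by rewrite addrC -scaleN1r psi_linear scaleN1r psiE addNr.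
Qed.
End GradedAcc.

(** * Homogeneous primes *)

(** The laws are required of homogeneous elements only: the carrier of [rees] contains families of
    infinite support, on which convolution need not obey them. *)
Record graded_axioms (R : graded_ring) (one : R) : Prop := GradedAxioms {
  gdegB : forall n, subgroup (@gdeg R n);
  gdeg1 : gdeg 0 one;
  gdegM : forall n m (a b : R), gdeg n a -> gdeg m b -> gdeg (n + m) (gmul a b);
  gmulC : forall n m (a b : R), gdeg n a -> gdeg m b -> gmul a b = gmul b a;
  gmulA : forall n m p (a b c : R), gdeg n a -> gdeg m b -> gdeg p c ->
    gmul a (gmul b c) = gmul (gmul a b) c;
  gmulDr : forall n m (a b c : R), gdeg n a -> gdeg m b -> gdeg m c ->
    gmul a (b + c) = gmul a b + gmul a c;
  gmul1 : forall n (a : R), gdeg n a -> gmul one a = a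
}.

Section HomogeneousPrimes.
Variables (R : graded_ring) (one : R) (Rax : graded_axioms one).

Definition gpow (f : R) (K : nat) : R := iter K (gmul f) one.

Lemma gdegD n (a b : R) : gdeg n a -> gdeg n b -> gdeg n (a + b).
Proof. by apply: subgroupD; exact: gdegB Rax n. Qed.

Lemma gdeg0 n : gdeg n (0 : R).
Proof. exact: (proj1 (gdegB Rax n)). Qed.

Lemma gdegN n (a : R) : gdeg n a -> gdeg n (- a).
Proof. by apply: subgroupN; exact: gdegB Rax n. Qed.

Lemma gdeg_pow d f K : gdeg d f -> gdeg (K * d) (gpow f K).
Proof.
move=> df; elim: K => [|K IH] /=; first by rewrite mul0n; exact: (gdeg1 Rax).
by rewrite mulSn; apply: (gdegM Rax).
Qed.

Lemma gmul0 n (a : R) : gdeg n a -> gmul a 0 = 0.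
Proof.
move=> na; have := gmulDr Rax na (gdeg0 0) (gdeg0 0).
by rewrite addr0 => /eqP; rewrite -subr_eq0 opprD addrA subrr sub0r oppr_eq0 => /eqP.
Qed.

Lemma gmulNr n m (a b : R) : gdeg n a -> gdeg m b -> gmul a (- b) = - gmul a b.
Proof.
move=> na mb; apply/eqP; rewrite -addr_eq0 -(gmulDr Rax na (gdegN mb) mb).
by rewrite addNr (gmul0 na).
Qed.

Lemma gmulBr n m (a b c : R) : gdeg n a -> gdeg m b -> gdeg m c ->
  gmul a (b - c) = gmul a b - gmul a c.
Proof.
by move=> na mb mc; rewrite (gmulDr Rax na mb (gdegN mc)) (gmulNr na mc).
Qed.

Lemma gmulDl n m (a b c : R) : gdeg n a -> gdeg m b -> gdeg m c ->
  gmul (b + c) a = gmul b a + gmul c a.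
Proof.
move=> na mb mc; rewrite (gmulC Rax (gdegD mb mc) na) (gmulDr Rax na mb mc).
by rewrite (gmulC Rax na mb) (gmulC Rax na mc).
Qed.

Lemma gmulCA n m p (a b c : R) : gdeg n a -> gdeg m b -> gdeg p c ->
  gmul a (gmul b c) = gmul b (gmul a c).
Proof.
move=> na mb pc; rewrite (gmulA Rax na mb pc) (gmulC Rax na mb).
by rewrite -(gmulA Rax mb na pc).
Qed.

Lemma gmulACA n m p q (a b c d : R) : gdeg n a -> gdeg m b -> gdeg p c -> gdeg q d ->
  gmul (gmul a b) (gmul c d) = gmul (gmul a c) (gmul b d).
Proof.
move=> na mb pc qd; have bd := gdegM Rax mb qd; have cd := gdegM Rax pc qd.
rewrite -(gmulA Rax na mb cd) -(gmulA Rax na pc bd).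
by rewrite (gmulCA mb pc qd).
Qed.

Lemma gpowD d f K L : gdeg d f -> gpow f (K + L) = gmul (gpow f K) (gpow f L).
Proof.
move=> df; elim: K => [|K IH] /=; first by rewrite (gmul1 Rax (gdeg_pow L df)).
by rewrite IH (gmulA Rax df (gdeg_pow K df) (gdeg_pow L df)).
Qed.

Record hideal (I : nat -> set R) : Prop := HIdeal {
  hideal_deg : forall n a, I n a -> gdeg n a;
  hideal0 : forall n, I n 0;
  hidealD : forall n a b, I n a -> I n b -> I n (a + b);
  hidealM : forall n m a b, gdeg m b -> I n a -> I (m + n)%N (gmul b a)
}.

Definition hprime (P : nat -> set R) : Prop := hideal P /\
  forall n m a b, gdeg n a -> gdeg m b -> P (n + m)%N (gmul a b) -> P n a \/ P m b.

(** An ideal maximal among those that contain I and no power of f is prime. For Zorn's lemma,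
    homogeneous ideals are coded as sets of pairs (degree, element). *)
Lemma hprime_exists (I : nat -> set R) d f : hideal I -> gdeg d f ->
  (forall K, ~ I (K * d)%N (gpow f K)) ->
  exists2 P, hprime P & (forall n, I n `<=` P n) /\
    forall K, ~ P (K * d)%N (gpow f K).
Proof.
move=> Ii df If.
pose good (X : set (nat * R)) := [/\ hideal (fun n => [set a | X (n, a)]),
  forall n a, I n a -> X (n, a) & forall K, ~ X ((K * d)%N, gpow f K)].
have [|X [X0 Xmax]] := @Zorn_bigcup _ [set X | X = set0 \/ good X].
  move=> F FQ Ftot; have Fgood X y : F X -> X y -> good X.
    by move=> /FQ[->|//].
  case: (pselect (exists2 X, F X & good X)) => [[X0 FX0 [[Xd X0' _ _] IX0 _]]|noX].
    right; split.
    - split.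
      + by move=> n a [X FX Xa]; have [[h _ _ _] _ _] := Fgood _ _ FX Xa; exact: h.
      + by move=> n; exists X0 => //; exact: X0'.
      + move=> n a b [X FX Xa] [X' FX' X'b].
        have [XX'|X'X] := Ftot _ _ FX FX'.
          exists X' => //; have [[_ _ h _] _ _] := Fgood _ _ FX' X'b.
          by apply: h => //; exact: XX'.
        exists X => //; have [[_ _ h _] _ _] := Fgood _ _ FX Xa.
        by apply: h => //; exact: X'X.
      + move=> n m a b mb [X FX Xa]; exists X => //.
        by have [[_ _ _ h] _ _] := Fgood _ _ FX Xa; exact: h.
    - by move=> n a Ia; exists X0 => //; exact: IX0.
    - by move=> K [X FX Xf]; have [_ _ h] := Fgood _ _ FX Xf; exact: h Xf.
  left; rewrite -subset0 => y [X FX Xy]; apply: noX.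
  by exists X => //; exact: Fgood Xy.
have {X0} [Xi IX Xf] : good X.
  case: X0 => // X0; exfalso.
  apply: (Xmax [set u | I u.1 u.2]); last by right; split=> //; case: Ii.
  rewrite X0; split=> [u //|]; move=> /(_ (0%N, 0)); apply; exact: hideal0 Ii 0%N.
pose P n := [set a | X (n, a)]; exists P; last by split.
split=> // n m a b na mb Pab; apply: contrapT => /not_orP[Pa Pb].
have [Pd P0 PD PM] := Xi.
(* Adjoining to P an element outside it produces a power of f, by maximality. Multiplying two such
   expressions would put a power of f in P if the product of the two adjoined elements were in P. *)
have gen k c : gdeg k c -> ~ P k c -> exists K p j r,
    [/\ P (K * d)%N p, gdeg j r, (j + k = K * d)%N & gpow f K = p + gmul r c].
  move=> kc Pc; pose J n' := [set e | exists p j r, [/\ P n' p, gdeg j r,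
     (j + k = n')%N & e = p + gmul r c] \/ P n' e].
  have Ji : hideal J.
    split.
    - move=> n' _ [p [j [r [[Pp jr jE ->]|/Pd //]]]].
      by apply: gdegD; [exact: Pd|rewrite -jE; exact: (gdegM Rax)].
    - by move=> n'; exists 0, 0%N, 0; right; exact: P0.
    - move=> n' e e' [p [j [r H]]] [p' [j' [r' H']]].
      case: H H' => [[Pp jr jE ->]|Pe] [[Pp' jr' jE' ->]|Pe'].
      + have jj : j' = j by apply: (@addIn k); rewrite jE jE'.
        rewrite jj in jr'.
        exists (p + p'), j, (r + r'); left; split=> //; first exact: PD.
          exact: gdegD.
        by rewrite (gmulDl kc jr jr') addrACA.
      + exists (p + e'), j, r; left; split=> //; first exact: PD.
        by rewrite addrAC.
      + exists (e + p'), j', r'; left; split=> //; first exact: PD.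
        by rewrite addrA.
      + by exists 0, 0%N, 0; right; exact: PD.
    - move=> n' m' e g mg [p [j [r [[Pp jr jE ->]|Pe]]]]; last first.
        by exists 0, 0%N, 0; right; exact: PM.
      exists (gmul g p), (m' + j)%N, (gmul g r); left; split.
      + exact: PM.
      + exact: (gdegM Rax).
      + by rewrite -addnA jE.
      + have rc := gdegM Rax jr kc; rewrite jE in rc.
        by rewrite (gmulDr Rax mg (Pd _ _ Pp) rc) (gmulA Rax mg jr kc).
  apply: contrapT => nJ; apply: (Xmax [set u | J u.1 u.2]).
    split; first by move=> [n' e] Xe; exists 0, 0%N, 0; right.
    move=> /(_ (k, c)) JX; apply: Pc; apply: JX => /=.
    exists 0, 0%N, one; left; split=> //; [exact: P0|exact: (gdeg1 Rax)|].
    by rewrite (gmul1 Rax kc) add0r.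
  right; split=> //.
    by move=> n' e Ie; exists 0, 0%N, 0; right; exact: IX.
  move=> K [p [j [r [[Pp jr jE fE]|//]]]]; last by move/(Xf K).
  by apply: nJ; exists K, p, j, r.
have [K [p [j [r [Pp jr jE fE]]]]] := gen _ _ na Pa.
have [L [p' [j' [r' [Pp' jr' jE' fE']]]]] := gen _ _ mb Pb.
apply: (Xf (K + L)%N); rewrite mulnDl (gpowD K L df) fE fE'.
have rb := gdegM Rax jr' mb; rewrite jE' in rb.
have ra := gdegM Rax jr na; rewrite jE in ra.
rewrite (gmulDl (gdegD (Pd _ _ Pp') rb) (Pd _ _ Pp) ra).
rewrite (gmulDr Rax ra (Pd _ _ Pp') rb).
apply: (PD); last apply: (PD).
- by rewrite addnC (gmulC Rax (Pd _ _ Pp) (gdegD (Pd _ _ Pp') rb));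
    apply: PM => //; exact: gdegD (Pd _ _ Pp') rb.
- exact: PM.
- rewrite (gmulACA jr na jr' mb) -jE -jE' addnACA.
  by apply: (PM) => //; exact: (gdegM Rax).
Qed.
End HomogeneousPrimes.

(** Every element is declared homogeneous of every degree, so that the graded result specializes to
    ordinary prime ideals. *)
Lemma comring_graded_axioms (R : comNzRingType) :
  @graded_axioms (@GradedRing R *%R (fun _ => setT)) 1.
Proof.
split=> //=; try by move=> *; rewrite ?mulrA ?mulrDr ?mul1r.
by move=> n m a b _ _; rewrite mulrC.
Qed.

Lemma prime_ideal_exists (R : comNzRingType) (I : set R) (f : R) :
  I 0 -> (forall a b, I a -> I b -> I (a + b)) -> (forall a b, I b -> I (a * b)) ->
  (forall K, ~ I (f ^+ K)) ->
  exists2 P, prime_ideal P & I `<=` P /\ forall K, ~ P (f ^+ K).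
Proof.
move=> I0 ID IM If.
have powE K : gpow (R := @GradedRing R *%R (fun _ => setT)) 1 f K = f ^+ K.
  by elim: K => //= K ->; rewrite exprS.
have [||K|P [[Pd P0 PD PM] Pp] [IP Pf]] := @hprime_exists _ _
    (comring_graded_axioms R) (fun _ => I) 0%N f.
- by split=> //= n m a b _; exact: IM.
- by [].
- by rewrite powE; exact: If.
exists (P 0%N).
  split.
  - by split; [exact: P0|have := Pf 0%N].
  - exact: PD.
  - by move=> a b; apply: (PM 0%N 0%N).
  - by move=> a b; apply: (Pp 0%N 0%N).
by split; [exact: IP|move=> K; have := Pf K; rewrite muln0 powE].
Qed.

(** * Points of Proj from homogeneous ideals *)

Section ProjPoints.
Variables (A : comNzRingType) (P : lrs A) (O : line_bundle P) (R : graded_ring).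
Variables (one : R) (Rax : graded_axioms one) (th : R -> germs O).
Hypothesis Rproj : is_proj th.
Hypothesis gdeg_inj : forall n m (a : R), gdeg n a -> gdeg m a -> n = m \/ a = 0.

(** A homogeneous prime containing I and avoiding f is a point of V(I) in D_+(f). The union Q' of
    its pieces forgets degrees; [gdeg_inj] recovers them. *)
Lemma proj_point (I : nat -> set R) d f : hideal I -> (0 < d)%N -> gdeg d f ->
  (forall K, ~ I (K * d)%N (gpow one f K)) ->
  exists2 z, nonvanishing d (th f z) & forall n a, I n a -> ~ nonvanishing n (th a z).
Proof.
move=> Ii d0 df If; have [Q [[Qd Q0 QD QM] Qp] [IQ Qf]] := hprime_exists Rax Ii df If.
pose Q' := [set a | exists n, Q n a].
have Q'E n a : gdeg n a -> Q' a -> Q n a.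
  by move=> na [m Qa]; case: (gdeg_inj na (Qd _ _ Qa)) => [->|->].
have nQf : ~ Q' f.
  move=> /(Q'E _ _ df) Qf1; apply: (Qf 1%N); rewrite mul1n /=.
  by rewrite (gmulC Rax df (gdeg1 Rax)) (gmul1 Rax df).
have [|z zP] := proj_surj Rproj (P := Q').
  split.
  - by exists 0%N; exact: Q0.
  - move=> n a b na nb Qa Qb; exists n; apply: QD; exact: Q'E.
  - by move=> n m a b na mb Qb; exists (n + m)%N; apply: QM => //; exact: Q'E.
  - move=> n m a b na mb /(Q'E _ _ (gdegM Rax na mb)) /(Qp _ _ _ _ na mb).
    by case=> ?; [left; exists n|right; exists m].
  - by exists d, f.
exists z; first by apply: contrapT => /(zP _ _ df).
by move=> n a Ia; apply/(zP _ _ (hideal_deg Ii Ia)); exists n; exact: IQ.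
Qed.
End ProjPoints.

(** * Stalks and line bundles *)

Section Units.
Variable R : comNzRingType.
Implicit Types a b : R.

Lemma is_unit1 : is_unit (1 : R).
Proof. by exists 1; rewrite mulr1. Qed.

Lemma is_unitM a b : is_unit a -> is_unit b -> is_unit (a * b).
Proof. by move=> [a' aa'] [b' bb']; exists (a' * b'); rewrite mulrACA aa' bb' mulr1. Qed.

Lemma is_unitMl a b : is_unit (a * b) -> is_unit a.
Proof. by move=> [c abc]; exists (b * c); rewrite mulrA. Qed.

Lemma is_unitMr a b : is_unit (a * b) -> is_unit b.
Proof. by rewrite mulrC; exact: is_unitMl. Qed.

Lemma is_unitX a n : is_unit a -> is_unit (a ^+ n).
Proof.
move=> au; elim: n => [|n IH]; first exact: is_unit1.
by rewrite exprS; apply: is_unitM.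
Qed.

Lemma is_unit_mul0 a b : is_unit a -> a * b = 0 -> b = 0.
Proof. by move=> [a' aa'] ab; rewrite -[b]mul1r -aa' mulrAC ab mul0r. Qed.

Lemma is_unit_mulI a b c : is_unit a -> a * b = a * c -> b = c.
Proof.
move=> au ab; apply/eqP; rewrite -subr_eq0; apply/eqP; apply: (is_unit_mul0 au).
by rewrite mulrBr ab subrr.
Qed.

Lemma is_unit0 : ~ is_unit (0 : R).
Proof. by move=> [a]; rewrite mul0r => /esym/eqP; rewrite oner_eq0. Qed.
End Units.

Lemma is_unit_rmorph (R S : comNzRingType) (f : {rmorphism R -> S}) a :
  is_unit a -> is_unit (f a).
Proof. by move=> [b ab]; exists (f b); rewrite -rmorphM ab rmorph1. Qed.

Lemma generator_scale_inj (R : comNzRingType) (B : comAlgType R) (h : nat -> set B) e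
    n c c' : generator h e -> c *: e ^+ n = c' *: e ^+ n -> c = c'.
Proof.
move=> [/bij_inj einj _] cE.
have hE d : horner_alg e (d *: 'X^n) = d *: e ^+ n.
  by rewrite linearZ /= rmorphXn /= horner_algX mulr_algl.
have : c *: 'X^n = c' *: 'X^n :> {poly R} by apply: einj; rewrite !hE.
move=> /(congr1 (coefp n)); rewrite /= !coefZ coefXn eqxx !mulr1.
by [].
Qed.

Lemma generator_degree_inj (R : comNzRingType) (B : comAlgType R) (h : nat -> set B) e
    n m w : generator h e -> h n w -> h m w -> n = m \/ w = 0.
Proof.
move=> [/bij_inj einj homE] /homE[c wE] /homE[c' wE'].
case: (n =P m) => nm; [by left|right].
have hE d k : horner_alg e (d *: 'X^k) = d *: e ^+ k.
  by rewrite linearZ /= rmorphXn /= horner_algX mulr_algl.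
have : c *: 'X^n = c' *: 'X^m :> {poly R} by apply: einj; rewrite !hE -wE.
move=> /(congr1 (coefp n)); rewrite /= !coefZ !coefXn eqxx mulr1.
by case: eqP => // _; rewrite mulr0 wE => ->; rewrite scale0r.
Qed.

Section Stalks.
Variables (A : comNzRingType) (Z : lrs A).

Lemma is_unit_local (x : Z) (a b : stalk Z x) : is_unit (a + b) ->
  is_unit a \/ is_unit b.
Proof.
move=> [c abc]; case: (stalk_local (a * c)) => [/is_unitMl|]; first by left.
have -> : 1 - a * c = b * c by rewrite -abc mulrDl addrAC subrr add0r.
by move/is_unitMl; right.
Qed.

Lemma reg1 (x : Z) : reg (fun y => 1 : stalk Z y) x.
Proof.
apply: (reg_ext (reg_sheaf Z) _ (regC 1 x)).
by apply: filterE => y; rewrite scale1r.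
Qed.

Lemma reg_near_eq (s s' : functions Z) x : reg s x -> reg s' x -> s x = s' x ->
  \forall y \near x, s y = s' y.
Proof. by move=> sr s'r; apply: (reg_eq (reg_sheaf Z) sr s'r). Qed.

Lemma reg_exists x (a : stalk Z x) : exists2 c : functions Z, reg c x & c x = a.
Proof. by have [s [sr sa]] := reg_germ (@reg_sheaf _ Z) a; exists s. Qed.

Lemma unit_near (c : functions Z) x : reg c x -> is_unit (c x) ->
  \forall y \near x, is_unit (c y).
Proof.
move=> cr [b cb]; have [d dr dx] := reg_exists b; rewrite -dx in cb.
have := reg_near_eq (regM cr dr) (reg1 x) cb.
by apply: filterS => y cd; exists (d y).
Qed.

Variable L : line_bundle Z.
Implicit Types (x : Z) (s t : germs L).

Lemma generator_at x : exists e : alg L x, generator homog e.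
Proof.
by have [e _ /nbhs_singleton eg] := locally_trivial L x; exists (e x).
Qed.

Lemma lreg_near_eq s t x : lreg s x -> lreg t x -> s x = t x ->
  \forall y \near x, s y = t y.
Proof. by move=> sr tr; apply: (reg_eq (lreg_sheaf L) sr tr). Qed.

Lemma lreg_eq_near s t x : (\forall y \near x, s y = t y) -> lreg s x -> lreg t x.
Proof. by move=> st sr; apply: (reg_ext (lreg_sheaf L) st sr). Qed.

Lemma lreg_opp s x : lreg s x -> lreg (fun y => - s y) x.
Proof.
move=> sr; apply: lreg_eq_near (lregZ (regC (-1) x) sr).
by apply: filterE => y; rewrite !scaleN1r.
Qed.

Lemma lreg_sub s t x : lreg s x -> lreg t x -> lreg (fun y => s y - t y) x.
Proof. by move=> sr tr; apply: lregD => //; exact: lreg_opp. Qed.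

Lemma lreg_zero x : lreg (fun y => 0 : alg L y) x.
Proof.
have r1 := lreg_sub (Defs.lreg1 L x) (Defs.lreg1 L x).
apply: lreg_eq_near r1.
by apply: filterE => y; rewrite subrr.
Qed.

Lemma lreg_exp s x n : lreg s x -> lreg (fun y => s y ^+ n) x.
Proof.
move=> sr; elim: n => [|n IH]; first exact: Defs.lreg1.
by apply: lreg_eq_near (Defs.lregM sr IH); apply: filterE => y; rewrite exprS.
Qed.

Section Fibre.
Variable x : Z.
Implicit Types (a b w : alg L x) (c : stalk Z x).

Lemma homogD n a b : homog n a -> homog n b -> homog n (a + b).
Proof.
have [e [_ eg]] := generator_at x => /eg[c ->] /eg[d ->].
by apply/eg; exists (c + d); rewrite scalerDl.
Qed.

Lemma homogZ n c a : homog n a -> homog n (c *: a).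
Proof.
have [e [_ eg]] := generator_at x => /eg[d ->].
by apply/eg; exists (c * d); rewrite scalerA.
Qed.

Lemma homog0 n : homog n (0 : alg L x).
Proof. by have [e [_ eg]] := generator_at x; apply/eg; exists 0; rewrite scale0r. Qed.

Lemma homogN n a : homog n a -> homog n (- a).
Proof. by move=> na; rewrite -scaleN1r; apply: homogZ. Qed.

Lemma homogB n a b : homog n a -> homog n b -> homog n (a - b).
Proof. by move=> na nb; apply: homogD => //; exact: homogN. Qed.

Lemma homog1 : homog 0 (1 : alg L x).
Proof.
by have [e [_ eg]] := generator_at x; apply/eg; exists 1; rewrite scale1r expr0.
Qed.

Lemma homogM n m a b : homog n a -> homog m b -> homog (n + m) (a * b).
Proof.
have [e [_ eg]] := generator_at x => /eg[c ->] /eg[d ->].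
by apply/eg; exists (c * d); rewrite -scalerAl -scalerAr scalerA exprD.
Qed.

Lemma homogX n a K : homog n a -> homog (K * n) (a ^+ K).
Proof.
move=> na; elim: K => [|K IH]; first exact: homog1.
by rewrite exprS mulSn; apply: homogM.
Qed.

Lemma homog_degree_inj n m a : homog n a -> homog m a -> n = m \/ a = 0.
Proof. by have [e eg] := generator_at x; exact: generator_degree_inj eg. Qed.

Lemma generator_homog e : generator homog e -> homog 1 (e : alg L x).
Proof. by move=> [_ eg]; apply/eg; exists 1; rewrite scale1r expr1. Qed.

Lemma generator_homogX n e : generator homog e -> homog n (e ^+ n : alg L x).
Proof. by move=> [_ eg]; apply/eg; exists 1; rewrite scale1r. Qed.

Lemma nonvanishing_homog n w : nonvanishing n w -> homog n w.
Proof. by move=> [e [c [[_ eg] _ ->]]]; apply/eg; exists c. Qed.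

Lemma nonvanishing_by e n w : generator homog e -> nonvanishing n w ->
  exists2 c, is_unit c & w = c *: e ^+ n.
Proof.
move=> eg [e' [c [e'g cu ->]]].
have [d e'E] : exists d, e' = d *: e ^+ 1 by apply/(proj2 eg); exact: generator_homog.
have [d' eE] : exists d', e = d' *: e' ^+ 1 by apply/(proj2 e'g); exact: generator_homog.
have du : is_unit d.
  exists d'; apply: (generator_scale_inj (n := 1) e'g).
  by rewrite -scalerA -eE scale1r !expr1; rewrite expr1 in e'E.
exists (c * d ^+ n); first by apply: is_unitM => //; exact: is_unitX.
by rewrite e'E expr1 exprZn scalerA.
Qed.

Lemma nonvanishing_fraction n w a : nonvanishing n w -> homog n a ->
  exists c, a = c *: w.
Proof.
move=> [e [d [[_ eg] [d' dd'] ->]]] /eg[c ->].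
by exists (c * d'); rewrite scalerA -mulrA [d' * _]mulrC dd' mulr1.
Qed.

Lemma nonvanishing_scale_inj n w c c' : nonvanishing n w -> c *: w = c' *: w -> c = c'.
Proof.
move=> [e [d [eg du ->]]]; rewrite !scalerA => /(generator_scale_inj eg).
by rewrite ![_ * d]mulrC; exact: is_unit_mulI.
Qed.

Lemma nonvanishing_scale0 n w c : nonvanishing n w -> c *: w = 0 -> c = 0.
Proof. by move=> wn cw; apply: (nonvanishing_scale_inj wn); rewrite scale0r. Qed.

Lemma nonvanishingZ n w c : is_unit c -> nonvanishing n w -> nonvanishing n (c *: w).
Proof.
move=> cu [e [d [eg du ->]]]; exists e, (c * d); split=> //; first exact: is_unitM.
by rewrite scalerA.
Qed.

Lemma nonvanishing_unit n w c : homog n w -> nonvanishing n (c *: w) -> is_unit c.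
Proof.
have [e eg] := generator_at x; move=> /(proj2 eg)[d ->] /(nonvanishing_by eg)[d' d'u].
by rewrite scalerA => /(generator_scale_inj eg) cd; apply: (@is_unitMl _ c d); rewrite cd.
Qed.

Lemma nonvanishing_unscale n w c : homog n w -> nonvanishing n (c *: w) ->
  nonvanishing n w.
Proof.
have [e eg] := generator_at x; move=> /(proj2 eg)[d ->] /(nonvanishing_by eg)[d' d'u].
rewrite scalerA => /(generator_scale_inj eg) cd; exists e, d; split=> //.
by apply: (@is_unitMr _ c d); rewrite cd.
Qed.

Lemma nonvanishingM n m a b : nonvanishing n a -> nonvanishing m b ->
  nonvanishing (n + m) (a * b).
Proof.
have [e eg] := generator_at x.
move=> /(nonvanishing_by eg)[c cu ->] /(nonvanishing_by eg)[d du ->].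
exists e, (c * d); split=> //; first exact: is_unitM.
by rewrite -scalerAl -scalerAr scalerA exprD.
Qed.

Lemma nonvanishing1 : nonvanishing 0 (1 : alg L x).
Proof.
have [e eg] := generator_at x; exists e, 1; split=> //; first exact: is_unit1.
by rewrite scale1r expr0.
Qed.

Lemma nonvanishingX n a K : nonvanishing n a -> nonvanishing (K * n) (a ^+ K).
Proof.
move=> na; elim: K => [|K IH]; first exact: nonvanishing1.
by rewrite exprS mulSn; apply: nonvanishingM.
Qed.

Lemma nonvanishing_mull n m a b : homog n a -> homog m b ->
  nonvanishing (n + m) (a * b) -> nonvanishing n a.
Proof.
have [e eg] := generator_at x.
move=> /(proj2 eg)[c ->] /(proj2 eg)[d ->] /(nonvanishing_by eg)[d' d'u].
rewrite -scalerAl -scalerAr scalerA -exprD => /(generator_scale_inj eg) cd.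
by exists e, c; split=> //; apply: (@is_unitMl _ c d); rewrite cd.
Qed.

Lemma nonvanishing_mulr n m a b : homog n a -> homog m b ->
  nonvanishing (n + m) (a * b) -> nonvanishing m b.
Proof. by move=> na mb; rewrite mulrC addnC; exact: nonvanishing_mull. Qed.

Lemma nonvanishing_mul0 n m w a : nonvanishing n w -> homog m a -> w * a = 0 -> a = 0.
Proof.
have [e eg] := generator_at x => /(nonvanishing_by eg)[c cu ->] /(proj2 eg)[d ->].
rewrite -scalerAl -scalerAr scalerA -exprD => cd.
suff -> : d = 0 by rewrite scale0r.
apply: (is_unit_mul0 cu); apply: (generator_scale_inj (n := n + m) eg).
by rewrite cd scale0r.
Qed.

Lemma nonvanishing_mulI n m w a b : nonvanishing n w -> homog m a -> homog m b ->
  w * a = w * b -> a = b.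
Proof.
move=> wn na nb wab; apply/eqP; rewrite -subr_eq0; apply/eqP.
apply: (nonvanishing_mul0 wn (homogB na nb)).
by rewrite mulrBr wab subrr.
Qed.

Lemma nonvanishing_add n a b : homog n a -> homog n b -> nonvanishing n (a + b) ->
  nonvanishing n a \/ nonvanishing n b.
Proof.
have [e eg] := generator_at x.
move=> /(proj2 eg)[c ->] /(proj2 eg)[d ->] /(nonvanishing_by eg)[d' d'u].
rewrite -scalerDl => /(generator_scale_inj eg) cd.
rewrite -cd in d'u; case: (is_unit_local d'u) => ?; [left|right].
  by exists e, c.
by exists e, d.
Qed.

Lemma nonvanishing_neq0 n : ~ nonvanishing n (0 : alg L x).
Proof.
have [e eg] := generator_at x => /(nonvanishing_by eg)[c cu].
rewrite -(scale0r (e ^+ n)) => /(generator_scale_inj eg) c0.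
by rewrite -c0 in cu; exact: is_unit0 cu.
Qed.

(** Substituting c X for X, with c invertible, is an automorphism of the polynomial algebra. *)
Lemma nonvanishing_generator e : nonvanishing 1 (e : alg L x) -> generator homog e.
Proof.
have [e0 e0g] := generator_at x => /(nonvanishing_by e0g)[c [c' cc'] ->].
rewrite expr1; have hE (d : stalk Z x) p : horner_alg (d *: e0) p =
    horner_alg e0 (p \Po (d *: 'X)).
  elim/poly_ind: p => [|p a IH]; first by rewrite comp_poly0 !rmorph0.
  rewrite comp_polyD comp_polyM comp_polyX comp_polyC !rmorphD !rmorphM /= IH.
  by rewrite linearZ /= !horner_algX !horner_algC mulr_algl.
have XXK (d d' : stalk Z x) p : d * d' = 1 -> (p \Po (d *: 'X)) \Po (d' *: 'X) = p.
  move=> dd'; rewrite -comp_polyA comp_polyZ comp_polyX scalerA dd' scale1r.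
  exact: comp_polyXr.
split.
  case: (proj1 e0g) => g gK Kg; exists (fun w => g w \Po (c' *: 'X)).
    by move=> p; rewrite hE gK XXK.
  by move=> w; rewrite hE XXK ?Kg // mulrC.
move=> n w; rewrite (proj2 e0g); split=> -[d ->].
  exists (d * c' ^+ n); rewrite exprZn scalerA -mulrA -exprMn mulrC [c' * c]mulrC cc'.
  by rewrite expr1n mul1r.
by exists (d * c ^+ n); rewrite exprZn scalerA.
Qed.

Lemma generator_nonvanishing (e : alg L x) : generator homog e -> nonvanishing 1 e.
Proof.
move=> eg; exists e, 1; split=> //; first exact: is_unit1.
by rewrite scale1r expr1.
Qed.
End Fibre.

Lemma nonvanishing_near n s x : lreg s x -> nonvanishing n (s x) ->
  \forall y \near x, nonvanishing n (s y).
Proof.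
move=> sr sn; have [e er eg] := locally_trivial L x.
have [c cu sE] := nonvanishing_by (nbhs_singleton eg) sn.
have [f fr fx] := reg_exists c; rewrite -fx in cu sE.
near=> y; have -> : s y = f y *: e y ^+ n.
  by near: y; apply: lreg_near_eq => //; apply: lregZ => //; exact: lreg_exp.
exists (e y), (f y); split=> //; first by near: y.
by near: y; exact: unit_near.
Unshelve. all: by end_near. Qed.

Lemma fraction_near n s w x : lreg s x -> homog n (s x) -> lreg w x ->
  nonvanishing n (w x) ->
  exists2 c : functions Z, reg c x & \forall y \near x, s y = c y *: w y.
Proof.
move=> sr sn wr wn; have [c sE] := nonvanishing_fraction wn sn.
have [f fr fx] := reg_exists c; exists f => //.
by apply: lreg_near_eq => //; [exact: lregZ|rewrite fx].
Qed.

Lemma H0_0 n : H0 L n 0.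
Proof. by move=> x; split; [exact: lreg_zero|exact: homog0]. Qed.

Lemma H0D n s t : H0 L n s -> H0 L n t -> H0 L n (s + t).
Proof.
move=> sn tn x; have [sr sh] := sn x; have [tr th] := tn x.
by split; [exact: lregD|exact: homogD].
Qed.

Lemma H0N n s : H0 L n s -> H0 L n (- s).
Proof.
by move=> sn x; have [sr sh] := sn x; split; [exact: lreg_opp|exact: homogN].
Qed.

Lemma H0B n s t : H0 L n s -> H0 L n t -> H0 L n (s - t).
Proof. by move=> sn tn; apply: H0D => //; exact: H0N. Qed.

Lemma H0M n m s t : H0 L n s -> H0 L m t -> H0 L (n + m) (s * t).
Proof.
move=> sn tn x; have [sr sh] := sn x; have [tr th] := tn x.
by split; [exact: Defs.lregM|exact: homogM].
Qed.

Lemma H0_1 : H0 L 0 1.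
Proof. by move=> x; split; [exact: Defs.lreg1|exact: homog1]. Qed.

Lemma H0X n s K : H0 L n s -> H0 L (K * n) (s ^+ K).
Proof.
move=> sn; elim: K => [|K IH]; first exact: H0_1.
by rewrite exprS mulSn; apply: H0M.
Qed.

Lemma H0Z n (a : A) s : H0 L n s -> H0 L n (a *: s).
Proof.
move=> sn x; have [sr sh] := sn x; split; last exact: homogZ.
exact: lregZ (regC a x) sr.
Qed.

Lemma H0_submodule n : submodule (H0 L n).
Proof. by split; [exact: H0_0|move=> a s t sn tn; apply: H0D => //; exact: H0Z]. Qed.

Lemma germsX s K x : (s ^+ K) x = s x ^+ K.
Proof. by elim: K => // K IH; rewrite !exprS -IH. Qed.

Lemma germs_sum I (l : seq I) (P : pred I) (F : I -> germs L) x :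
  (\sum_(k <- l | P k) F k) x = \sum_(k <- l | P k) F k x.
Proof. by elim/big_rec2: _ => //= k a b _ <-. Qed.

Lemma germs_mulZ (a : A) s t : (a *: s) * t = a *: (s * t).
Proof. by apply: functional_extensionality_dep => x; rewrite -[LHS]scalerAl. Qed.
End Stalks.

Lemma dep_choice (T : Type) (F : T -> Type) (P : forall x, F x -> Prop) :
  (forall x, exists y, P x y) -> exists f : forall x, F x, forall x, P x (f x).
Proof. by move=> H; exists (fun x => sval (cid (H x))) => x; case: cid. Qed.

(** * Morphisms of line bundles defined by local generators *)

Section PolynomialExtension.
Variables (R S : comNzRingType) (k : {rmorphism R -> S}).
Variables (B : comAlgType R) (C : comAlgType S) (e : B) (e' : C) (h : B -> {poly R}).
Hypotheses (hK : cancel (horner_alg e) h) (Kh : cancel h (horner_alg e)).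

Definition poly_extend (w : B) : C := horner_alg e' (map_poly k (h w)).

Let h_horner p : h (horner_alg e p) = p. Proof. exact: hK. Qed.

Fact poly_extend_zmod : zmod_morphism poly_extend.
Proof.
move=> u v; rewrite /poly_extend -{1}(Kh u) -{1}(Kh v) -rmorphB h_horner.
by rewrite !rmorphB.
Qed.

Fact poly_extend_monoid : monoid_morphism poly_extend.
Proof.
split; first by rewrite /poly_extend -(rmorph1 (horner_alg e)) h_horner !rmorph1.
move=> u v; rewrite /poly_extend -{1}(Kh u) -{1}(Kh v) -rmorphM h_horner.
by rewrite !rmorphM.
Qed.

HB.instance Definition _ := GRing.isZmodMorphism.Build B C poly_extend poly_extend_zmod.
HB.instance Definition _ :=
  GRing.isMonoidMorphism.Build B C poly_extend poly_extend_monoid.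

Definition poly_extend_rmorphism : {rmorphism B -> C} := poly_extend.

Lemma poly_extendZ a w : poly_extend (a *: w) = k a *: poly_extend w.
Proof.
rewrite -mulr_algl rmorphM /= -[k a *: _]mulr_algl; congr (_ * _).
by rewrite /poly_extend -(horner_algC e) h_horner map_polyC horner_algC.
Qed.

Lemma poly_extend_gen : poly_extend e = e'.
Proof.
by rewrite -(horner_algX e) /poly_extend h_horner map_polyX !horner_algX.
Qed.
End PolynomialExtension.

Lemma generator_extend (R S : comNzRingType) (k : {rmorphism R -> S})
    (B : comAlgType R) (C : comAlgType S) (hom : nat -> set B) (e : B) (e' : C) :
  generator hom e -> exists phi : {rmorphism B -> C},
    (forall a w, phi (a *: w) = k a *: phi w) /\ phi e = e'.
Proof.
move=> [[h hK Kh] _]; exists (poly_extend_rmorphism k e' hK Kh); split.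
  by move=> a w; exact: poly_extendZ hK Kh a w.
exact: poly_extend_gen hK.
Qed.

Lemma generator_ind (R : comNzRingType) (B : comAlgType R) (hom : nat -> set B) (e : B)
    (P : B -> Prop) : generator hom e ->
  P 0 -> (forall w c, P w -> P (w * e + c%:A)) -> forall w, P w.
Proof.
move=> [[h _ Kh] _] P0 PS w; rewrite -(Kh w).
elim/poly_ind: (h w) => [|p c IH]; first by rewrite rmorph0.
by rewrite rmorphD rmorphM /= horner_algX horner_algC; exact: PS.
Qed.

Lemma generator_rmorph_ext (R : comNzRingType) (B : comAlgType R) (hom : nat -> set B)
    (e : B) (S : comNzRingType) (phi psi : B -> S) :
  generator hom e -> phi 0 = psi 0 ->
  (forall u v, phi (u + v) = phi u + phi v) -> (forall u v, psi (u + v) = psi u + psi v) ->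
  (forall u v, phi (u * v) = phi u * phi v) -> (forall u v, psi (u * v) = psi u * psi v) ->
  (forall c, phi c%:A = psi c%:A) -> phi e = psi e -> phi =1 psi.
Proof.
move=> eg phi0 phiD psiD phiM psiM phiC phie; apply: (generator_ind eg) => // w c IH.
by rewrite phiD psiD phiM psiM IH phie phiC.
Qed.

Lemma near_pull (A : comNzRingType) (Z W : lrs A) (f : mor Z W) x (P : W -> Prop) :
  (\forall y \near f x, P y) -> \forall y \near x, P (f y).
Proof. by move=> H; have /(_ _ H) := @mfun_continuous _ _ _ f x. Qed.

Section LineBundleMorphisms.
Variables (A : comNzRingType) (Z W : lrs A) (f : mor Z W).
Variables (L : line_bundle Z) (M : line_bundle W).

Section Given.
Variable phi : lbmor f L M.

Lemma lbfun_homog x n (w : alg M (f x)) : homog n w -> homog n (lbfun phi x w).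
Proof.
have [e eg] := generator_at M (f x); move=> /(proj2 eg)[c ->].
rewrite lbfunZ rmorphXn; apply/(proj2 (lbfun_generator phi eg)).
by exists (comor f x c).
Qed.

Lemma lbfun_nonvanishing x n (w : alg M (f x)) : nonvanishing n w ->
  nonvanishing n (lbfun phi x w).
Proof.
move=> [e [c [eg cu ->]]]; rewrite lbfunZ rmorphXn.
exists (lbfun phi x e), (comor f x c); split=> //.
  exact: lbfun_generator.
exact: is_unit_rmorph.
Qed.

Lemma lbfun_nonvanishingE x n (w : alg M (f x)) : homog n w ->
  nonvanishing n (lbfun phi x w) -> nonvanishing n w.
Proof.
have [e eg] := generator_at M (f x); move=> /(proj2 eg)[c ->].
rewrite lbfunZ rmorphXn => wn.
exists e, c; split=> //; apply: comor_local.
apply: nonvanishing_unit wn; apply: generator_homogX.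
exact: lbfun_generator.
Qed.

Lemma lbfun_inj_homog x n (w : alg M (f x)) : injective (comor f x) -> homog n w ->
  lbfun phi x w = 0 -> w = 0.
Proof.
move=> cinj; have [e eg] := generator_at M (f x); move=> /(proj2 eg)[c ->].
rewrite lbfunZ rmorphXn => c0; suff -> : c = 0 by rewrite scale0r.
apply: cinj; rewrite rmorph0.
apply: (generator_scale_inj (n := n) (lbfun_generator phi eg)).
by rewrite scale0r.
Qed.

Lemma lbfun_homog_inj x n (w w' : alg M (f x)) : injective (comor f x) ->
  homog n w -> homog n w' -> lbfun phi x w = lbfun phi x w' -> w = w'.
Proof.
move=> cinj wn w'n ww'; apply/eqP; rewrite -subr_eq0; apply/eqP.
by apply: (lbfun_inj_homog cinj (homogB wn w'n)); rewrite rmorphB ww' subrr.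
Qed.

Lemma lbfun_surj_homog x n (w : alg L x) : (forall b, exists a, comor f x a = b) ->
  homog n w -> exists2 w' : alg M (f x), homog n w' & lbfun phi x w' = w.
Proof.
move=> csurj; have [e eg] := generator_at M (f x).
move=> /(proj2 (lbfun_generator phi eg))[c ->].
have [a ac] := csurj c; exists (a *: e ^+ n); last by rewrite lbfunZ rmorphXn ac.
by apply/(proj2 eg); exists a.
Qed.

Lemma lpull0 : lpull phi 0 = 0.
Proof. by apply: functional_extensionality_dep => x; exact: rmorph0. Qed.
Lemma lpull1 : lpull phi 1 = 1.
Proof. by apply: functional_extensionality_dep => x; exact: rmorph1. Qed.
Lemma lpullD s t : lpull phi (s + t) = lpull phi s + lpull phi t.
Proof. by apply: functional_extensionality_dep => x; exact: rmorphD. Qed.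
Lemma lpullM s t : lpull phi (s * t) = lpull phi s * lpull phi t.
Proof. by apply: functional_extensionality_dep => x; exact: rmorphM. Qed.
Lemma lpullX s n : lpull phi (s ^+ n) = lpull phi s ^+ n.
Proof. by elim: n => [|n IH]; rewrite ?lpull1 // !exprS lpullM IH. Qed.
Lemma lpullZ (a : A) s : lpull phi (a *: s) = a *: lpull phi s.
Proof.
apply: functional_extensionality_dep => x; rewrite /lpull lbfunZ.
by rewrite linearZ /= rmorph1.
Qed.
Lemma lpull_sum I (l : seq I) (P : pred I) (F : I -> germs M) :
  lpull phi (\sum_(j <- l | P j) F j) = \sum_(j <- l | P j) lpull phi (F j).
Proof. exact: (big_morph _ lpullD lpull0). Qed.

Lemma lpull_H0 n s : H0 M n s -> H0 L n (lpull phi s).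
Proof.
move=> sn x; have [sr sh] := sn (f x); split; last exact: lbfun_homog.
exact: lbfun_reg.
Qed.

(** A section with the germ of s at [f x] agrees with s near x after pullback, hence also before it:
    the comorphisms are injective and f maps neighbourhoods to neighbourhoods. *)
Lemma lpull_lreg_open n (s : germs M) x : open_immersion f ->
  (forall y, homog n (s (f y))) -> lreg (lpull phi s) x -> lreg s (f x).
Proof.
move=> [_ fopen fbij] sn sr.
have [e er eg] := locally_trivial M (f x); have egx := nbhs_singleton eg.
have /(proj2 egx)[c sE] := sn x; have [d dr dx] := reg_exists c.
have s'r : lreg (fun y => d y *: e y ^+ n) (f x) by apply: lregZ => //; exact: lreg_exp.
apply: (lreg_eq_near _ s'r).
have near1 : \forall y \near x, d (f y) *: e (f y) ^+ n = s (f y).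
  have egf := near_pull eg.
  have := lreg_near_eq (lbfun_reg phi s'r) sr.
  rewrite /lpull dx -sE => /(_ erefl) H.
  near=> y; apply: (@lbfun_homog_inj y n); first exact: bij_inj (fbij y).
  - have eyg : generator homog (e (f y)) by near: y.
    by apply/(proj2 eyg); exists (d (f y)).
  - exact: sn.
  - by near: y.
apply: filterS (fopen _ _ near1) => _ [y yE <-] //.
Unshelve. all: by end_near. Qed.
End Given.

Variables (g : forall x, alg M (f x)) (g' : forall x, alg L x).
Hypothesis gg : forall x, generator homog (g x).
Hypothesis g'g : forall x, generator homog (g' x).
Hypothesis compat : forall x, exists (G : germs M) (G' : germs L),
  [/\ lreg G (f x), lreg G' x, nonvanishing 1 (G (f x)) &
    \forall y \near x, exists c, G (f y) = c *: g y /\ G' y = comor f y c *: g' y].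

(** The generators g and g' are chosen point by point and need not vary regularly. Regularity is
    tested instead on sections G and G' having corresponding coefficients with respect to g and
    g'. *)
Lemma lbmor_exists : exists phi : lbmor f L M, forall x, lbfun phi x (g x) = g' x.
Proof.
have [phi phiP] := dep_choice (fun x => generator_extend (comor f x) (g' x) (gg x)).
have phiE x := proj2 (phiP x); have phiZ x := proj1 (phiP x).
unshelve eexists (@LBMor A Z W f L M phi _ _ _) => //.
- move=> s x sr; have [G [G' [Gr G'r Gn GG']]] := compat x.
  have phiG : \forall y \near x, phi y (G (f y)) = G' y.
    by apply: filterS GG' => y [c [-> ->]]; rewrite phiZ phiE.
  (* The stalk at [f x] is the polynomial algebra on G (f x), so some polynomial in G with regular
     coefficients has the germ of s; phi sends G to G' near x. *)
  have [s' [s'r s'x s'phi]] : exists s' : germs M, [/\ lreg s' (f x), s' (f x) = s (f x)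
      & lreg (fun y => phi y (s' (f y))) x].
    move: (s (f x)); apply: (generator_ind (nonvanishing_generator Gn)).
      exists (fun=> 0); split=> //; first exact: lreg_zero.
      apply: lreg_eq_near (lreg_zero L x).
      by apply: filterE => y; rewrite rmorph0.
    move=> w c [s' [s'r s'x s'phi]]; have [d dr dx] := reg_exists c.
    exists (fun y => s' y * G y + d y *: 1); split.
    - apply: lregD; first exact: Defs.lregM.
      by apply: lregZ => //; exact: Defs.lreg1.
    - by rewrite s'x dx.
    - have r1 : lreg (fun y => phi y (s' (f y)) * G' y + pull f d y *: 1) x.
        apply: lregD; first exact: Defs.lregM.
        by apply: lregZ; [exact: comor_reg|exact: Defs.lreg1].
      apply: lreg_eq_near r1; apply: filterS phiG => y phiG.
      by rewrite rmorphD rmorphM phiG phiZ rmorph1.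
  apply: lreg_eq_near s'phi.
  by apply: filterS (near_pull (lreg_near_eq s'r sr s'x)) => y ->.
- move=> x w wg; have /(proj2 (gg x))[c wE] := generator_homog wg.
  rewrite wE phiZ rmorphXn phiE; apply: nonvanishing_generator.
  apply: nonvanishingZ; last by rewrite expr1; exact: generator_nonvanishing.
  apply: is_unit_rmorph; apply: (nonvanishing_unit (n := 1) (w := g x ^+ 1)).
    exact: generator_homogX (gg x).
  by rewrite -wE; exact: generator_nonvanishing.
Qed.
End LineBundleMorphisms.

(** * Sections on closed subspaces of Proj *)

Section ClosedSubspacesOfProj.
Variables (A : comNzRingType) (P : lrs A) (O : line_bundle P) (R : graded_ring).
Variables (one : R) (Rax : graded_axioms one) (th : R -> germs O).
Hypothesis Rproj : is_proj th.
Hypothesis gdeg_inj : forall n m (a : R), gdeg n a -> gdeg m a -> n = m \/ a = 0.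
Variables (r : nat) (b : nat -> R).
Hypothesis b_deg : forall k, gdeg 1 (b k).
Hypothesis b_cover : forall z, exists2 k, (k < r)%N & nonvanishing 1 (th (b k) z).
Variables (Z : lrs A) (L : line_bundle Z) (f : Z -> P) (Th : R -> germs L).
Hypothesis f_closed : closed (range f).
Hypothesis f_nbhs : forall x (V : set Z), nbhs x V ->
  exists2 U : set P, nbhs (f x) U & f @^-1` U `<=` V.
Hypothesis Th_H0 : forall n a, gdeg n a -> H0 L n (Th a).
Hypothesis ThD : forall n a c, gdeg n a -> gdeg n c -> Th (a + c) = Th a + Th c.
Hypothesis ThM : forall n m a c, gdeg n a -> gdeg m c -> Th (gmul a c) = Th a * Th c.
Hypothesis Th_nonvanishing : forall n a x, gdeg n a ->
  (nonvanishing n (Th a x) <-> nonvanishing n (th a (f x))).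

Let Th_homog n a x : gdeg n a -> homog n (Th a x).
Proof. by move=> na; case: (Th_H0 na x). Qed.

Lemma graded_map0 : Th 0 = 0.
Proof.
have := ThD (gdeg0 Rax 0) (gdeg0 Rax 0); rewrite addr0 => /eqP.
by rewrite -subr_eq0 opprD addrA subrr sub0r oppr_eq0 => /eqP.
Qed.

Lemma graded_mapN n a : gdeg n a -> Th (- a) = - Th a.
Proof.
move=> na; apply/eqP; rewrite -addr_eq0 -(ThD (gdegN Rax na) na).
by rewrite addNr graded_map0.
Qed.

Lemma graded_mapB n a c : gdeg n a -> gdeg n c -> Th (a - c) = Th a - Th c.
Proof. by move=> na nc; rewrite (ThD na (gdegN Rax nc)) (graded_mapN nc). Qed.

Lemma graded_map_cover x : exists2 k, (k < r)%N & nonvanishing 1 (Th (b k) x).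
Proof. by have [k kr kn] := b_cover (f x); exists k => //; apply/Th_nonvanishing. Qed.

Lemma graded_map1 : Th one = 1.
Proof.
apply: functional_extensionality_dep => x; have [k kr kn] := graded_map_cover x.
apply: (nonvanishing_mulI kn (m := 0)).
- exact: Th_homog (gdeg1 Rax).
- exact: homog1.
rewrite mulr1 mulrC -[in RHS](gmul1 Rax (b_deg k)) (ThM (gdeg1 Rax) (b_deg k)).
by [].
Qed.

Lemma graded_mapX d a K : gdeg d a -> Th (gpow one a K) = Th a ^+ K.
Proof.
move=> da; elim: K => [|K IH]; first by rewrite /= graded_map1.
by rewrite /= (ThM da (gdeg_pow Rax K da)) IH exprS.
Qed.

Lemma proj_pow_nonvanishing m q z K : gdeg m q -> nonvanishing m (th q z) ->
  nonvanishing (K.+1 * m) (th (gpow one q K.+1) z).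
Proof.
move=> mq qn; elim: K => [|K IH].
  by rewrite mul1n /= (gmulC Rax mq (gdeg1 Rax)) (gmul1 Rax mq).
rewrite mulSn -[gpow _ _ _]/(gmul q (gpow one q K.+1)).
by rewrite (projM Rproj mq (gdeg_pow Rax K.+1 mq)); exact: nonvanishingM.
Qed.

(** If no power of a were in I, some point of D_+(a) would lie outside every D_+(c) with c in I. *)
Lemma cover_power (I : nat -> set R) d a : hideal I -> (0 < d)%N -> gdeg d a ->
  (forall z, exists n c, I n c /\ nonvanishing n (th c z)) ->
  exists K, I (K * d)%N (gpow one a K).
Proof.
move=> Ii d0 da Icov; apply: contrapT => /forallNP noK.
have [z _ zI] := proj_point Rax Rproj gdeg_inj Ii d0 da noK.
by have [n [c [Ic cn]]] := Icov z; exact: zI Ic cn.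
Qed.

(** The elements a such that one K serves on all of D(a) form a homogeneous ideal. Near a point
    outside the closed image of f, a set D_+(a) that misses the image qualifies vacuously. The ideal
    thus contains powers of the finitely many b_k, and these cover Z. *)
Lemma quasi_compact (Q : nat -> set Z) : (forall K, Q K `<=` Q K.+1) ->
  (forall x : Z, exists K, \forall y \near x, Q K y) -> exists K, forall x, Q K x.
Proof.
move=> QS Qloc.
have Qmono := chain_mono QS.
pose I n := [set a : R | gdeg n a /\
  exists K, forall x, nonvanishing n (Th a x) -> Q K x].
have Ii : hideal I.
  split.
  - by move=> n a [].
  - move=> n; split; first exact: gdeg0 Rax n.
    by exists 0%N => x; rewrite graded_map0 => /nonvanishing_neq0.
  - move=> n a c [na [K aK]] [nc [K' cK']]; split; first exact: (gdegD Rax).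
    exists (maxn K K') => x; rewrite (ThD na nc) => an.
    have [/aK|/cK'] := nonvanishing_add (Th_homog x na) (Th_homog x nc) an.
      exact: Qmono (leq_maxl _ _) _.
    exact: Qmono (leq_maxr _ _) _.
  - move=> n m a c mc [na [K aK]]; split; first exact: (gdegM Rax).
    exists K => x; rewrite (ThM mc na) => an; apply: aK.
    exact: nonvanishing_mulr (Th_homog x mc) (Th_homog x na) an.
have Icov z : exists n c, I n c /\ nonvanishing n (th c z).
  case: (pselect (range f z)) => [[x _ xz]|zf].
    have [K QK] := Qloc x; have [U Ux UQ] := f_nbhs QK.
    rewrite xz in Ux; have [n [a [_ na an aU]]] := proj_nbhs Rproj Ux.
    exists n, a; split=> //; split=> //; exists K => y /(Th_nonvanishing y na) yn.
    by apply: UQ; exact: aU.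
  have Uz : nbhs z (~` range f) by apply: open_nbhs_nbhs; split=> //; exact: closed_openC.
  have [n [a [_ na an aU]]] := proj_nbhs Rproj Uz.
  exists n, a; split=> //; split=> //; exists 0%N => y /(Th_nonvanishing y na) /aU [].
  by exists y.
have KP k : exists K, forall x, nonvanishing 1 (Th (b k) x) -> Q K x.
  have [K [_ [K' KK']]] := cover_power Ii (ltn0Sn 0) (b_deg k) Icov.
  exists K' => x bx; apply: KK'.
  by rewrite (graded_mapX K (b_deg k)) germsX; exact: nonvanishingX.
have [K KQ] : exists K, forall k, (k < r)%N -> forall x, nonvanishing 1 (Th (b k) x) ->
    Q K x.
  elim: (r) => [|m [K IH]]; first by exists 0%N.
  have [K' K'P] := KP m; exists (maxn K K') => k.
  rewrite ltnS leq_eqVlt => /orP[/eqP ->|km] x xn.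
    by apply: (Qmono _ _ (leq_maxr K K')); exact: K'P.
  by apply: (Qmono _ _ (leq_maxl K K')); exact: IH xn.
by exists K => x; have [k kr kn] := graded_map_cover x; exact: KQ kn.
Qed.

Hypothesis Th_fraction : forall x (c : stalk Z x), exists n p q,
  [/\ gdeg n p, gdeg n q, nonvanishing n (Th q x) & c *: Th q x = Th p x].
Hypothesis Th_zero : forall n m p q, gdeg n p -> gdeg m q -> (0 < m)%N ->
  (forall x, nonvanishing m (Th q x) -> Th p x = 0) ->
  exists K, Th q ^+ K * Th p = 0.

(** Around x, rho is a function times b_k^n, and the germ of the function is a fraction p/q by
    [Th_fraction]. The factor h confines the resulting equality to a basic open set on which it
    holds. *)
Lemma section_fraction n rho x : H0 L n rho -> exists m q p,
  [/\ (0 < m)%N, gdeg m q, gdeg (m + n) p, nonvanishing m (Th q x) &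
      forall y, nonvanishing m (Th q y) -> Th q y * rho y = Th p y].
Proof.
move=> rhoH; have [k kr kn] := graded_map_cover x.
have bn := nonvanishingX n kn; rewrite muln1 in bn.
have [c rhoE] := nonvanishing_fraction bn (proj2 (rhoH x)).
have [m [p [q [mp mq qn cE]]]] := Th_fraction c.
have bnd := gdeg_pow Rax n (b_deg k); rewrite muln1 in bnd.
have E : Th q x * rho x = Th (gmul p (gpow one (b k) n)) x.
  rewrite (ThM mp bnd) (graded_mapX n (b_deg k)) rhoE -scalerAr scalerAl cE.
  by rewrite -[RHS]/(Th p x * (Th (b k) ^+ n) x) germsX.
have Er1 : lreg (Th q * rho) x.
  by apply: Defs.lregM; [case: (Th_H0 mq x)|case: (rhoH x)].
have Er2 : lreg (Th (gmul p (gpow one (b k) n))) x.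
  by case: (Th_H0 (gdegM Rax mp bnd) x).
have [U Ux UE] := f_nbhs (lreg_near_eq Er1 Er2 E).
have [d [h [d0 dh hn hU]]] := proj_nbhs Rproj Ux.
exists (d + m)%N, (gmul h q), (gmul h (gmul p (gpow one (b k) n))); split.
- by rewrite addn_gt0 d0.
- exact: (gdegM Rax).
- by rewrite -addnA; apply: (gdegM Rax) => //; exact: (gdegM Rax).
- by rewrite (ThM dh mq); apply: nonvanishingM => //; apply/Th_nonvanishing.
move=> y; rewrite (ThM dh mq) (ThM dh (gdegM Rax mp bnd)) => hqn.
have /hU yU : nonvanishing d (th h (f y)).
  apply/Th_nonvanishing => //.
  exact: nonvanishing_mull (Th_homog y dh) (Th_homog y mq) hqn.
by rewrite -[LHS]mulrA; congr (_ * _); exact: UE.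
Qed.

(** The difference of q rho and p vanishes on D(q). Locally it is again a fraction, so [Th_zero]
    kills it by a power of q, and quasi-compactness makes the exponent uniform. *)
Lemma section_extend n rho m q p : H0 L n rho -> (0 < m)%N -> gdeg m q ->
  gdeg (m + n) p -> (forall y, nonvanishing m (Th q y) -> Th q y * rho y = Th p y) ->
  exists K, Th q ^+ K * (Th q * rho - Th p) = 0.
Proof.
move=> rhoH m0 mq mnp qE; set sg := Th q * rho - Th p.
have sgH : H0 L (m + n) sg by apply: H0B; [apply: H0M => //|]; exact: Th_H0.
have [K KP] : exists K, forall x, Th q x ^+ K * sg x = 0.
  apply: quasi_compact => [K x xK|x].
    by rewrite exprS -mulrA xK mulr0.
  have [m' [q' [p' [m'0 m'q' p'd q'x q'E]]]] := section_fraction x sgH.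
  have qq'd := gdegM Rax mq m'q'.
  have [|y qq'n|K KE] := Th_zero p'd qq'd; first by rewrite addn_gt0 m0.
    rewrite (ThM mq m'q') in qq'n.
    have qn := nonvanishing_mull (Th_homog y mq) (Th_homog y m'q') qq'n.
    have q'n := nonvanishing_mulr (Th_homog y mq) (Th_homog y m'q') qq'n.
    rewrite -(q'E y q'n) (_ : sg y = 0) ?mulr0 //.
    by rewrite -[LHS]/(Th q y * rho y - Th p y) qE // subrr.
  exists K; have q'r : lreg (Th q') x by case: (Th_H0 m'q' x).
  apply: filterS (nonvanishing_near q'r q'x) => y q'n.
  have sgh : homog (m + n) (sg y) by case: (sgH y).
  have qKh := homogX K (Th_homog y mq).
  have := congr1 (fun s : germs L => s y) KE.
  rewrite -[LHS]/((Th (gmul q q') ^+ K) y * Th p' y) germsX (ThM mq m'q').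
  rewrite -[(Th q * Th q') y]/(Th q y * Th q' y) exprMn -(q'E y q'n).
  rewrite mulrCA [_ ^+ K * _]mulrC -!mulrA => E1.
  apply: (nonvanishing_mul0 (nonvanishingX K q'n) (homogM qKh sgh)).
  apply: (nonvanishing_mul0 q'n) E1.
  exact: homogM (homogX K (Th_homog y m'q')) (homogM qKh sgh).
exists K; apply: functional_extensionality_dep => x.
by rewrite -[LHS]/((Th q ^+ K) x * sg x) germsX KP.
Qed.

(** The a for which a rho comes from R form an ideal of denominators. It has no zero on Z by
    [section_extend], nor outside Z thanks to elements q with D(q) empty on Z; hence it contains a
    power of each b_k. *)
Lemma section_power n rho k : H0 L n rho ->
  exists K p, gdeg (n + K) p /\ Th (b k) ^+ K * rho = Th p.
Proof.
move=> rhoH; pose I m := [set a : R | gdeg m a /\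
  exists p, gdeg (m + n) p /\ Th a * rho = Th p].
have Ii : hideal I.
  split.
  - by move=> m a [].
  - move=> m; split; first exact: gdeg0 Rax m.
    by exists 0; split; [exact: (gdeg0 Rax)|rewrite graded_map0 mul0r].
  - move=> m a c [ma [p [mp pE]]] [mc [p' [mp' p'E]]]; split; first exact: (gdegD Rax).
    exists (p + p'); split; first exact: (gdegD Rax).
    by rewrite (ThD ma mc) mulrDl pE p'E (ThD mp mp').
  - move=> m m' a c m'c [ma [p [mp pE]]]; split; first exact: (gdegM Rax).
    exists (gmul c p); split; first by rewrite -addnA; exact: (gdegM Rax).
    by rewrite (ThM m'c ma) -mulrA pE (ThM m'c mp).
have extend m q p : (0 < m)%N -> gdeg m q -> gdeg (m + n) p ->
    (forall y, nonvanishing m (Th q y) -> Th q y * rho y = Th p y) ->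
    exists K, I (K.+1 * m)%N (gpow one q K.+1).
  move=> m0 mq mp qE; have [K KE] := section_extend rhoH m0 mq mp qE.
  have qKd := gdeg_pow Rax K mq.
  exists K; split; first exact: (gdeg_pow Rax).
  exists (gmul (gpow one q K) p); split.
    have -> : (K.+1 * m + n = K * m + (m + n))%N by rewrite mulSn [(m + _)%N]addnC addnA.
    exact: (gdegM Rax).
  rewrite (graded_mapX K.+1 mq) (ThM qKd mp) (graded_mapX K mq) exprSr -mulrA.
  by apply/eqP; rewrite -subr_eq0 -mulrBr KE.
have Icov z : exists n c, I n c /\ nonvanishing n (th c z).
  case: (pselect (range f z)) => [[x _ xz]|zf].
    have [m [q [p [m0 mq mp qn qE]]]] := section_fraction x rhoH.
    have [K IK] := extend m q p m0 mq mp qE.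
    exists (K.+1 * m)%N, (gpow one q K.+1); split=> //.
    rewrite -xz; apply/Th_nonvanishing; first exact: (gdeg_pow Rax).
    by rewrite (graded_mapX K.+1 mq) germsX; exact: nonvanishingX.
  have Uz : nbhs z (~` range f) by apply: open_nbhs_nbhs; split=> //; exact: closed_openC.
  have [m [q [m0 mq qn qU]]] := proj_nbhs Rproj Uz.
  have [|K IK] := extend m q 0 m0 mq (gdeg0 Rax _).
    by move=> y /(Th_nonvanishing y mq) /qU []; exists y.
  exists (K.+1 * m)%N, (gpow one q K.+1); split=> //.
  exact: proj_pow_nonvanishing.
have [K [_ [p [pd pE]]]] := cover_power Ii (ltn0Sn 0) (b_deg k) Icov.
rewrite muln1 addnC in pd.
by exists K, p; split=> //; rewrite -pE (graded_mapX K (b_deg k)).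
Qed.

Variable C : set (R -> R).
Let x k := gmul (b k).
Hypothesis xB : forall k u v, x k (u - v) = x k u - x k v.
Hypothesis xC : forall k l v, x k (x l v) = x l (x k v).
Hypothesis CB : forall c u v, C c -> c (u - v) = c u - c v.
Hypothesis Cx : forall c k v, C c -> c (x k v) = x k (c v).
Hypothesis R_sub : graded_sub r x C (@gdeg R).
Hypothesis R_acc : graded_acc r x C (@gdeg R).
Hypothesis Th_C : forall n c a, C c -> gdeg n a -> Th a = 0 -> Th (c a) = 0.

Lemma gpowE k K n a : gdeg n a -> iter K (x k) a = gmul (gpow one (b k) K) a.
Proof.
move=> na; elim: K => [|K IH] /=; first by rewrite (gmul1 Rax na).
by rewrite IH /x (gmulA Rax (b_deg k) (gdeg_pow Rax K (b_deg k)) na).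
Qed.

Lemma Th_iter k K n a : gdeg n a -> Th (iter K (x k) a) = Th (b k) ^+ K * Th a.
Proof.
move=> na; rewrite (gpowE k K na) (ThM (gdeg_pow Rax K (b_deg k)) na).
by rewrite (graded_mapX K (b_deg k)).
Qed.

Lemma Th_cover_inj K n (s t : germs L) : (forall x, homog n (s x)) ->
  (forall x, homog n (t x)) ->
  (forall k, (k < r)%N -> Th (b k) ^+ K * s = Th (b k) ^+ K * t) -> s = t.
Proof.
move=> sn tn st; apply: functional_extensionality_dep => y.
have [k kr kn] := graded_map_cover y; have /(congr1 (fun s : germs L => s y)) := st k kr.
rewrite -[LHS]/((Th (b k) ^+ K) y * s y) -[RHS]/((Th (b k) ^+ K) y * t y) germsX.
exact: nonvanishing_mulI (nonvanishingX K kn) (sn y) (tn y).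
Qed.

(** The numerators of b_k^K rho form a compatible family modulo the kernel of Th, and saturation of
    this kernel extends it to a single element of R. *)
Theorem sections_surjective : exists n0, forall n, (n0 <= n)%N -> forall rho, H0 L n rho ->
  exists2 p, gdeg n p & Th p = rho.
Proof.
pose ker n := [set a : R | gdeg n a /\ Th a = 0].
have ker_sub : graded_sub r x C ker.
  move=> n; have [[_ RB] RC Rx] := R_sub n; split.
  - split; first by split; [exact: (gdeg0 Rax)|exact: graded_map0].
    move=> u v [nu u0] [nv v0]; split; first exact: RB.
    by rewrite (graded_mapB nu nv) u0 v0 subrr.
  - by move=> c v Cc [nv v0]; split; [exact: RC|exact: (Th_C Cc nv v0)].
  - move=> k v kr [nv v0]; split; first exact: Rx.
    by rewrite /x (ThM (b_deg k) nv) v0 mulr0.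
have [n0 n0P] := saturated_noetherian xB xC CB Cx R_acc R_sub ker_sub (fun n a => @proj1 _ _).
exists n0 => n /n0P[_ ext] rho rhoH.
have [K0 [p p0]] : exists K (p : nat -> R), forall k, (k < r)%N ->
    gdeg (n + K)%N (p k) /\ Th (b k) ^+ K * rho = Th (p k).
  have /choice[Kp KpP] : forall k, exists Kp : nat * R, gdeg (n + Kp.1)%N Kp.2 /\
      Th (b k) ^+ Kp.1 * rho = Th Kp.2.
    by move=> k; have [K [p pP]] := section_power k rhoH; exists (K, p).
  (* Multiplying each numerator by a further power of b_k makes all exponents equal. *)
  pose K := (\max_(k < r) (Kp k).1)%N.
  exists K, (fun k => iter (K - (Kp k).1)%N (x k) (Kp k).2) => k kr.
  have Kk : ((Kp k).1 <= K)%N by exact: (leq_bigmax (Ordinal kr)).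
  have [kd kE] := KpP k; split.
    have := graded_sub_iter (K - (Kp k).1)%N R_sub kr kd.
    by rewrite -addnA subnKC.
  by rewrite (Th_iter _ _ kd) -kE mulrA -exprD subnK.
have [k kr|k l kr lr|v nv vE] := ext K0 p; first by have [] := p0 k kr.
  have [kd kE] := p0 k kr; have [ld lE] := p0 l lr.
  have kd' := graded_sub_iter K0 R_sub lr kd.
  have ld' := graded_sub_iter K0 R_sub kr ld.
  split; first by case: (R_sub (n + K0 + K0)%N) => -[_ RB] _ _; exact: RB.
  rewrite (graded_mapB ld' kd') (Th_iter k K0 ld) (Th_iter l K0 kd) -kE -lE.
  by rewrite mulrCA subrr.
exists v => //; apply: (@Th_cover_inj K0 n).
- by move=> y; exact: Th_homog.
- by move=> y; case: (rhoH y).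
move=> k kr; have [kd kE] := p0 k kr; have [_] := vE k kr.
have vd := graded_sub_iter K0 R_sub kr nv.
rewrite (graded_mapB kd vd) (Th_iter k K0 nv) kE => /eqP; rewrite subr_eq0 => /eqP ->.
by [].
Qed.
End ClosedSubspacesOfProj.

(** * Affine schemes and affine lines *)

Section Spec.
Variables (A : comNzRingType) (Z : lrs A) (U : set Z) (R : comNzRingType) (f : R).
Variable th : R -> functions Z.
Hypothesis Us : is_spec U f th.
Implicit Types (r g q : R) (z : Z).

Lemma spec0 z : U z -> th 0 z = 0.
Proof.
move=> Uz; have := specD Us 0 0 Uz; rewrite addr0 => /eqP.
by rewrite -subr_eq0 opprD addrA subrr sub0r oppr_eq0 => /eqP.
Qed.

Lemma specN r z : U z -> th (- r) z = - th r z.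
Proof.
by move=> Uz; apply/eqP; rewrite -addr_eq0 -(specD Us _ _ Uz) addNr spec0.
Qed.

Lemma specB r q z : U z -> th (r - q) z = th r z - th q z.
Proof. by move=> Uz; rewrite (specD Us _ _ Uz) specN. Qed.

Lemma specX r K z : U z -> th (r ^+ K) z = th r z ^+ K.
Proof.
by move=> Uz; elim: K => [|K IH]; rewrite ?(spec1 Us Uz) // !exprS (specM Us _ _ Uz) IH.
Qed.

Lemma spec_near z : U z -> \forall y \near z, U y.
Proof. by move=> Uz; apply: open_nbhs_nbhs; split=> //; exact: spec_open Us. Qed.

(** If no power of f g killed r, a prime containing the annihilator of r and avoiding f g would be a
    point where g is invertible and the germ of r is nonzero. *)
Lemma spec_vanishing r g : (forall z, U z -> is_unit (th g z) -> th r z = 0) ->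
  exists K, (f * g) ^+ K * r = 0.
Proof.
move=> r0; apply: contrapT => /forallNP noK.
have [||||P [[P0 P1] PD PM Pp] [IP Pf]] := @prime_ideal_exists R [set a | a * r = 0] (f * g).
- by rewrite /= mul0r.
- by move=> a b /= ar br; rewrite mulrDl ar br addr0.
- by move=> a b /= br; rewrite -mulrA br mulr0.
- by move=> K; exact: noK.
have nPf : ~ P f by move=> Pf'; apply: (Pf 1%N); rewrite expr1 mulrC; exact: PM.
have nPg : ~ P g by move=> Pg'; apply: (Pf 1%N); rewrite expr1; exact: PM.
have [|z Uz zP] := spec_surj Us (P := P) _ nPf; first by split.
have gu : is_unit (th g z) by apply: contrapT => /zP.
have [q [qu qr]] := spec_zero Us Uz (r0 z Uz gu).
by have /zP := IP _ qr; apply.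
Qed.

(** Near z, d is a fraction r/q times a generator, on a set where some h is invertible. There r
    vanishes wherever g is invertible, so a power of f h g kills r, and g cancels. *)
Lemma spec_dense g (L : line_bundle Z) n (d : germs L) z :
  (forall r, g * r = 0 -> r = 0) -> U z -> lreg d z -> homog n (d z) ->
  (\forall y \near z, U y -> is_unit (th g y) -> d y = 0) -> d z = 0.
Proof.
move=> greg Uz dr dh d0; have [e er eg] := locally_trivial L z.
have en : nonvanishing n (e z ^+ n).
  rewrite -{1}[n]muln1; apply: nonvanishingX; apply: generator_nonvanishing.
  exact: nbhs_singleton eg.
have [c cr dE] := fraction_near dr dh (lreg_exp n er) en.
have [r [q [qu cE]]] := spec_frac Us (c z) Uz.
have := reg_near_eq (regM cr (spec_reg Us q Uz)) (spec_reg Us r Uz) cE => cE'.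
have nearV : \forall y \near z, [/\ U y -> is_unit (th g y) -> d y = 0,
   generator homog (e y), d y = c y *: e y ^+ n & c y * th q y = th r y].
  by near=> y; split; near: y.
have [h hu hV] := spec_nbhs Us Uz nearV.
have [|K KE] := @spec_vanishing r (h * g).
  move=> y Uy; rewrite (specM Us _ _ Uy) => hgu.
  have [dy0 eyg dyE cqE] := hV y Uy (is_unitMl hgu).
  rewrite -cqE (_ : c y = 0) ?mul0r //.
  have ey := nonvanishingX n (generator_nonvanishing eyg); rewrite muln1 in ey.
  by apply: (nonvanishing_scale0 ey); rewrite -dyE dy0 //; exact: is_unitMr hgu.
have {}KE : (f * h) ^+ K * r = 0.
  have gregX k q' : g ^+ k * q' = 0 -> q' = 0.
    by elim: k => [|k IH]; rewrite ?mul1r // exprS -mulrA => /greg.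
  by apply: (gregX K); rewrite -[RHS]KE !exprMn; ring.
have : (th f z * th h z) ^+ K * th r z = 0.
  by rewrite -(specM Us) // -specX // -(specM Us) // KE spec0.
move=> /(is_unit_mul0 (is_unitX K (is_unitM (spec_f Us Uz) hu))) r0.
rewrite (nbhs_singleton dE) (_ : c z = 0) ?scale0r //.
by apply: (is_unit_mul0 qu); rewrite mulrC cE.
Unshelve. all: by end_near. Qed.
End Spec.

Section SchemeSections.
Variables (A : comNzRingType) (X : lrs A) (L : line_bundle X).
Hypothesis hX : scheme X.

(** In an affine chart trivializing L, p and q become fractions and [spec_vanishing] applies to
    their numerators. With [quasi_compact] this yields the hypothesis [Th_zero] for X. *)
Lemma scheme_vanishing n m (p q : germs L) : H0 L n p -> H0 L m q ->
  (forall x, nonvanishing m (q x) -> p x = 0) ->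
  forall x : X, exists K, \forall y \near x, q y ^+ K * p y = 0.
Proof.
move=> pH qH pq0 x; have [U [R [th [Ux Us]]]] := hX x.
have [e er eg] := locally_trivial L x; have egx := nbhs_singleton eg.
have ek k : nonvanishing k (e x ^+ k).
  by rewrite -{1}[k]muln1; exact: nonvanishingX (generator_nonvanishing egx).
have [pr ph] := pH x; have [qr qh] := qH x.
have [c cr pE] := fraction_near pr ph (lreg_exp n er) (ek n).
have [g gr qE] := fraction_near qr qh (lreg_exp m er) (ek m).
have [r1 [q1 [q1u cE]]] := spec_frac Us (c x) Ux.
have [r2 [q2 [q2u gE]]] := spec_frac Us (g x) Ux.
have cE' := reg_near_eq (regM cr (spec_reg Us q1 Ux)) (spec_reg Us r1 Ux) cE.
have gE' := reg_near_eq (regM gr (spec_reg Us q2 Ux)) (spec_reg Us r2 Ux) gE.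
have q1u' := unit_near (spec_reg Us q1 Ux) q1u.
have q2u' := unit_near (spec_reg Us q2 Ux) q2u.
pose good y := [/\ generator homog (e y), p y = c y *: e y ^+ n, q y = g y *: e y ^+ m,
  c y * th q1 y = th r1 y & g y * th q2 y = th r2 y].
have nearV : \forall y \near x, good y by near=> y; split; near: y.
have [h hu hV] := spec_nbhs Us Ux nearV.
have [|K KE] := @spec_vanishing _ _ _ _ _ _ Us r1 (h * r2).
  move=> y Uy; rewrite (specM Us _ _ Uy) => hru.
  have [eyg pyE qyE c1 g2] := hV y Uy (is_unitMl hru).
  have ey k : nonvanishing k (e y ^+ k).
    by rewrite -{1}[k]muln1; exact: nonvanishingX (generator_nonvanishing eyg).
  rewrite -c1 (_ : c y = 0) ?mul0r //; apply: (nonvanishing_scale0 (ey n)).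
  rewrite -pyE pq0 // qyE; apply: nonvanishingZ (ey m).
  by have := is_unitMr hru; rewrite -g2 => /is_unitMl.
exists K; near=> y.
have Uy : U y by near: y; exact: spec_near Us _ Ux.
have [eyg -> -> c1 g2] : good y by near: y.
rewrite exprZn -scalerAl -scalerAr scalerA (_ : g y ^+ K * c y = 0) ?scale0r //.
have hyu : is_unit (th h y) by near: y; exact: unit_near (spec_reg Us h Ux) hu.
have q1yu : is_unit (th q1 y) by near: y.
have q2yu : is_unit (th q2 y) by near: y.
apply: (is_unit_mul0 (is_unitM (is_unitX K (is_unitM hyu q2yu)) q1yu)).
have : (th h y * th r2 y) ^+ K * th r1 y = 0.
  by rewrite -(specM Us) // -(specX Us) // -(specM Us) // -[h * r2]mul1r KE (spec0 Us).
by rewrite -c1 -g2 !exprMn => E; rewrite -[RHS]E; ring.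
Unshelve. all: by end_near. Qed.
End SchemeSections.

Section LineOver.
Variables (A : comNzRingType) (X Z : lrs A) (p : mor Z X) (v : functions Z).
Hypotheses (hX : scheme X) (Zline : is_line_over p v).

Section Chart.
Variables (U : set X) (R : comNzRingType) (th : R -> functions X).
Hypothesis Us : is_spec U 1 th.

Definition poly_eval (q : {poly R}) : functions Z :=
  fun z => \sum_(k < size q) pull p (th q`_k) z * v z ^+ k.

Lemma poly_eval_spec : is_spec (p @^-1` U) 1 poly_eval.
Proof. exact: (proj2 Zline). Qed.

Lemma poly_evalC r z : U (p z) -> poly_eval r%:P z = pull p (th r) z.
Proof.
move=> Uz; rewrite /poly_eval size_polyC; case: eqP => [->|_] /=.
  by rewrite big_ord0 /pull (spec0 Us Uz) rmorph0.
by rewrite big_ord_recl big_ord0 addr0 expr0 mulr1 coefC eqxx.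
Qed.

Lemma poly_evalX z : U (p z) -> poly_eval 'X z = v z.
Proof.
move=> Uz; rewrite /poly_eval size_polyX !big_ord_recl big_ord0 !coefX /= addr0.
by rewrite /pull (spec0 Us Uz) (spec1 Us Uz) rmorph0 rmorph1 mul0r add0r mul1r expr1.
Qed.
End Chart.

Lemma polyX_mul0 (R : comNzRingType) (q : {poly R}) : 'X * q = 0 -> q = 0.
Proof.
move=> Xq; apply/polyP => i; have /(congr1 (coefp i.+1)) := Xq.
by rewrite /= coefXM !coef0.
Qed.

Lemma line_coord_regular z (c : stalk Z z) : v z * c = 0 -> c = 0.
Proof.
move=> vc0; have [U [R [th [Uz Us]]]] := hX (p z).
have Zs := poly_eval_spec Us.
have [r [q [qu cE]]] := spec_frac Zs c Uz.
have : poly_eval th ('X * r) z = 0.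
  by rewrite (specM Zs) // (poly_evalX Us) // -cE mulrA vc0 mul0r.
move=> /(spec_zero Zs (z := z) Uz)[q' [q'u q'E]].
have q'r : q' * r = 0 by apply: polyX_mul0; rewrite mulrCA.
apply: (is_unit_mul0 qu); rewrite mulrC cE; apply: (is_unit_mul0 q'u).
by rewrite -(specM Zs) // q'r (spec0 Zs).
Qed.

Lemma line_dense (M : line_bundle Z) n (d : germs M) : H0 M n d ->
  (forall z, is_unit (v z) -> d z = 0) -> d = 0.
Proof.
move=> dH d0; apply: functional_extensionality_dep => z.
have [U [R [th [Uz Us]]]] := hX (p z); have [dr dh] := dH z.
apply: (spec_dense (poly_eval_spec Us) (g := 'X)) dr dh _ => //.
  exact: polyX_mul0.
have := spec_near (poly_eval_spec Us) (z := z) Uz.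
apply: filterS => y Uy _; rewrite (poly_evalX Us) //; exact: d0.
Qed.

(** The point of {v = 0} over x is the prime of polynomials whose constant coefficient is not
    invertible at x. The second clause, obtained by comparing constant coefficients, says that
    functions on X inject into functions modulo v at that point. *)
Lemma zero_section_point x : exists2 z, p z = x &
  forall (c : functions X) (g : stalk Z z), pull p c z = v z * g -> c (p z) = 0.
Proof.
have [U [R [th [Ux Us]]]] := hX x; have Zs := poly_eval_spec Us.
pose P : set {poly R} := [set q | ~ is_unit (th q`_0 x)].
have [|P1|z Uz zP] := spec_surj Zs (P := P).
- split.
  + by rewrite /P /= coef0 coefC eqxx (spec0 Us Ux) (spec1 Us Ux);
      split; [exact: is_unit0|apply; exact: is_unit1].
  + move=> a b; rewrite /P /= coefD (specD Us _ _ Ux) => na nb.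
    by case/is_unit_local.
  + move=> a b; rewrite /P /= coef0M (specM Us _ _ Ux) => nb /is_unitMr.
    by [].
  + move=> a b; rewrite /P /= coef0M (specM Us _ _ Ux) => nab.
    by apply/not_andP => -[au bu]; apply: nab; exact: is_unitM.
- by apply: P1; rewrite /P /= coefC eqxx (spec1 Us Ux); exact: is_unit1.
have unitE q : is_unit (poly_eval th q z) <-> is_unit (th q`_0 x).
  split=> [qu|qu]; apply: contrapT => nq; first by have /zP := nq; apply.
  by have /zP := nq; apply.
have zx : p z = x.
  apply: (spec_inj Us) => // r; have := unitE r%:P.
  rewrite (poly_evalC Us) // coefC eqxx => <-; split; last exact: comor_local.
  exact: is_unit_rmorph.
exists z => // c g cE; rewrite -zx in Ux unitE.
have [r [q [qu rE]]] := spec_frac Us (c (p z)) Ux.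
have [r' [q' [q'u r'E]]] := spec_frac Zs g Uz.
have [|q'' [q''u q''E]] := spec_zero Zs (z := z) (r := r%:P * q' - 'X * r' * q%:P) Uz.
  rewrite (specB Zs) // !(specM Zs) // !(poly_evalC Us) // (poly_evalX Us) //.
  rewrite -r'E /pull -rE rmorphM /= -[comor p z (c (p z))]/(pull p c z) cE.
  by ring.
have := congr1 (fun s : {poly R} => s`_0) q''E.
rewrite coef0M coefB coef0M coefC eqxx -mulrA coefXM subr0 coef0 => E.
apply: (is_unit_mul0 qu); rewrite mulrC rE.
apply: (is_unit_mul0 (proj1 (unitE _) q'u)); apply: (is_unit_mul0 (proj1 (unitE _) q''u)).
by rewrite -!(specM Us) // [q'`_0 * r]mulrC E (spec0 Us).
Qed.

(** Restriction to the zero section {v = 0}, one point at a time. *)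
Lemma line_constant_term (L : line_bundle X) (M : line_bundle Z) (phi : lbmor p M L) n
    (a : germs L) (g : germs M) : H0 L n a -> H0 M n g ->
  (forall z, lpull phi a z = v z *: g z) -> a = 0.
Proof.
move=> aH gH aE; apply: functional_extensionality_dep => x.
have [z <- zP] := zero_section_point x.
have [e eg] := generator_at L (p z).
have [c0 ac] := proj1 (proj2 eg _ _) (proj2 (aH (p z))).
have [c cr cE] := reg_exists c0.
have [g0 gE] := proj1 (proj2 (lbfun_generator phi eg) _ _) (proj2 (gH z)).
rewrite ac -cE (zP c g0) ?scale0r //.
apply: (generator_scale_inj (lbfun_generator phi eg) (n := n)).
by rewrite -scalerA -gE -aE /lpull ac -cE lbfunZ rmorphXn.
Qed.
End LineOver.

(** * The extended Rees algebra *)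

Section FiniteSupport.
Variables (A : comNzRingType) (X : lrs A) (L : line_bundle X).
Local Notation G := (germs L).
Implicit Types (a b c : int -> G) (g h : G) (l m k : int).

(** The monomial g tau^(-l) of S'. *)
Definition mono l g : int -> G := fun k => if k == l then g else 0.

Definition finite_support a : Prop := finite_set [set l | a l <> 0].

Lemma fsum_seq (V : nmodType) (s : seq int) (F : int -> V) : uniq s ->
  (forall l, l \notin s -> F l = 0) ->
  \sum_(l \in [set: int]) F l = \sum_(l <- s) F l.
Proof.
move=> us F0; rewrite (fsbigE s) //; last by move=> l _ /F0.
by apply: eq_bigl => l; rewrite in_setT.
Qed.

Lemma finite_support_seq a : finite_support a ->
  exists2 s, uniq s & forall l, l \notin s -> a l = 0.
Proof.
move=> /finite_seqP[s sE]; exists (undup s); first exact: undup_uniq.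
move=> l; rewrite mem_undup => ls; apply: contrapT => al.
by move: (sE) => /seteqP[/(_ l al)]; rewrite /= (negbTE ls).
Qed.

Lemma finite_support_ind (Q : int -> set G) (P : set (int -> G)) :
  P (fun=> 0) -> (forall l, Q l 0) ->
  (forall l g a, Q l g -> finite_support a -> (forall m, Q m (a m)) -> P a ->
     P (fun k => mono l g k + a k)) ->
  forall a, finite_support a -> (forall m, Q m (a m)) -> P a.
Proof.
move=> P0 Q0 Padd a /finite_support_seq[s _ sa] Qa.
elim: s a sa Qa => [|l s IH] a sa Qa.
  by rewrite (_ : a = fun=> 0) //; apply: funext => l; exact: sa.
pose a' k := if k == l then 0 else a k.
have -> : a = (fun k => mono l (a l) k + a' k).
  by apply: funext => k; rewrite /mono /a'; case: eqP => [->|_]; rewrite ?addr0 ?add0r.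
have sa' k : k \notin s -> a' k = 0.
  by rewrite /a'; case: (k =P l) => // /eqP kl ks; apply: sa; rewrite inE negb_or kl.
have Qa' k : Q k (a' k) by rewrite /a'; case: ifP.
apply: Padd => //; last exact: IH.
apply/finite_seqP; exists [seq k <- s | a' k != 0]; apply/seteqP; split=> k /=.
  move=> ak; rewrite mem_filter; apply/andP; split; first exact/eqP.
  by apply: contrapT => /negP /sa'.
by rewrite mem_filter => /andP[/eqP].
Qed.

Lemma finite_support0 : finite_support (fun=> 0).
Proof.
by apply: (sub_finite_set _ (finite_set0 int)) => l /= /(_ erefl).
Qed.

Lemma finite_support_mono l g : finite_support (mono l g).
Proof.
apply: (sub_finite_set _ (finite_set1 l)) => k /=; rewrite /mono.
by case: eqP.
Qed.

Lemma finite_supportD a b : finite_support a -> finite_support b ->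
  finite_support (fun k => a k + b k).
Proof.
move=> fa fb; apply: (@sub_finite_set _ _ ([set l | a l <> 0] `|` [set l | b l <> 0])).
  move=> k /= abk; apply: contrapT => /not_orP[/contrapT ak /contrapT bk].
  by apply: abk; rewrite ak bk addr0.
by rewrite finite_setU.
Qed.

Definition convol a b : int -> G := fun k => \sum_(l \in [set: int]) a l * b (k - l).

Lemma convol_seq s a b k : uniq s -> (forall l, l \notin s -> a l = 0) ->
  convol a b k = \sum_(l <- s) a l * b (k - l).
Proof. by move=> us sa; apply: fsum_seq => // l /sa ->; rewrite mul0r. Qed.

Lemma convol_mono l g b : convol (mono l g) b = fun k => g * b (k - l).
Proof.
apply: funext => k; rewrite (@convol_seq [:: l]) //.
  by rewrite big_seq1 /mono eqxx.
by move=> m; rewrite inE /mono => /negbTE ->.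
Qed.

Lemma convolDr a b c : finite_support a ->
  convol a (fun k => b k + c k) = fun k => convol a b k + convol a c k.
Proof.
move=> /finite_support_seq[s us sa]; apply: funext => k.
rewrite !(@convol_seq s) // -big_split /=; apply: eq_bigr => l _.
by rewrite mulrDr.
Qed.

Lemma convolDl a b c : finite_support a -> finite_support b ->
  convol (fun k => a k + b k) c = fun k => convol a c k + convol b c k.
Proof.
move=> /finite_support_seq[s us sa] /finite_support_seq[s' us' sb].
apply: funext => k; rewrite !(@convol_seq (undup (s ++ s'))) ?undup_uniq //.
- by rewrite -big_split /=; apply: eq_bigr => l _; rewrite mulrDl.
- by move=> l; rewrite mem_undup mem_cat negb_or => /andP[_ /sb].
- by move=> l; rewrite mem_undup mem_cat negb_or => /andP[/sa].
- by move=> l; rewrite mem_undup mem_cat negb_or => /andP[/sa -> /sb ->]; rewrite addr0.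
Qed.

Lemma convol0r a : convol a (fun=> 0) = fun=> 0.
Proof. by apply: funext => k; apply: fsbig1 => l _; rewrite mulr0. Qed.

Lemma convol0l a : convol (fun=> 0) a = fun=> 0.
Proof. by apply: funext => k; apply: fsbig1 => l _; rewrite mul0r. Qed.

Lemma mono_mul l m g h : convol (mono l g) (mono m h) = mono (l + m) (g * h).
Proof.
rewrite convol_mono; apply: funext => k; rewrite /mono subr_eq [m + l]addrC.
by case: ifP => _; rewrite ?mulr0.
Qed.

Lemma monoD l g h : mono l (g + h) = fun k => mono l g k + mono l h k.
Proof. by apply: funext => k; rewrite /mono; case: ifP; rewrite ?addr0. Qed.

Lemma mono0 l : mono l 0 = fun=> 0.
Proof. by apply: funext => k; rewrite /mono; case: ifP. Qed.

Lemma convolC a b : finite_support a -> finite_support b -> convol a b = convol b a.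
Proof.
move=> fa fb; apply: (@finite_support_ind (fun _ => setT)
    [set a | convol a b = convol b a]) fa _ => //=; first by rewrite convol0r convol0l.
move=> l g {}a _ fa _ IH.
rewrite convolDl //; last exact: finite_support_mono.
rewrite convolDr // IH; suff -> : convol (mono l g) b = convol b (mono l g) by [].
apply: (@finite_support_ind (fun _ => setT)
    [set b | convol (mono l g) b = convol b (mono l g)]) fb _ => //=.
  by rewrite convol0r convol0l.
move=> m h {}b _ fb _ {}IH; have fm := finite_support_mono.
by rewrite convolDr // convolDl // IH !mono_mul addrC mulrC.
Qed.

Lemma finite_support_shift l g b : finite_support b ->
  finite_support (fun k => g * b (k - l)).
Proof.
move=> fb; apply: (sub_finite_set _ (finite_image (fun k => k + l) fb)) => k /= gb.
exists (k - l); last by rewrite subrK.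
by move=> bkl; apply: gb; rewrite bkl mulr0.
Qed.

Lemma finite_support_convol a b : finite_support a -> finite_support b ->
  finite_support (convol a b).
Proof.
move=> fa fb; apply: (@finite_support_ind (fun _ => setT)
    [set a | finite_support (convol a b)]) fa _ => //=.
  by rewrite convol0l; exact: finite_support0.
move=> l g {}a _ fa _ IH; rewrite convolDl //; last exact: finite_support_mono.
apply: finite_supportD => //; rewrite convol_mono.
exact: finite_support_shift.
Qed.

Lemma convolA a b c : finite_support a -> finite_support b -> finite_support c ->
  convol a (convol b c) = convol (convol a b) c.
Proof.
move=> fa fb fc; have fm := finite_support_mono; have fcv := finite_support_convol.
apply: (@finite_support_ind (fun _ => setT)
    [set a | convol a (convol b c) = convol (convol a b) c]) fa _ => //=.
  by rewrite !convol0l.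
move=> l g {}a _ fa _ IH; rewrite !convolDl //; try exact: fcv.
rewrite IH.
suff -> : convol (mono l g) (convol b c) = convol (convol (mono l g) b) c by [].
apply: (@finite_support_ind (fun _ => setT)
    [set b | convol (mono l g) (convol b c) = convol (convol (mono l g) b) c]) fb _ => //=.
  by rewrite convol0l convol0r convol0l.
move=> m h {}b _ fb _ {}IH.
rewrite convolDl // convolDr // IH convolDr // convolDl //; try exact: fcv.
suff -> : convol (mono l g) (convol (mono m h) c) =
  convol (convol (mono l g) (mono m h)) c by [].
rewrite mono_mul !convol_mono; apply: funext => k.
by rewrite mulrA opprD addrA.
Qed.
End FiniteSupport.

(** * Powers of the ideal and the graded ring S' *)

Section ExtendedRees.
Variables (A : comNzRingType) (X Y : lrs A) (i : mor Y X) (L : line_bundle X).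
Local Notation G := (germs L).
Local Notation Ipow := (@ideal_pow A X Y i L).
Local Notation Ipowz := (@ideal_powz A X Y i L).
Implicit Types (g h : G).

Lemma ideal_pow_H0 l n : Ipow l n `<=` H0 L n.
Proof.
elim: l n => [n g //|l IH n _ [k [d [a [b [abP ->]]]]]].
apply: (submodule_sum _ (H0_submodule L n)) => j _.
have [dn [aH _] bI] := abP j; rewrite -(subnKC dn); apply: H0M => //; exact: IH.
Qed.

Lemma ideal_powD l n g h : Ipow l n g -> Ipow l n h ->
  Ipow l n (g + h).
Proof.
case: l => [|l] /=; first exact: H0D.
move=> [k [d [a [b [abP ->]]]]] [k' [d' [a' [b' [abP' ->]]]]].
pose join (T : Type) (u : 'I_k -> T) (u' : 'I_k' -> T) (j : 'I_(k + k')) :=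
  match fintype.split j with inl j1 => u j1 | inr j2 => u' j2 end.
exists (k + k')%N, (join _ d d'), (join _ a a'), (join _ b b'); split.
  by move=> j; rewrite /join; case: fintype.splitP => j' _.
rewrite big_split_ord /=; congr (_ + _); apply: eq_bigr => j _; rewrite /join.
  by case: fintype.splitP => j' /= => [/ord_inj -> //|jE];
    have := ltn_ord j; rewrite jE ltnNge leq_addr.
case: fintype.splitP => j' /= => [jE|/addnI/ord_inj -> //].
by have := ltn_ord j'; rewrite -jE ltnNge leq_addr.
Qed.

Lemma ideal_pow0 l n : Ipow l n (0 : G).
Proof.
case: l => [|l] /=; first exact: (H0_0 L n).
exists 0%N, (fun=> 0%N), (fun=> 0), (fun=> 0); split; first by case.
by rewrite big_ord0.
Qed.

Lemma ideal_powM l n m g h : Ipow l n g -> H0 L m h ->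
  Ipow l (n + m) (g * h).
Proof.
elim: l n g => [|l IH] n g /=; first exact: H0M.
move=> [k [d [a [b [abP ->]]]]] hH.
exists k, d, a, (fun j => b j * h); split; last first.
  by rewrite mulr_suml; apply: eq_bigr => j _; rewrite mulrA.
move=> j; have [dn aI bI] := abP j; split=> //; first exact: leq_trans dn (leq_addr _ _).
by rewrite -addnBAC //; exact: IH.
Qed.

Lemma ideal_pow_submodule l n : submodule (Ipow l n).
Proof.
split; first exact: (ideal_pow0 l n).
move=> a g h gI hI; apply: ideal_powD => //.
have a0 : H0 L 0 (a *: (1 : G)) by apply: H0Z; exact: H0_1.
have := ideal_powM gI a0; rewrite addn0 mulrC.
by rewrite (_ : a *: (1 : G) * g = a *: g) // germs_mulZ mul1r.
Qed.

Lemma ideal_pow_decr l n : Ipow l.+1 n `<=` Ipow l n.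
Proof.
move=> _ [k [d [a [b [abP ->]]]]].
apply: (submodule_sum _ (ideal_pow_submodule l n)) => j _.
have [dn [aH _] bI] := abP j.
by rewrite mulrC -(subnK dn); exact: ideal_powM.
Qed.

Lemma ideal_pow_mul l n l' n' g h : Ipow l n g -> Ipow l' n' h ->
  Ipow (l + l') (n + n') (g * h).
Proof.
elim: l n g => [|l IH] n g /=.
  by move=> gH hI; rewrite add0n mulrC addnC; exact: ideal_powM.
move=> [k [d [a [b [abP ->]]]]] hI.
exists k, d, a, (fun j => b j * h); split; last first.
  by rewrite mulr_suml; apply: eq_bigr => j _; rewrite mulrA.
move=> j; have [dn aI bI] := abP j; split=> //; first exact: leq_trans dn (leq_addr _ _).
by rewrite -addnBAC //; exact: IH.
Qed.

Lemma ideal_powz_H0 l n : Ipowz l n `<=` H0 L n.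
Proof. by case: l => l //=; exact: ideal_pow_H0. Qed.

Lemma ideal_powz_submodule l n : submodule (Ipowz l n).
Proof. by case: l => l /=; [exact: ideal_pow_submodule|exact: H0_submodule]. Qed.

Lemma ideal_powz_neg (l : int) n : l <= 0 -> Ipowz l n = H0 L n.
Proof. by case: l => [[|l]|l]. Qed.

Lemma ideal_powz_decr (l : int) n : Ipowz (l + 1) n `<=` Ipowz l n.
Proof.
case: l => l; first by rewrite -PoszD addn1; exact: ideal_pow_decr.
by rewrite /= => g /ideal_powz_H0.
Qed.

Lemma ideal_powz_mono (l l' : int) n : l <= l' -> Ipowz l' n `<=` Ipowz l n.
Proof.
move=> ll'; rewrite -(subrK l l') addrC -[l' - l]gez0_abs ?subr_ge0 //.
elim: `|l' - l|%N => [|k IH]; first by rewrite addr0.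
by apply: subset_trans IH; rewrite -addn1 PoszD addrA; exact: ideal_powz_decr.
Qed.

Lemma ideal_powz_mul (l : int) n (l' : int) n' g h : Ipowz l n g -> Ipowz l' n' h ->
  Ipowz (l + l') (n + n') (g * h).
Proof.
case: (lerP 0 l) => [l0|/ltW l0].
  rewrite -(gez0_abs l0); case: (lerP 0 l') => [l'0|/ltW l'0].
    by rewrite -(gez0_abs l'0) -PoszD; exact: ideal_pow_mul.
  move=> gI; rewrite (ideal_powz_neg _ l'0) => hH.
  apply: (@ideal_powz_mono _ (`|l|%N%:Z)); last exact: (@ideal_powM `|l|).
  by rewrite -[leRHS]addr0 lerD2l.
rewrite (ideal_powz_neg _ l0) => gH hI.
apply: (@ideal_powz_mono _ l'); first by rewrite -[leRHS]add0r lerD2r.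
case: l' hI => l' /= hI; last exact: H0M.
by rewrite mulrC addnC; exact: ideal_powM.
Qed.

Local Notation R := (rees i L).
Implicit Types (a b c : R).

Lemma gmulE a b : gmul a b = convol a b.
Proof. by []. Qed.

Lemma gdeg_mono l n g : Ipowz l n g -> gdeg n (mono l g : R).
Proof.
move=> gI; split; first exact: finite_support_mono.
move=> k; rewrite /mono; case: eqP => [->|_] //.
exact: (proj1 (ideal_powz_submodule _ _)).
Qed.

Lemma gdeg_ind n (P : set R) : P 0 ->
  (forall l g a, Ipowz l n g -> gdeg n a -> P a -> P ((mono l g : R) + a)) ->
  forall a, gdeg n a -> P a.
Proof.
move=> P0 Padd a [fa aI].
have Q0 l : Ipowz l n 0 by exact: (proj1 (ideal_powz_submodule _ _)).
suff [] : gdeg n a /\ P a by [].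
apply: (@finite_support_ind _ _ _ (fun l => Ipowz l n)
  (fun a => @gdeg R n a /\ P a)) fa aI => //.
  by split=> //; split; [exact: finite_support0|].
move=> l g {}a gI fa aI [ga Pa]; split; last exact: Padd.
split; first by apply: finite_supportD => //; exact: finite_support_mono.
move=> k; apply: (submoduleD (ideal_powz_submodule k n)) => //.
by case: (gdeg_mono gI).
Qed.

Lemma rees_axioms : @graded_axioms R (mono 0 1).
Proof.
split.
- move=> n; split.
    by split; [exact: finite_support0|move=> l; exact: (proj1 (ideal_powz_submodule l n))].
  move=> a b [fa aI] [fb bI]; split; last first.
    by move=> l; apply: (submoduleB (ideal_powz_submodule l n)).
  apply: (@finite_supportD _ _ _ a (fun l => - b l)) => //.
  apply: (sub_finite_set _ fb) => l /= bl b0; apply: bl.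
  by rewrite b0 oppr0.
- by apply: gdeg_mono; exact: H0_1.
- move=> n m a b na [fb bI]; pattern a; move: a na; apply: gdeg_ind.
    rewrite gmulE (_ : convol _ _ = 0); last exact: convol0l.
    split; [exact: finite_support0|].
    by move=> l; exact: (proj1 (ideal_powz_submodule l (n + m))).
  move=> l g a gI [fa aI] [fab abI]; rewrite gmulE.
  rewrite (_ : convol _ b = fun k => convol (mono l g) b k + convol a b k); last first.
    by apply: convolDl => //; exact: finite_support_mono.
  split; first by apply: finite_supportD => //; rewrite convol_mono; exact: finite_support_shift.
  move=> k; apply: (submoduleD (ideal_powz_submodule k _)) => //.
  rewrite convol_mono -{1}(subrKC l k).
  by have := ideal_powz_mul gI (bI (k - l)).
- by move=> n m a b [fa _] [fb _]; exact: convolC.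
- by move=> n m p a b c [fa _] [fb _] [fc _]; exact: convolA.
- by move=> n m a b c [fa _] _ _; exact: convolDr.
- move=> n a _; rewrite gmulE convol_mono; apply: funext => k.
  by rewrite mul1r subr0.
Qed.

Lemma rees_gdeg_inj n m a : gdeg n a -> gdeg m a -> n = m \/ a = 0.
Proof.
move=> [_ na] [_ ma]; case: (n =P m) => nm; [by left|right].
apply: funext => l; apply: functional_extensionality_dep => x.
have [_ nx] := ideal_powz_H0 (na l) x; have [_ mx] := ideal_powz_H0 (ma l) x.
by case: (homog_degree_inj nx mx).
Qed.

Lemma gmul_mono l k g h : gmul (mono l g : R) (mono k h) = mono (l + k) (g * h).
Proof. exact: mono_mul. Qed.

Lemma gpow_mono l g K : gpow (mono 0 1 : R) (mono l g : R) K = mono (l *+ K) (g ^+ K).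
Proof.
elim: K => [//|K IH]; rewrite mulrS exprS -gmul_mono -IH.
by [].
Qed.

Variables (M : nat) (t : 'I_M -> G).
Hypothesis ht : generates_ideal i t.

(** In each product the factor from I is a combination of the t_q with coefficients one degree
    lower, or zero in degree 0; the coefficients are absorbed by the other factor. *)
Lemma ideal_powS l n : Ipow l.+1 n.+1 `<=`
  [set g | exists b : 'I_M -> G, (forall j, Ipow l n (b j)) /\
    g = \sum_j t j * b j].
Proof.
move=> _ [k [d [a [b [abP ->]]]]].
have /choice[c cP] : forall j, exists c : 'I_M -> G, (forall q, Ipow l n (c q)) /\
    a j * b j = \sum_q t q * c q.
  move=> j; have [dn aI bI] := abP j.
  have := proj2 ht _ _ aI; case: (d j) dn bI => [_ _ ->|m].
    exists (fun=> 0); split; first by move=> _; exact: (ideal_pow0 l n).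
    by rewrite mul0r big1 // => q _; rewrite mulr0.
  rewrite ltnS subSS => mn bI [c [cH ->]]; exists (fun q => c q * b j); split.
    by move=> q; rewrite mulrC -(subnK mn); exact: ideal_powM.
  by rewrite mulr_suml; apply: eq_bigr => q _; rewrite mulrA.
exists (fun q => \sum_j c j q); split.
  move=> q; apply: (submodule_sum _ (ideal_pow_submodule l n)) => j _.
  by case: (cP j).
under eq_bigr => j _ do rewrite (proj2 (cP j)).
by rewrite exchange_big; apply: eq_bigr => q _; rewrite mulr_sumr.
Qed.

Lemma ideal_powS0 l g : Ipow l.+1 0 g -> g = 0.
Proof.
move=> [k [d [a [b [abP ->]]]]]; rewrite big1 // => j _.
have [dn aI _] := abP j; move: dn aI; rewrite leqn0 => /eqP ->.
by move=> /(proj2 ht) ->; rewrite mul0r.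
Qed.

(** Each factor t_q consumes one degree, down to I_0 = 0. This bounds the weights l by n. *)
Lemma ideal_pow_gt l n g : (n < l)%N -> Ipow l n g -> g = 0.
Proof.
elim: n l g => [|n IH] [|l] g // nl; first exact: ideal_powS0.
move=> /ideal_powS[b [bI ->]]; rewrite big1 // => j _.
by rewrite (IH l (b j)) ?mulr0.
Qed.
End ExtendedRees.

(** * Sections of powers of a very ample line bundle *)

(** Extension by 0 to all natural numbers, because the operators of the saturation theorem are
    indexed by [nat]. *)
Definition nat_family (V : zmodType) (n : nat) (u : 'I_n -> V) (k : nat) : V :=
  if insub k is Some j then u j else 0.

Lemma nat_familyE (V : zmodType) (n : nat) (u : 'I_n -> V) (j : 'I_n) :
  nat_family u j = u j.
Proof. by rewrite /nat_family valK. Qed.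

Lemma nat_family_ind (V : zmodType) (n : nat) (u : 'I_n -> V) (P : V -> Prop) k :
  P 0 -> (forall j, P (u j)) -> P (nat_family u k).
Proof. by move=> P0 Pu; rewrite /nat_family; case: insub. Qed.

Section GradedSpanMaps.
Variables (A : comNzRingType) (V W : lmodType A) (r q : nat).
Variables (x y : nat -> V -> V) (x' y' : nat -> W -> W) (one : V) (one' : W) (T : V -> W).
Hypothesis T0 : T 0 = 0.

(* The hypotheses need only hold on the graded span, where T may be additive
   in each degree without being additive. *)
Lemma graded_span_map (D : nat -> set V) n v :
  (forall n u, graded_span r q x y one n u -> D n u) ->
  T one = one' ->
  (forall n a u w, D n u -> D n w -> T (a *: u + w) = a *: T u + T w) ->
  (forall n k u, (k < r)%N -> D n u -> T (x k u) = x' k (T u)) ->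
  (forall n k u, (k < q)%N -> D n u -> T (y k u) = y' k (T u)) ->
  graded_span r q x y one n v -> graded_span r q x' y' one' n (T v).
Proof.
move=> spanD T1 TL Tx Ty.
elim=> {n v} [n||n a u v uS IHu vS IHv|n k v kr vS IH|n k v kq vS IH].
- by rewrite T0; exact: GSpan0.
- by rewrite T1; exact: GSpan1.
- by rewrite (TL n) //; [exact: GSpanL|exact: spanD|exact: spanD].
- by rewrite (Tx n) //; [exact: GSpanX|exact: spanD].
- by rewrite (Ty n) //; [exact: GSpanY|exact: spanD].
Qed.
End GradedSpanMaps.

Section PolynomialRing.
Variables (A : comNzRingType) (n : nat).
Local Notation R := (mpoly n A).
Local Notation hom d := (@ishomog1 n A d mdeg).

Definition poly_var (k : nat) : R :=
  if insub k is Some j then mpolyX A (mnm1 j) else 0.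

Lemma poly_varE (j : 'I_n) : poly_var j = mpolyX A (mnm1 j).
Proof. by rewrite /poly_var valK. Qed.

Lemma poly_var_homog k : poly_var k \is hom 1.
Proof.
rewrite /poly_var; case: insub => [j|]; last exact: dhomog0.
by rewrite dhomogX /= mdeg1.
Qed.

Lemma poly_ring_axioms : @graded_axioms (poly_ring A n) 1.
Proof.
split=> /=.
- move=> d; split; first exact: dhomog0.
  by move=> u v ud vd; apply: rpredB.
- exact: dhomog1.
- by move=> d e a b; exact: dhomogM.
- by move=> d e a b _ _; exact: mulrC.
- by move=> d e f a b c _ _ _; exact: mulrA.
- by move=> d e a b c _ _ _; exact: mulrDr.
- by move=> d a _; exact: mul1r.
Qed.

Lemma poly_ring_gdeg_inj d e (a : poly_ring A n) :
  gdeg d a -> gdeg e a -> d = e \/ a = 0.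
Proof.
move=> /= da ea; case: (eqVneq (a : R) 0) => [|a0]; first by right.
by left; exact: dhomog_uniq a0 da ea.
Qed.

Definition poly_span : nat -> R -> Prop :=
  graded_span n 0 (fun k => *%R (poly_var k)) (fun=> id) (1 : R).

Lemma poly_span_homog d v : poly_span d v -> v \is hom d.
Proof.
elim=> {d v} [d||d a u v _ ud _ vd|d k v _ _ vd|//].
- exact: dhomog0.
- exact: dhomog1.
- by apply: rpredD => //; exact: dhomogZ.
- by rewrite -add1n; apply: dhomogM => //; exact: poly_var_homog.
Qed.

Lemma poly_spanP d v : v \is hom d -> poly_span d v.
Proof.
move=> vd; have spanX (m : multinom n) : poly_span (mdeg m) (mpolyX A m).
  elim: (mdeg m) {-2}m (erefl (mdeg m)) => [|e IH] {}m me.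
    move/eqP: (me); rewrite mdeg_eq0 => /eqP ->; rewrite mpolyX0 mdeg0.
    exact: GSpan1.
  have [j mj] : exists j, m j != 0%N.
    apply: contrapT => /forallNP mj; have : mdeg m = 0%N.
      by rewrite mdegE big1 // => j _; apply/eqP/negPn/negP; exact: mj.
    by rewrite me.
  rewrite -lep1mP in mj; have mE := submK mj.
  have me' : mdeg (mnm_sub m (mnm1 j)) = e.
    by apply: succn_inj; rewrite -me -{2}mE mdegD mdeg1 addn1.
  rewrite me -mE mpolyXD mulrC -poly_varE.
  by apply: GSpanX => //; rewrite -me'; exact: IH.
rewrite (mpolyE v) big_seq; apply: big_ind.
- exact: GSpan0.
- by move=> u w uS wS; rewrite -[u]scale1r; exact: GSpanL.
- move=> m /(dhomog_mf vd) /= <-; rewrite -[_ *: _]addr0.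
  by apply: GSpanL; [exact: spanX|exact: GSpan0].
Qed.

Local Notation ops := (degree0_ops (A := A) (V := R) 0 (fun=> id)).

Lemma poly_ring_acc : principal_ideals A ->
  graded_acc n (fun k => *%R (poly_var k)) ops (@gdeg (poly_ring A n)).
Proof.
move=> Apid.
(* A single embedding, the identity, without shift: the polynomial ring is its own span of
   monomials. *)
apply: (@graded_acc_embedding A R n 0 1 0 _ (fun=> id) (fun=> id) 1 Apid) => //.
- by move=> k a u v; rewrite mulrDr scalerAr.
- by move=> k l v; rewrite mulrCA.
- by move=> v /(_ 0%N isT).
- by move=> j d v _ vd; rewrite addn0; exact: poly_spanP.
Qed.

Lemma poly_ring_sub :
  graded_sub n (fun k => *%R (poly_var k)) ops (@gdeg (poly_ring A n)).
Proof.
move=> d; split; first exact: gdegB poly_ring_axioms d.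
  by move=> _ v [[a ->]|[]//] vd; exact: dhomogZ.
by move=> k v _ vd; rewrite /= -add1n; apply: dhomogM => //; exact: poly_var_homog.
Qed.
End PolynomialRing.

Section ProjectiveSpace.
Variables (A : comNzRingType) (n : nat) (P : lrs A) (O : line_bundle P).
Variable x : 'I_n -> germs O.
Local Notation R := (mpoly n A).

Definition hom_eval (q : R) : germs O := fun z =>
  mmap (fun a : A => (a%:A : stalk P z)%:A) (fun j => x j z) q.

Let const z : {rmorphism A -> alg O z} :=
  [the {rmorphism _ -> _} of in_alg (alg O z) \o in_alg (stalk P z)].

Let hom_evalE q z : hom_eval q z = mmap (const z) (fun j => x j z) q.
Proof. by []. Qed.

Lemma hom_evalD p q : hom_eval (p + q) = hom_eval p + hom_eval q.
Proof. by apply: functional_extensionality_dep => z; rewrite hom_evalE mmapD. Qed.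

Lemma hom_eval0 : hom_eval 0 = 0.
Proof. by apply: functional_extensionality_dep => z; rewrite hom_evalE mmap0. Qed.

Lemma hom_evalM p q : hom_eval (p * q) = hom_eval p * hom_eval q.
Proof.
apply: functional_extensionality_dep => z; rewrite hom_evalE.
exact: (rmorphM (mmap (const z) (fun j => x j z))).
Qed.

Lemma hom_eval1 : hom_eval 1 = 1.
Proof.
apply: functional_extensionality_dep => z; rewrite hom_evalE.
exact: (rmorph1 (mmap (const z) (fun j => x j z))).
Qed.

Lemma hom_evalZ a q : hom_eval (a *: q) = a *: hom_eval q.
Proof.
apply: functional_extensionality_dep => z; rewrite hom_evalE mmapZ.
exact: mulr_algl.
Qed.

Lemma hom_eval_var (j : 'I_n) : hom_eval (poly_var A n j) = x j.
Proof.
apply: functional_extensionality_dep => z; rewrite poly_varE hom_evalE mmapX.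
exact: mmap1U.
Qed.

Hypothesis Pspace : is_projective_space x.

(** A homogeneous polynomial of positive degree invertible at z has a monomial, hence a variable,
    invertible at z, the stalk being local. *)
Lemma projective_space_cover z : exists j, nonvanishing 1 (x j z).
Proof.
have [d [q [d0 dq qn]]] := proj_irrelevant Pspace z.
have homE e p : poly_span e p -> homog e (hom_eval p z).
  by move=> /poly_span_homog ep; case: (proj_sec Pspace ep z).
elim: (poly_spanP dq) d0 qn => {d q dq} [d||d a u v uS IHu vS IHv|d k v kn vS IH|//].
- move=> _; rewrite -[X in nonvanishing _ X]/(hom_eval 0 z) hom_eval0.
  by move/nonvanishing_neq0.
- by [].
- move=> d0; rewrite -[X in nonvanishing _ X]/(hom_eval (a *: u + v) z).
  rewrite hom_evalD hom_evalZ => /nonvanishing_add[].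
  + exact: homogZ (homE _ _ uS).
  + exact: homE.
  + by move=> /(nonvanishing_unscale (homE _ _ uS)); exact: IHu.
  + exact: IHv.
- move=> _; rewrite -[X in nonvanishing _ X]/(hom_eval (poly_var A n k * v) z).
  rewrite hom_evalM -add1n (hom_eval_var (Ordinal kn)) => xn.
  exists (Ordinal kn); apply: nonvanishing_mull xn; last exact: homE.
  have := proj_sec Pspace (poly_var_homog A n k) z.
  by rewrite -[X in homog _ X]/(hom_eval (poly_var A n k) z) (hom_eval_var (Ordinal kn)) => -[].
Qed.
End ProjectiveSpace.

Section ProjectiveSections.
Variables (A : comNzRingType) (X : lrs A) (L : line_bundle X) (N : nat).
Variable s : 'I_N.+1 -> germs L.
Hypothesis Apid : principal_ideals A.
Hypothesis hX : scheme X.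
Hypothesis hs : induces_closed_immersion s.

Definition sect_span : nat -> germs L -> Prop :=
  graded_span N.+1 0 (fun k => *%R (nat_family s k)) (fun=> id) (1 : germs L).

Lemma closed_immersion_cover x : exists j, nonvanishing 1 (s j x).
Proof.
have [P [O [y [f [phi [Pspace _ sE]]]]]] := hs.
have [j jn] := projective_space_cover Pspace (f x); exists j.
by rewrite -sE; exact: lbfun_nonvanishing.
Qed.

(** Surjectivity of the restriction from polynomials of degree n to H^0(X, L^n) in large degree:
    [sections_surjective] for X as a closed subspace of projective space. *)
Lemma sections_span : exists n0, forall n, (n0 <= n)%N -> forall g, H0 L n g ->
  sect_span n g.
Proof.
have [P [O [y [f [phi [Pspace [finj fcl fnb fsurj] sE]]]]]] := hs.
pose Th (q : poly_ring A N.+1) : germs L := lpull phi (hom_eval y q).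
have Rax := poly_ring_axioms A N.+1.
have Rinj := @poly_ring_gdeg_inj A N.+1.
have Pp : @is_proj A P O (poly_ring A N.+1) (hom_eval y) := Pspace.
have b_cover z : exists2 k, (k < N.+1)%N &
    nonvanishing 1 (hom_eval y (poly_var A N.+1 k) z).
  have [j jn] := projective_space_cover Pspace z.
  by exists j => //; rewrite hom_eval_var.
have Th_H0 n a : gdeg n a -> H0 L n (Th a).
  by move=> na; apply: lpull_H0; exact: (proj_sec Pp na).
have ThD n (a c : poly_ring A N.+1) : gdeg n a -> gdeg n c -> Th (a + c) = Th a + Th c.
  by move=> _ _; rewrite /Th hom_evalD lpullD.
have ThM n m (a c : poly_ring A N.+1) : gdeg n a -> gdeg m c ->
    Th (gmul a c) = Th a * Th c.
  by move=> _ _; rewrite /Th /= hom_evalM lpullM.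
have Th_nv n a x : gdeg n a ->
    (nonvanishing n (Th a x) <-> nonvanishing n (hom_eval y a (f x))).
  move=> na; split; last exact: lbfun_nonvanishing.
  by apply: lbfun_nonvanishingE; case: (proj_sec Pp na (f x)).
have Th_frac x (c : stalk X x) : exists n p q,
    [/\ gdeg n p, gdeg n q, nonvanishing n (Th q x) & c *: Th q x = Th p x].
  have [c' <-] := fsurj x c; have [n [p [q [np nq qn cE]]]] := proj_frac Pp c'.
  exists n, p, q; split=> //; first exact/Th_nv.
  by rewrite /Th /lpull -lbfunZ; congr (lbfun phi x _); exact: cE.
have pvd k : @gdeg (poly_ring A N.+1) 1 (poly_var A N.+1 k) by exact: poly_var_homog.
have Th_zero n m p q : gdeg n p -> gdeg m q -> (0 < m)%N ->
    (forall x, nonvanishing m (Th q x) -> Th p x = 0) ->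
    exists K, Th q ^+ K * Th p = 0.
  move=> np mq _ pq0.
  have [||K KP] := @quasi_compact _ _ _ _ _ Rax _ Pp Rinj _ _ pvd b_cover _ _ _ _
    fcl fnb Th_H0 ThD ThM Th_nv (fun K => [set x | Th q x ^+ K * Th p x = 0]).
  - by move=> K x /= xK; rewrite exprS -mulrA xK mulr0.
  - exact: scheme_vanishing hX _ _ _ _ (Th_H0 _ _ np) (Th_H0 _ _ mq) pq0.
  exists K; apply: functional_extensionality_dep => x.
  by rewrite -[LHS]/((Th q ^+ K) x * Th p x) germsX; exact: KP.
have [|||||n0 n0P] := @sections_surjective _ _ _ _ _ Rax _ Pp Rinj _ _ pvd b_cover
    _ _ _ _ fcl fnb Th_H0 ThD ThM Th_nv Th_frac Th_zero
    (degree0_ops (A := A) (V := mpoly N.+1 A) 0 (fun=> id)) _ _ _ _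
    (@poly_ring_sub A N.+1) (poly_ring_acc Apid).
- by move=> k u v; exact: mulrBr.
- by move=> k l v; exact: mulrCA.
- by move=> _ u v [[a ->]|[]//]; exact: scalerBr.
- by move=> _ k v [[a ->]|[]//]; exact: scalerAr.
- move=> n _ a [[e ->]|[]//] na; rewrite /Th hom_evalZ lpullZ => ->.
  exact: scaler0.
exists n0 => n nn0 g gH; have [p np <-] := n0P n nn0 g gH.
apply: (@graded_span_map _ _ _ _ _ _ _ _ _ _ _ Th _ (fun _ => setT)) (poly_spanP np).
- by rewrite /Th hom_eval0 lpull0.
- by [].
- by rewrite /Th hom_eval1 lpull1.
- by move=> _ a u w _ _; rewrite /Th hom_evalD lpullD hom_evalZ lpullZ.
- move=> _ k u kN _; rewrite /Th hom_evalM lpullM (hom_eval_var y (Ordinal kN)) sE.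
  by rewrite -nat_familyE.
- by [].
Qed.
End ProjectiveSections.

(** * Open immersions and the standard charts of Proj *)

Section OpenImmersions.
Variables (A : comNzRingType) (Z W : lrs A) (f : mor Z W).
Hypothesis fopen : open_immersion f.

Let finj : injective f. Proof. by case: fopen. Qed.
Let fnbhs x (V : set Z) : nbhs x V -> nbhs (f x) (f @` V).
Proof. by case: fopen => _ + _; exact. Qed.
Let fbij x : bijective (comor f x). Proof. by case: fopen. Qed.

Lemma open_comor_inj x : injective (comor f x).
Proof. exact: bij_inj. Qed.

Lemma open_comor_surj x c : exists a, comor f x a = c.
Proof. by have [g _ gK] := fbij x; exists (g c). Qed.

Lemma extend_functions (u : functions Z) : exists u' : functions W, pull f u' = u.
Proof.
have /dep_choice[u' u'P] : forall d, exists y : stalk W d,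
    forall C : functions W, C d = y -> forall z, f z = d -> pull f C z = u z.
  move=> d; case: (pselect (exists z, f z = d)) => [[z <-]|nz]; last first.
    by exists 0 => C _ z zd; case: nz; exists z.
  have [a aE] := open_comor_surj (u z).
  by exists a => C Ca z' /finj ->; rewrite /pull Ca.
by exists u'; apply: functional_extensionality_dep => z; exact: (u'P (f z)).
Qed.

Lemma extend_germs (L : line_bundle Z) (M : line_bundle W) (phi : lbmor f L M) n
    (u : germs L) : (forall z, homog n (u z)) ->
  exists2 u' : germs M, (forall d, homog n (u' d)) & lpull phi u' = u.
Proof.
move=> un; have /dep_choice[u' u'P] : forall d, exists y : alg M d, homog n y /\
    forall C : germs M, C d = y -> forall z, f z = d -> lpull phi C z = u z.
  move=> d; case: (pselect (exists z, f z = d)) => [[z <-]|nz]; last first.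
    by exists 0; split=> [|C _ z zd]; [exact: homog0|case: nz; exists z].
  have [a an aE] := lbfun_surj_homog phi (@open_comor_surj z) (un z).
  by exists a; split=> // C Ca z' /finj ->; rewrite /lpull Ca.
exists u' => [d|]; first by case: (u'P d).
by apply: functional_extensionality_dep => z; exact: (proj2 (u'P (f z))).
Qed.

Lemma open_near x (Q : W -> Prop) : (\forall y \near x, Q (f y)) ->
  \forall y \near f x, Q y.
Proof. by move=> H; apply: filterS (fnbhs H) => _ [y yQ <-]. Qed.

Lemma reg_open (u : functions W) x : reg (pull f u) x -> reg u (f x).
Proof.
move=> ur; have [u' u'r u'x] := reg_exists (u (f x)).
apply: (reg_ext (reg_sheaf W) _ u'r).
apply: open_near; have E : pull f u' x = pull f u x by rewrite /pull u'x.
apply: filterS (reg_near_eq (comor_reg u'r) ur E) => y.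
exact: open_comor_inj.
Qed.

Lemma spec_open_immersion (U : set Z) (R : comNzRingType) (g : R) th :
  is_spec U g th -> exists th', is_spec (f @` U) g th' /\
    forall r, pull f (th' r) = th r.
Proof.
move=> Us; have [th' th'E] := choice (fun r => extend_functions (th r)).
exists th'; split=> //.
have thE r z : comor f z (th' r (f z)) = th r z.
  by rewrite -[LHS]/(pull f (th' r) z) th'E.
have unitE r z : is_unit (th' r (f z)) <-> is_unit (th r z).
  by rewrite -thE; split; [exact: is_unit_rmorph|exact: comor_local].
split.
- rewrite openE => _ [z Uz <-]; apply: fnbhs.
  by apply: open_nbhs_nbhs; split=> //; exact: spec_open Us.
- by move=> r _ [z Uz <-]; apply: reg_open; rewrite th'E; exact: (spec_reg Us r Uz).
- by move=> _ [z Uz <-]; apply: open_comor_inj; rewrite thE rmorph1; exact: (spec1 Us Uz).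
- move=> r r' _ [z Uz <-]; apply: open_comor_inj.
  rewrite [RHS]rmorphD /= !thE.
  by rewrite (specD Us r r' Uz).
- move=> r r' _ [z Uz <-]; apply: open_comor_inj.
  by rewrite [RHS]rmorphM /= !thE (specM Us r r' Uz).
- by move=> _ [z Uz <-]; apply/unitE; exact: (spec_f Us Uz).
- move=> _ _ [z Uz <-] [z' Uz' <-] E; congr (f _); apply: (spec_inj Us Uz Uz') => r.
  by split=> /unitE/E/unitE.
- move=> P Pp nPg; have [z Uz zP] := spec_surj Us Pp nPg.
  exists (f z); first by exists z.
  by move=> r; rewrite zP; split=> nu /unitE.
- move=> _ V [z Uz <-] zV; have [r ru rV] := spec_nbhs Us Uz (near_pull zV).
  exists r; first exact/unitE.
  by move=> _ [y Uy <-] /unitE; exact: rV.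
- move=> d c [z Uz zd]; subst d.
  have [r [q [qu cE]]] := spec_frac Us (comor f z c) Uz.
  exists r, q; split; first exact/unitE.
  by apply: open_comor_inj; rewrite rmorphM /= !thE.
- move=> _ r [z Uz <-] r0; have [|q [qu qr]] := spec_zero Us (z := z) (r := r) Uz.
    by rewrite -thE r0 rmorph0.
  by exists q; split=> //; exact/unitE.
Qed.
End OpenImmersions.

(** * The affine charts D_+(b) of Proj *)

Section ProjChart.
Variables (A : comNzRingType) (Z : lrs A) (O : line_bundle Z) (S : graded_ring).
Variables (one : S) (Sax : graded_axioms one) (th : S -> germs O).
Hypothesis Sproj : is_proj th.
Hypothesis gdeg_inj : forall n m (a : S), gdeg n a -> gdeg m a -> n = m \/ a = 0.
Variables (b : S) (b1 : gdeg 1 b).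

Definition chart_point := {z : Z | nonvanishing 1 (th b z)}.

Definition chart_functions := forall p : chart_point, stalk Z (sval p).

Definition is_fraction (c : chart_functions) n (a : S) : Prop :=
  gdeg n a /\ forall p, th a (sval p) = c p *: th b (sval p) ^+ n.

Let bX (p : chart_point) n : nonvanishing n (th b (sval p) ^+ n).
Proof. by rewrite -{1}[n]muln1; apply: nonvanishingX; exact: svalP p. Qed.

Let th1 (p : chart_point) : th one (sval p) = 1.
Proof.
apply: (nonvanishing_mulI (m := 0) (svalP p)).
- by case: (proj_sec Sproj (gdeg1 Sax) (sval p)).
- exact: homog1.
rewrite mulr1 mulrC -[LHS]/((th one * th b) (sval p)).
by rewrite -(projM Sproj (gdeg1 Sax) b1) (gmul1 Sax b1).
Qed.

Let thX K (p : chart_point) : th (gpow one b K) (sval p) = th b (sval p) ^+ K.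
Proof.
elim: K => [|K IH]; first exact: th1.
rewrite exprS -IH -[RHS]/((th b * th (gpow one b K)) (sval p)).
by rewrite -(projM Sproj b1 (gdeg_pow Sax K b1)).
Qed.

Let bKd K : gdeg K (gpow one b K).
Proof. by have := gdeg_pow Sax K b1; rewrite muln1. Qed.

Lemma is_fraction0 : is_fraction (fun p => 0) 0 0.
Proof.
split=> [|p]; first exact: (gdeg0 Sax 0).
rewrite scale0r (graded_map0 Sax) //; exact: (projD Sproj).
Qed.

Lemma is_fraction1 : is_fraction (fun p => 1) 0 one.
Proof. by split=> [|p]; [exact: (gdeg1 Sax)|rewrite scale1r th1]. Qed.

Lemma is_fractionM c c' n n' a a' : is_fraction c n a -> is_fraction c' n' a' ->
  is_fraction (fun p => c p * c' p) (n + n') (gmul a a').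
Proof.
move=> [na aE] [na' aE']; split=> [|p]; first exact: (gdegM Sax).
rewrite (projM Sproj na na') -[LHS]/(th a (sval p) * th a' (sval p)) aE aE'.
by rewrite -scalerAl -scalerAr scalerA exprD.
Qed.

Lemma is_fraction_pow c n a K : is_fraction c n a ->
  is_fraction c (n + K) (gmul a (gpow one b K)).
Proof.
move=> ca; have cE : is_fraction (fun p => 1) K (gpow one b K).
  by split=> [|p]; [exact: bKd|rewrite scale1r thX].
by have [d E] := is_fractionM ca cE; split=> // p; rewrite E mulr1.
Qed.

Lemma is_fractionD c c' n a a' : is_fraction c n a -> is_fraction c' n a' ->
  is_fraction (fun p => c p + c' p) n (a + a').
Proof.
move=> [na aE] [na' aE']; split=> [|p]; first exact: (gdegD Sax).
rewrite (projD Sproj na na') -[LHS]/(th a (sval p) + th a' (sval p)) aE aE'.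
by rewrite scalerDl.
Qed.

Lemma is_fractionN c n a : is_fraction c n a -> is_fraction (fun p => - c p) n (- a).
Proof.
move=> [na aE]; split=> [|p]; first exact: (gdegN Sax).
rewrite (graded_mapN Sax (projD Sproj) na) -[LHS]/(- th a (sval p)) aE.
by rewrite scaleNr.
Qed.

(** The degree 0 part of the localization of S at b, realized as the functions on D_+(b) of the form
    a/b^n, so that equality of fractions is equality of functions. *)
Definition chart_ring := {c : chart_functions | exists n a, is_fraction c n a}.

HB.instance Definition _ := gen_eqMixin chart_ring.
HB.instance Definition _ := gen_choiceMixin chart_ring.

Lemma chart_eq (u v : chart_ring) : (forall p, sval u p = sval v p) -> u = v.
Proof.
case: u v => [u uP] [v vP] /= uv.
have E : u = v by apply: functional_extensionality_dep => p; exact: uv.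
by subst v; congr exist; exact: Prop_irrelevance.
Qed.

Let add_closed (u v : chart_ring) :
  exists n a, is_fraction (fun p => sval u p + sval v p) n a.
Proof.
case: u v => [u [n [a ua]]] [v [m [a' va]]] /=.
exists (n + m)%N, (gmul a (gpow one b m) + gmul a' (gpow one b n)).
apply: is_fractionD; first exact: is_fraction_pow.
by rewrite addnC; exact: is_fraction_pow.
Qed.

Let mul_closed (u v : chart_ring) :
  exists n a, is_fraction (fun p => sval u p * sval v p) n a.
Proof.
case: u v => [u [n [a ua]]] [v [m [a' va]]] /=.
by exists (n + m)%N, (gmul a a'); exact: is_fractionM.
Qed.

Let opp_closed (u : chart_ring) : exists n a, is_fraction (fun p => - sval u p) n a.
Proof. by case: u => [u [n [a ua]]] /=; exists n, (- a); exact: is_fractionN. Qed.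

Definition chart_zero : chart_ring :=
  exist _ (fun=> 0) (ex_intro _ 0%N (ex_intro _ 0 is_fraction0)).
Definition chart_one : chart_ring :=
  exist _ (fun=> 1) (ex_intro _ 0%N (ex_intro _ one is_fraction1)).
Definition chart_add u v : chart_ring := exist _ _ (add_closed u v).
Definition chart_mul u v : chart_ring := exist _ _ (mul_closed u v).
Definition chart_opp u : chart_ring := exist _ _ (opp_closed u).

Let addA : associative chart_add.
Proof. by move=> u v w; apply: chart_eq => p /=; rewrite addrA. Qed.
Let addC : commutative chart_add.
Proof. by move=> u v; apply: chart_eq => p /=; rewrite addrC. Qed.
Let add0 : left_id chart_zero chart_add.
Proof. by move=> u; apply: chart_eq => p /=; rewrite add0r. Qed.
Let addN : left_inverse chart_zero chart_opp chart_add.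
Proof. by move=> u; apply: chart_eq => p /=; rewrite addNr. Qed.

HB.instance Definition _ := GRing.isZmodule.Build chart_ring addA addC add0 addN.

Let mulA : associative chart_mul.
Proof. by move=> u v w; apply: chart_eq => p /=; rewrite mulrA. Qed.
Let mulC : commutative chart_mul.
Proof. by move=> u v; apply: chart_eq => p /=; rewrite mulrC. Qed.
Let mul1 : left_id chart_one chart_mul.
Proof. by move=> u; apply: chart_eq => p /=; rewrite mul1r. Qed.
Let mulD : left_distributive chart_mul chart_add.
Proof. by move=> u v w; apply: chart_eq => p /=; rewrite mulrDl. Qed.

Variables (z0 : Z) (z0b : nonvanishing 1 (th b z0)).

(** The point z0 is required because the ring of an empty chart would be zero. *)
Let one_neq0 : chart_one <> chart_zero.
Proof.
move=> /(congr1 (fun u : chart_ring => sval u (exist _ z0 z0b))) /= /eqP.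
by rewrite oner_eq0.
Qed.

Let one_neq0b : chart_one != chart_zero.
Proof. exact/eqP. Qed.

HB.instance Definition _ :=
  GRing.Zmodule_isComNzRing.Build chart_ring mulA mulC mul1 mulD one_neq0b.

Definition chart_comring : comNzRingType := chart_ring.

Definition chart_eval (u : chart_comring) : functions Z := fun z =>
  if pselect (nonvanishing 1 (th b z)) is left h then sval u (exist _ z h) else 0.

Lemma chart_evalE u z (h : nonvanishing 1 (th b z)) : chart_eval u z = sval u (exist _ z h).
Proof.
rewrite /chart_eval; case: pselect => // h'.
by rewrite (Prop_irrelevance h' h).
Qed.

Lemma chart_fraction (u : chart_comring) : exists n a, gdeg n a /\
  forall z, nonvanishing 1 (th b z) -> th a z = chart_eval u z *: th b z ^+ n.
Proof.
case: u => [u [n [a [na aE]]]]; exists n, a; split=> // z h.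
by rewrite (chart_evalE _ h) /= -(aE (exist _ z h)).
Qed.

Lemma chart_fraction_exists n a : gdeg n a -> exists u : chart_comring,
  forall z, nonvanishing 1 (th b z) -> th a z = chart_eval u z *: th b z ^+ n.
Proof.
move=> na; have /dep_choice[c cE] : forall p : chart_point, exists c : stalk Z (sval p),
    th a (sval p) = c *: th b (sval p) ^+ n.
  by move=> p; apply: (nonvanishing_fraction (bX p n)); case: (proj_sec Sproj na (sval p)).
exists (exist _ c (ex_intro _ n (ex_intro _ a (conj na cE)))) => z h.
by rewrite (chart_evalE _ h) -(cE (exist _ z h)).
Qed.

Lemma chart_eval_inj (u v : chart_comring) :
  (forall z, nonvanishing 1 (th b z) -> chart_eval u z = chart_eval v z) -> u = v.
Proof.
by move=> uv; apply: chart_eq => -[z h]; rewrite -!chart_evalE; exact: uv.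
Qed.

Let bn z n : nonvanishing 1 (th b z) -> nonvanishing n (th b z ^+ n).
Proof. by move=> h; have := nonvanishingX n h; rewrite muln1. Qed.

Lemma chart_spec : is_spec [set z | nonvanishing 1 (th b z)] (1 : chart_comring) chart_eval.
Proof.
have breg z : lreg (th b) z by case: (proj_sec Sproj b1 z).
have evD u v z : nonvanishing 1 (th b z) ->
    chart_eval (u + v) z = chart_eval u z + chart_eval v z.
  by move=> h; rewrite !(chart_evalE _ h).
have evM u v z : nonvanishing 1 (th b z) ->
    chart_eval (u * v) z = chart_eval u z * chart_eval v z.
  by move=> h; rewrite !(chart_evalE _ h).
have ev1 z : nonvanishing 1 (th b z) -> chart_eval 1 z = 1.
  by move=> h; rewrite (chart_evalE _ h).
have ev0 z : nonvanishing 1 (th b z) -> chart_eval 0 z = 0.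
  by move=> h; rewrite (chart_evalE _ h).
have unitE n a (u : chart_comring) z : gdeg n a -> nonvanishing 1 (th b z) ->
    th a z = chart_eval u z *: th b z ^+ n ->
    (is_unit (chart_eval u z) <-> nonvanishing n (th a z)).
  move=> na h ->; split=> [uu|]; first by apply: nonvanishingZ; [|exact: bn].
  by apply: nonvanishing_unit; exact: nonvanishing_homog (bn _ h).
split.
- by rewrite openE => z h; exact: nonvanishing_near (breg z) h.
- move=> u z h; have [n [a [na aE]]] := chart_fraction u.
  have [ar ah] := proj_sec Sproj na z.
  have [c cr cE] := fraction_near ar ah (lreg_exp n (breg z)) (bn n h).
  apply: (reg_ext (reg_sheaf Z) _ cr).
  near=> y; have hy : nonvanishing 1 (th b y).
    by near: y; exact: nonvanishing_near (breg z) h.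
  apply: (nonvanishing_scale_inj (bn n hy)); rewrite -aE //.
  by apply: esym; near: y.
- exact: ev1.
- by move=> u v z; exact: evD.
- by move=> u v z; exact: evM.
- by move=> z /ev1 ->; exact: is_unit1.
- move=> z z' h h' zz'; apply: (proj_inj Sproj) => n a na.
  have [u uE] := chart_fraction_exists na.
  by rewrite -(unitE _ _ _ _ na h (uE z h)) -(unitE _ _ _ _ na h' (uE z' h')).
- move=> P [[P0 P1] PD PM Pp] _.
  (* [fr (n, a)] is the fraction a/b^n. The homogeneous prime Q attached to P consists of the a
     whose fraction lies in P; it avoids b, whose fraction is 1. *)
  have /choice[fr frE] : forall na : nat * S, exists u : chart_comring,
      gdeg na.1 na.2 -> forall z, nonvanishing 1 (th b z) ->
      th na.2 z = chart_eval u z *: th b z ^+ na.1.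
    move=> [n a]; case: (pselect (gdeg n a)) => na; last by exists 0 => /na.
    by have [u uE] := chart_fraction_exists na; exists u.
  have frP n a (u : chart_comring) : gdeg n a ->
      (forall z, nonvanishing 1 (th b z) -> th a z = chart_eval u z *: th b z ^+ n) ->
      fr (n, a) = u.
    move=> na uE; apply: chart_eval_inj => z h; apply: (nonvanishing_scale_inj (bn n h)).
    by rewrite -(frE (n, a) na z h) uE.
  pose Q : set S := [set a | exists n, gdeg n a /\ P (fr (n, a))].
  have fr0 n : fr (n, 0) = 0.
    apply: frP => [|z h]; first exact: (gdeg0 Sax).
    by rewrite ev0 // scale0r (graded_map0 Sax (projD Sproj)).
  have QE n a : gdeg n a -> Q a -> P (fr (n, a)).
    by move=> na [m [ma Pa]]; case: (gdeg_inj na ma) => [->|->] //; rewrite fr0.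
  have [|z zP] := proj_surj Sproj (P := Q).
    split.
    - by exists 0%N; split; [exact: (gdeg0 Sax)|rewrite fr0].
    - move=> n a a' na na' Qa Qa'; exists n; split; first exact: (gdegD Sax).
      rewrite (frP n (a + a') (fr (n, a) + fr (n, a'))).
      + by apply: PD; exact: QE.
      + exact: (gdegD Sax).
      + move=> z h; rewrite evD // (projD Sproj na na').
        rewrite -[LHS]/(th a z + th a' z) (frE (n, a) na z h) (frE (n, a') na' z h).
        by rewrite scalerDl.
    - move=> n m a a' na ma' Qa'; exists (n + m)%N; split; first exact: (gdegM Sax).
      rewrite (frP _ (gmul a a') (fr (n, a) * fr (m, a'))).
      + by apply: PM; exact: QE.
      + exact: (gdegM Sax).
      + move=> z h; rewrite evM // (projM Sproj na ma').
        rewrite -[LHS]/(th a z * th a' z) (frE (n, a) na z h) (frE (m, a') ma' z h).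
        by rewrite -scalerAl -scalerAr scalerA exprD.
    - move=> n m a a' na ma' /(QE _ _ (gdegM Sax na ma')).
      rewrite (frP _ (gmul a a') (fr (n, a) * fr (m, a'))).
      + by case/Pp => ?; [left; exists n|right; exists m].
      + exact: (gdegM Sax).
      + move=> z h; rewrite evM // (projM Sproj na ma').
        rewrite -[LHS]/(th a z * th a' z) (frE (n, a) na z h) (frE (m, a') ma' z h).
        by rewrite -scalerAl -scalerAr scalerA exprD.
    - exists 1%N, b; split=> // /(QE _ _ b1).
      rewrite (frP 1%N b 1) // => z h.
      by rewrite ev1 // scale1r expr1.
  have zb : nonvanishing 1 (th b z).
    apply: contrapT => /(zP 1%N b b1) /(QE _ _ b1).
    rewrite (frP 1%N b 1) // => y h.
    by rewrite ev1 // scale1r expr1.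
  exists z => // u; have [n [a [na aE]]] := chart_fraction u.
  rewrite (unitE n a u z na zb (aE z zb)) -(zP n a na); split=> [Pu|/(QE _ _ na)].
    by exists n; split=> //; rewrite (frP n a u).
  by rewrite (frP n a u).
- move=> z V h zV; have [n [a [_ na an aV]]] := proj_nbhs Sproj zV.
  have [u uE] := chart_fraction_exists na; exists u.
    exact/(unitE _ _ _ _ na h (uE z h)).
  by move=> y hy /(unitE _ _ _ _ na hy (uE y hy)); exact: aV.
- move=> z c h; have [n [p [q [np nq qn cE]]]] := proj_frac Sproj c.
  have [u uE] := chart_fraction_exists np; have [v vE] := chart_fraction_exists nq.
  exists u, v; split; first exact/(unitE _ _ _ _ nq h (vE z h)).
  apply: (nonvanishing_scale_inj (bn n h)).
  by rewrite -scalerA -vE // -uE.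
- move=> z u h u0; have [n [a [na aE]]] := chart_fraction u.
  have [|m [a' [ma' a'n a'a]]] := proj_zero Sproj (z := z) na.
    by rewrite aE // u0 scale0r.
  have [v vE] := chart_fraction_exists ma'.
  exists v; split; first exact/(unitE _ _ _ _ ma' h (vE z h)).
  apply: chart_eval_inj => y hy; rewrite evM // ev0 //.
  apply: (nonvanishing_scale0 (bn (m + n) hy)).
  rewrite exprD -scalerA scalerAr -aE // scalerAl -vE //.
  rewrite -[LHS]/((th a' * th a) y) -(projM Sproj ma' na) a'a.
  by rewrite (graded_map0 Sax (projD Sproj)).
Unshelve. all: by end_near. Qed.
End ProjChart.

(** * The deformation to the projective completion of the cone *)

Section TensorProducts.
Variables (A : comNzRingType) (Z : lrs A) (T L M : line_bundle Z).
Variable b : tensor_product T L M.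
Implicit Types (x : Z).

Lemma tmul_nonvanishing x (a : alg L x) (c : alg M x) : nonvanishing 1 a ->
  nonvanishing 1 c -> nonvanishing 1 (tmul b a c).
Proof.
move=> /nonvanishing_generator ag /nonvanishing_generator cg.
by apply: generator_nonvanishing; exact: tmul_generator.
Qed.

Lemma tmul_homog x (a : alg L x) (c : alg M x) : homog 1 a -> homog 1 c ->
  homog 1 (tmul b a c).
Proof.
have [e eg] := generator_at L x; have [e' e'g] := generator_at M x.
move=> /(proj2 eg)[k ->] /(proj2 e'g)[k' ->]; rewrite !expr1.
have eh := generator_homog eg; have e'h := generator_homog e'g.
rewrite tmulZl //; last exact: homogZ.
rewrite tmulZr //; apply: homogZ; apply: homogZ.
by apply: generator_homog; exact: tmul_generator.
Qed.

Lemma tsec_H0 (u : germs L) (w : germs M) : H0 L 1 u -> H0 M 1 w -> H0 T 1 (tsec b u w).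
Proof.
move=> uH wH x; have [ur uh] := uH x; have [wr wh] := wH x.
by split; [exact: tmul_reg|exact: tmul_homog].
Qed.
End TensorProducts.

Section DeformationBasics.
Variables (A : comNzRingType) (X Y : lrs A) (i : mor Y X) (L : line_bundle X).
Variables (N M : nat) (s : 'I_N.+1 -> germs L) (t : 'I_M -> germs L).
Hypothesis Apid : principal_ideals A.
Hypothesis hX : scheme X.
Hypothesis hs : induces_closed_immersion s.
Hypothesis ht : generates_ideal i t.
Variable D : deformation i s t.
Local Notation R := (rees i L).
Local Notation v := (U0v D).
Local Notation tau := (U1tau D).
Local Notation th := (U1th D).
Local Notation r := (N.+1 + M)%N.
Local Notation phat := (lpull (U0pL D)).

(** The distinguished elements of degree 1 of S' are the s_k and, from index N + 1 on, the t_j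
    tau^(-1). [gen_exp] is the exponent of tau^(-1) and also the power of v in the matching
    coordinate. *)
Definition gen_exp (k : nat) : nat := ~~ (k < N.+1)%N.

Definition gen_sec (k : nat) : germs L :=
  if (k < N.+1)%N then nat_family s k else nat_family t (k - N.+1).

Definition gen (k : nat) : R := mono (gen_exp k) (gen_sec k).

Definition proj_coord (k : nat) : germs (L1 D) :=
  if (k < N.+1)%N then nat_family (sx D) k else nat_family (sy D) (k - N.+1).

Lemma s_H0 j : H0 L 1 (s j).
Proof.
have [P [O [y [f [phi [Pspace _ sE]]]]]] := hs; rewrite -sE; apply: lpull_H0.
have := proj_sec Pspace (poly_var_homog A N.+1 j).
rewrite (_ : (fun z => _) = hom_eval y (poly_var A N.+1 j)) // hom_eval_var.
exact.
Qed.

Lemma gen_sec_ideal k : ideal_pow i (gen_exp k) 1 (gen_sec k).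
Proof.
rewrite /gen_exp /gen_sec; case: ifP => _ /=.
  by apply: nat_family_ind => [|j]; [exact: H0_0|exact: s_H0].
apply: (nat_family_ind (P := ideal_pow i 1 1)) => [|j]; first exact: ideal_pow0.
exists 1%N, (fun=> 1%N), (fun=> t j), (fun=> 1); split; last first.
  by rewrite big_ord_recl big_ord0 addr0 mulr1.
by move=> _; split=> //; [exact: (proj1 ht)|exact: H0_1].
Qed.

Lemma gen_sec_H0 k : H0 L 1 (gen_sec k).
Proof. exact: ideal_pow_H0 (gen_sec_ideal k). Qed.

Lemma gen_deg k : gdeg 1 (gen k).
Proof. by apply: gdeg_mono; exact: gen_sec_ideal. Qed.

Lemma PNMx_H0 j : H0 (PNMO D) 1 (PNMx D j).
Proof.
have := proj_sec (PNM_space D) (poly_var_homog A _ j).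
rewrite (_ : (fun z => _) = hom_eval (PNMx D) (poly_var A _ j)) // hom_eval_var.
exact.
Qed.

Lemma coord_H0 k : H0 (L1 D) 1 (proj_coord k).
Proof.
rewrite /proj_coord; case: ifP => _; apply: nat_family_ind; try exact: H0_0;
  by move=> j; apply: lpull_H0; exact: PNMx_H0.
Qed.

Lemma j0L_coord k z : lpull (j0L D) (proj_coord k) z = v z ^+ gen_exp k *: phat (gen_sec k) z.
Proof.
rewrite /proj_coord /gen_exp /gen_sec; case: ifP => _; rewrite /nat_family.
  case: insub => [j|]; last by rewrite !lpull0; exact/esym/scaler0.
  by rewrite toPNM_x expr0 scale1r.
case: insub => [j|]; last by rewrite !lpull0; exact/esym/scaler0.
by rewrite toPNM_y expr1.
Qed.

Lemma coord_cover d : exists2 k, (k < r)%N & nonvanishing 1 (proj_coord k d).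
Proof.
have [j jn] := projective_space_cover (PNM_space D) (toPNM D d).
have {}jn := lbfun_nonvanishing (toPNML D) jn.
case: (fintype.splitP j) => j' jE.
  exists j'; first by rewrite (leq_trans (ltn_ord j')) // leq_addr.
  rewrite /proj_coord ltn_ord nat_familyE /sx /lpull (_ : lshift M j' = j) //.
  exact/val_inj.
exists (N.+1 + j')%N; first by rewrite ltn_add2l.
rewrite /proj_coord ltnNge leq_addr /= addKn nat_familyE /sy /lpull.
by rewrite (_ : rshift N.+1 j' = j) //; exact/val_inj.
Qed.

Lemma s_cover z : exists2 k, (k < N.+1)%N & nonvanishing 1 (phat (gen_sec k) z).
Proof.
have [j jn] := closed_immersion_cover hs (U0p D z); exists j => //.
by rewrite /gen_sec ltn_ord nat_familyE; exact: lbfun_nonvanishing.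
Qed.

Lemma P1x_H0 j : H0 (P1O D) 1 (P1x D j).
Proof.
have := proj_sec (P1_space D) (poly_var_homog A _ j).
rewrite (_ : (fun z => _) = hom_eval (P1x D) (poly_var A _ j)) // hom_eval_var.
exact.
Qed.

Lemma su_H0 : H0 (L2 D) 1 (su D). Proof. by apply: lpull_H0; exact: P1x_H0. Qed.
Lemma st_H0 : H0 (L2 D) 1 (st D). Proof. by apply: lpull_H0; exact: P1x_H0. Qed.

Lemma su_st_cover d : nonvanishing 1 (su D d) \/ nonvanishing 1 (st D d).
Proof.
have [j jn] := projective_space_cover (P1_space D) (toP1 D d).
have {}jn := lbfun_nonvanishing (toP1L D) jn.
have [j0|j1] : j = ord0 \/ j = ord_max.
  by case: j {jn} => -[|[|//]] ?; [left|right]; exact: val_inj.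
- by left; rewrite j0 in jn.
- by right; rewrite j1 in jn.
Qed.

(** The relations between u and t are given for families on D, so v and tau are first extended from
    the charts. *)
Lemma coord_functions : exists Vf Tf : functions D,
  [/\ pull (j0 D) Vf = v, pull (j1 D) Tf = tau,
     forall z, su D (j0 D z) = Vf (j0 D z) *: st D (j0 D z) &
     forall z, st D (j1 D z) = Tf (j1 D z) *: su D (j1 D z)].
Proof.
have [Vf VfE] := extend_functions (j0_open D) v.
have [Tf TfE] := extend_functions (j1_open D) tau.
exists Vf, Tf; split=> // z.
  by apply: toP1_U0; rewrite VfE.
by apply: toP1_U1; rewrite TfE.
Qed.

Lemma st_U0 z : nonvanishing 1 (st D (j0 D z)).
Proof.
have [Vf [_ [_ _ suE _]]] := coord_functions.
case: (su_st_cover (j0 D z)) => //; rewrite suE.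
by apply: nonvanishing_unscale; case: (st_H0 (j0 D z)).
Qed.

Lemma su_U1 z : nonvanishing 1 (su D (j1 D z)).
Proof.
have [_ [Tf [_ _ _ stE]]] := coord_functions.
case: (su_st_cover (j1 D z)) => //; rewrite stE.
by apply: nonvanishing_unscale; case: (su_H0 (j1 D z)).
Qed.

Let Rax := rees_axioms i L.
Let Rproj := U1_proj D.
Let Rinj := @rees_gdeg_inj A X Y i L.

Lemma th_homog n a z : gdeg n a -> homog n (th a z).
Proof. by move=> na; case: (proj_sec Rproj na z). Qed.

Lemma th0 : th 0 = 0. Proof. exact: (graded_map0 Rax (projD Rproj)). Qed.

Lemma thD n a b z : gdeg n a -> gdeg n b -> th (a + b) z = th a z + th b z.
Proof. by move=> na nb; rewrite (projD Rproj na nb). Qed.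

Lemma thM n m a b z : gdeg n a -> gdeg m b -> th (gmul a b) z = th a z * th b z.
Proof. by move=> na nb; rewrite (projM Rproj na nb). Qed.

Lemma thB n a b z : gdeg n a -> gdeg n b -> th (a - b) z = th a z - th b z.
Proof. by move=> na nb; rewrite (graded_mapB Rax (projD Rproj) na nb). Qed.

Definition tau_mul (a : R) : R := gmul (rees_tau i L) a.

Lemma tau_mulE a : tau_mul a = fun k => a (k + 1).
Proof.
rewrite /tau_mul gmulE convol_mono; apply: funext => k.
by rewrite mul1r opprK.
Qed.

Lemma rees_tau_deg : gdeg 0 (rees_tau i L).
Proof. by apply: (@gdeg_mono _ _ _ i L (-1) 0%N 1); exact: H0_1. Qed.

Lemma tau_mul_deg n a : gdeg n a -> gdeg n (tau_mul a).
Proof. exact: (gdegM Rax rees_tau_deg). Qed.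

Lemma tau_mul_mono l g : tau_mul (mono l g) = mono (l - 1) g.
Proof. by rewrite /tau_mul gmul_mono mul1r addrC. Qed.

Lemma th_tau_mul n a z : gdeg n a -> th (tau_mul a) z = tau z *: th a z.
Proof.
by move=> na; rewrite (thM z rees_tau_deg na) U1tauE mulr_algl.
Qed.

Lemma th_mono_neg n l g z : H0 L n g -> l <= 0 ->
  exists c, th (mono l g) z = c *: th (mono 0 g) z.
Proof.
move=> gH; case: l => [[|//] _|l _].
  by exists 1; rewrite scale1r.
exists (tau z ^+ l.+1); elim: l => [|l IH].
  rewrite -(th_tau_mul (n := n)); last exact: gdeg_mono.
  by rewrite tau_mul_mono add0r.
have E : mono (Negz l.+1) g = tau_mul (mono (Negz l) g) :> R.
  by rewrite tau_mul_mono; congr mono; rewrite !NegzE -[l.+2]addn1 PoszD opprD.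
rewrite E (th_tau_mul (n := n)); last exact: gdeg_mono.
by rewrite IH scalerA -exprS.
Qed.

Lemma th_mono_X n g z K : H0 L n g -> th (mono 0 (g ^+ K)) z = th (mono 0 g) z ^+ K.
Proof.
move=> gH; have gd : @gdeg R n (mono 0 g) by exact: gdeg_mono.
have gKd K' : @gdeg R (K' * n) (mono 0 (g ^+ K')) by apply: gdeg_mono; exact: H0X.
elim: K => [|K IH]; last first.
  rewrite !exprS -IH -(thM z gd (gKd K)); congr (th _ z).
  by rewrite gmul_mono addr0.
have [m [a [m0 ma an]]] := proj_irrelevant Rproj z.
apply: (nonvanishing_mulI an (m := 0)).
- exact: th_homog (gdeg1 Rax).
- by rewrite expr0; exact: homog1.
rewrite !expr0 mulr1 mulrC -(thM z (gdeg1 Rax) ma) (gmul1 Rax ma).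
by [].
Qed.

Lemma sect_span_H0 n g : sect_span s n g -> H0 L n g.
Proof.
elim=> {n g} [n||n a g h _ gH _ hH|n k g kN _ gH|//].
- exact: H0_0.
- exact: H0_1.
- exact: (proj2 (H0_submodule L n)).
- rewrite -add1n; apply: H0M => //.
  by apply: nat_family_ind => [|j]; [exact: H0_0|exact: s_H0].
Qed.

Lemma mono0_deg n g : H0 L n g -> @gdeg R n (mono 0 g).
Proof. exact: (@gdeg_mono _ _ _ i L 0). Qed.

Lemma gen_sE k : (k < N.+1)%N -> gen k = mono 0 (nat_family s k).
Proof. by move=> kN; rewrite /gen /gen_exp /gen_sec kN. Qed.

Lemma mono0_span_cover n g z : sect_span s n g -> (0 < n)%N ->
  nonvanishing n (th (mono 0 g) z) -> exists2 k, (k < r)%N & nonvanishing 1 (th (gen k) z).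
Proof.
elim=> {n g} [n||n a g h gS IHg hS IHh|n k g kN gS IH|//].
- by move=> _; rewrite mono0 th0 => /nonvanishing_neq0.
- by [].
- move=> n0; have gH := sect_span_H0 gS; have hH := sect_span_H0 hS.
  have agH := H0Z a gH; rewrite (monoD 0 (a *: g) h).
  rewrite (thD z (mono0_deg agH) (mono0_deg hH)) => /nonvanishing_add[].
  + exact: th_homog (mono0_deg agH).
  + exact: th_homog (mono0_deg hH).
  + have a1H := H0Z a (H0_1 L).
    have -> : mono 0 (a *: g) = gmul (mono 0 (a *: (1 : germs L)) : R) (mono 0 g).
      rewrite gmul_mono addr0; congr mono.
      transitivity (a *: ((1 : germs L) * g)); first by rewrite mul1r.
      exact/esym/germs_mulZ.
    rewrite (thM z (mono0_deg a1H) (mono0_deg gH)) -{1}[n]add0n.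
    move=> /(nonvanishing_mulr (th_homog z (mono0_deg a1H)) (th_homog z (mono0_deg gH))).
    exact: IHg.
  + exact: IHh.
- move=> _; have gH := sect_span_H0 gS.
  have -> : mono 0 (nat_family s k * g) = gmul (gen k) (mono 0 g).
    by rewrite gen_sE // gmul_mono addr0.
  rewrite -add1n (thM z (gen_deg k) (mono0_deg gH)).
  move=> /(nonvanishing_mull (th_homog z (gen_deg k)) (th_homog z (mono0_deg gH))) kn.
  by exists k => //; rewrite (leq_trans kN) // leq_addr.
Qed.

(** For l > 0 a monomial is a sum of multiples of the t_q tau^(-1), by [ideal_powS]. For l <= 0 it
    is a power of tau times g, and a power of g is a polynomial in the s_k. *)
Lemma mono_cover n l g z : (0 < n)%N -> ideal_powz i l n g ->
  nonvanishing n (th (mono l g) z) -> exists2 k, (k < r)%N & nonvanishing 1 (th (gen k) z).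
Proof.
move=> n_gt0 gI; case: (lerP l 0) => l0.
  have gH := ideal_powz_H0 gI; have [c ->] := th_mono_neg z gH l0.
  move=> /(nonvanishing_unscale (th_homog z (mono0_deg gH))) gn.
  have [n0 n0P] := sections_span Apid hX hs.
  (* The exponent n0 + 1 makes the degree of the power positive and at least n0, where monomials in
     the s_k span. *)
  apply: (@mono0_span_cover (n0.+1 * n) (g ^+ n0.+1)).
  - apply: n0P; last exact: H0X.
    by rewrite (leq_trans (leqnSn n0)) // leq_pmulr.
  - by rewrite muln_gt0.
  - by rewrite (th_mono_X z _ gH); exact: nonvanishingX.
case: l l0 gI => [[//|l]|//] _; case: n n_gt0 => // n _ /(ideal_powS ht)[c [cI ->]].
have tcI q : ideal_pow i l.+1 n.+1 (t q * c q).
  have tI := gen_sec_ideal (N.+1 + q).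
  have := ideal_pow_mul tI (cI q); rewrite /gen_exp ltnNge leq_addr /= !add1n.
  by rewrite /gen_sec ltnNge leq_addr /= addKn nat_familyE.
have tcd q : @gdeg R n.+1 (mono l.+1 (t q * c q)) by exact: (@gdeg_mono _ _ _ i L l.+1 _ _ (tcI q)).
have tc_cover q : nonvanishing n.+1 (th (mono l.+1 (t q * c q)) z) ->
    exists2 k, (k < r)%N & nonvanishing 1 (th (gen k) z).
  have cd : @gdeg R n (mono l (c q)) by exact: (@gdeg_mono _ _ _ i L l _ _ (cI q)).
  have -> : mono l.+1 (t q * c q) = gmul (gen (N.+1 + q)) (mono l (c q)).
    rewrite /gen gmul_mono /gen_exp /gen_sec ltnNge leq_addr /= addKn nat_familyE.
    by rewrite -PoszD add1n.
  rewrite -add1n (thM z (gen_deg _) cd).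
  move=> /(nonvanishing_mull (th_homog z (gen_deg _)) (th_homog z cd)) qn.
  by exists (N.+1 + q)%N => //; rewrite ltn_add2l.
suff: @gdeg R n.+1 (mono l.+1 (\sum_q t q * c q)) /\
    (nonvanishing n.+1 (th (mono l.+1 (\sum_q t q * c q)) z) ->
    exists2 k, (k < r)%N & nonvanishing 1 (th (gen k) z)) by case.
elim/big_ind: _ => [|g1 g2 [d1 H1] [d2 H2]|q _].
- rewrite mono0; split; first exact: (gdeg0 Rax).
  by rewrite th0 => /nonvanishing_neq0.
- rewrite monoD; split; first exact: (gdegD Rax d1 d2).
  rewrite (thD z d1 d2) => /(nonvanishing_add (th_homog z d1) (th_homog z d2)).
  by case.
- by split; [exact: tcd|exact: tc_cover].
Qed.

Lemma gen_cover z : exists2 k, (k < r)%N & nonvanishing 1 (th (gen k) z).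
Proof.
have [n [a [n_gt0 na an]]] := proj_irrelevant Rproj z.
move: an; pattern a; move: a na; apply: gdeg_ind.
  by rewrite th0 => /nonvanishing_neq0.
move=> l g a gI na IH; have gd := gdeg_mono gI.
rewrite (thD z gd na) => /(nonvanishing_add (th_homog z gd) (th_homog z na))[|//].
exact: mono_cover.
Qed.

(** Multiplication by tau shifts the components, so it is injective on S', and fractions inherit
    this. *)
Lemma tau_regular z (c : stalk (U1 D) z) : tau z * c = 0 -> c = 0.
Proof.
move=> tc; have [n [p [q [np nq qn cE]]]] := proj_frac Rproj c.
have [|m [a [ma an aE]]] := proj_zero Rproj (z := z) (tau_mul_deg np).
  by rewrite (th_tau_mul z np) -cE scalerA tc scale0r.
have ap : gmul a p = 0.
  have : tau_mul (gmul a p) = 0.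
    by rewrite -aE /tau_mul (gmulCA Rax rees_tau_deg ma np).
  rewrite tau_mulE => ap0; apply: funext => k.
  have /(congr1 (fun f : int -> germs L => f (k - 1))) := ap0.
  by rewrite subrK.
apply: (nonvanishing_scale0 qn); rewrite cE.
apply: (nonvanishing_mul0 an (th_homog z np)).
by rewrite -(thM z ma np) ap th0.
Qed.

(* The points outside the fibre at infinity are dense: it is locally defined by the
   nonzerodivisor tau. *)
Lemma chart_at z : exists (U : set D) (B : comNzRingType) (th' : B -> functions D) (tau' : B),
  [/\ is_spec U 1 th', U (j1 D z), forall c, tau' * c = 0 -> c = 0 &
      forall d, U d -> is_unit (th' tau' d) -> range (j0 D) d].
Proof.
have [k _ kn] := gen_cover z.
have Bs := chart_spec Rax Rproj Rinj (gen_deg k) kn.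
have [th' [Ds th'E]] := spec_open_immersion (j1_open D) Bs.
have gk1 y : nonvanishing 1 (th (gen k) y) -> nonvanishing 1 (th (gen k) y ^+ 1).
  by rewrite expr1.
have [tau' tau'E] := chart_fraction_exists Rax Rproj (gen_deg k) kn
  (tau_mul_deg (gen_deg k)).
have {}tau'E y : nonvanishing 1 (th (gen k) y) -> chart_eval tau' y = tau y.
  move=> yn; apply: (nonvanishing_scale_inj (gk1 y yn)).
  by rewrite -tau'E // expr1 (th_tau_mul y (gen_deg k)).
exists (j1 D @` [set z | nonvanishing 1 (th (gen k) z)]), _, th', tau'; split=> //.
- move=> c tc; apply: chart_eval_inj => y yn.
  rewrite (spec0 Bs yn); apply: tau_regular.
  by rewrite -(tau'E y yn) -(specM Bs tau' c yn) tc (spec0 Bs yn).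
- move=> _ [y yn <-] tu; apply/overlap1; rewrite -(tau'E y yn) -th'E.
  exact: is_unit_rmorph.
Qed.

(** Around a point of Proj S' the nonzerodivisor given by [chart_at] is invertible only over X x
    Spec A[v], so [spec_dense] applies. *)
Lemma deformation_dense (Q : line_bundle D) n (e : germs Q) d : lreg e d ->
  homog n (e d) -> (\forall d' \near d, range (j0 D) d' -> e d' = 0) -> e d = 0.
Proof.
move=> er eh e0; case: (Defs.cover d) => [dr|[z _ zd]]; first by move/nbhs_singleton: e0; apply.
have [U [B [th' [tau' [Us Uz treg tU]]]]] := chart_at z.
rewrite zd in Uz; apply: (spec_dense Us treg Uz er eh).
by apply: filterS e0 => d' e0 Ud' /(tU d' Ud').
Qed.

Lemma deformation_H0_eq (Q : line_bundle D) n (e e' : germs Q) : H0 Q n e -> H0 Q n e' ->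
  (forall z, e (j0 D z) = e' (j0 D z)) -> e = e'.
Proof.
move=> eH e'H ee'; apply: functional_extensionality_dep => d.
apply/eqP; rewrite -subr_eq0; apply/eqP.
have [er eh] := H0B eH e'H d.
apply: (deformation_dense er eh); apply: filterE => _ [z _ <-].
by rewrite -[LHS]/(e _ - e' _) ee' subrr.
Qed.
End DeformationBasics.

(** * Trivializations of L' over the two charts *)

Section DeformationBundle.
Variables (A : comNzRingType) (X Y : lrs A) (i : mor Y X) (L : line_bundle X).
Variables (N M : nat) (s : 'I_N.+1 -> germs L) (t : 'I_M -> germs L).
Hypothesis Apid : principal_ideals A.
Hypothesis hX : scheme X.
Hypothesis hs : induces_closed_immersion s.
Hypothesis ht : generates_ideal i t.
Variable D : deformation i s t.
Local Notation R := (rees i L).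
Local Notation v := (U0v D).
Local Notation tau := (U1tau D).
Local Notation th := (U1th D).
Local Notation r := (N.+1 + M)%N.
Local Notation phat := (lpull (U0pL D)).
Local Notation gsec := (gen_sec s t).
Local Notation gexp := (gen_exp N).
Local Notation gn := (gen i s t).
Local Notation cd := (@proj_coord A X Y i L N M s t D).

(** Products of a coordinate with t and with u: t has no zero on X x Spec A[v], and u has none on
    Proj S'. *)
Definition wt (k : nat) : germs (L' D) := tsec (L'_tensor D) (cd k) (st D).
Definition wu (k : nat) : germs (L' D) := tsec (L'_tensor D) (cd k) (su D).

Let cd_H0 k : H0 (L1 D) 1 (cd k). Proof. exact: coord_H0. Qed.
Let cd_homog k d : homog 1 (cd k d). Proof. by case: (cd_H0 k d). Qed.
Let st_homog d : homog 1 (st D d). Proof. by case: (st_H0 d). Qed.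
Let su_homog d : homog 1 (su D d). Proof. by case: (su_H0 d). Qed.
Let gdegk k : gdeg 1 (gn k). Proof. exact: gen_deg. Qed.

Lemma wt_H0 k : H0 (L' D) 1 (wt k).
Proof. by apply: tsec_H0; [exact: cd_H0|exact: st_H0]. Qed.

Lemma wu_H0 k : H0 (L' D) 1 (wu k).
Proof. by apply: tsec_H0; [exact: cd_H0|exact: su_H0]. Qed.

Lemma wt_scale k k' d c : cd k d = c *: cd k' d -> wt k d = c *: wt k' d.
Proof. by move=> E; rewrite /wt /tsec E tmulZl. Qed.

Lemma wu_scale k k' d c : cd k d = c *: cd k' d -> wu k d = c *: wu k' d.
Proof. by move=> E; rewrite /wu /tsec E tmulZl. Qed.

Lemma wu_U0 k z c : su D (j0 D z) = c *: st D (j0 D z) -> wu k (j0 D z) = c *: wt k (j0 D z).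
Proof. by move=> E; rewrite /wu /wt /tsec E tmulZr. Qed.

Lemma wt_U1 k z c : st D (j1 D z) = c *: su D (j1 D z) -> wt k (j1 D z) = c *: wu k (j1 D z).
Proof. by move=> E; rewrite /wu /wt /tsec E tmulZr. Qed.

Lemma coord_U0 z : exists k, [/\ (k < N.+1)%N, nonvanishing 1 (phat (gsec k) z),
  nonvanishing 1 (lpull (j0L D) (cd k) z) & nonvanishing 1 (wt k (j0 D z))].
Proof.
have [k kN kn] := s_cover hs z; exists k.
have kn' : nonvanishing 1 (lpull (j0L D) (cd k) z).
  by rewrite j0L_coord /gen_exp kN expr0 scale1r.
split=> //; apply: tmul_nonvanishing; last exact: st_U0.
exact: lbfun_nonvanishingE kn'.
Qed.

(** Over this chart t generates O(1) of the projective line, and dividing by it identifies L' with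
    the pullback of L. The coordinates s_k with k <= N, which have no common zero, provide the
    generators. *)
Lemma J0_exists : exists J0 : lbmor (j0 D) (U0L D) (L' D),
  (forall k z, lpull J0 (wt k) z = lpull (j0L D) (cd k) z) /\
  (forall k z, lpull J0 (wu k) z = v z *: lpull (j0L D) (cd k) z).
Proof.
have [kk kkP] := choice coord_U0.
have cn z : nonvanishing 1 (cd (kk z) (j0 D z)).
  by have [_ _ kn _] := kkP z; exact: lbfun_nonvanishingE kn.
have [|||J0 J0E] := @lbmor_exists _ _ _ (j0 D) (U0L D) (L' D)
    (fun z => wt (kk z) (j0 D z)) (fun z => lpull (j0L D) (cd (kk z)) z).
- by move=> z; have [_ _ _ /nonvanishing_generator] := kkP z.
- by move=> z; have [_ _ /nonvanishing_generator] := kkP z.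
- move=> z; exists (wt (kk z)), (lpull (j0L D) (cd (kk z))); split.
  + by case: (wt_H0 (kk z) (j0 D z)).
  + by case: (lpull_H0 (j0L D) (cd_H0 (kk z)) z).
  + by have [] := kkP z.
  + apply: filterE => y.
    have [c cE] := nonvanishing_fraction (cn y) (cd_homog (kk z) (j0 D y)).
    exists c; split; first exact: wt_scale.
    by rewrite /lpull cE lbfunZ.
have J0t k z : lpull J0 (wt k) z = lpull (j0L D) (cd k) z.
  have [c cE] := nonvanishing_fraction (cn z) (cd_homog k (j0 D z)).
  by rewrite /lpull (wt_scale cE) lbfunZ J0E cE lbfunZ.
exists J0; split=> // k z; have [Vf [_ [VfE _ suE _]]] := coord_functions D.
by rewrite /lpull (wu_U0 k (suE z)) lbfunZ -VfE; congr (_ *: _); exact: J0t.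
Qed.

Section LaurentEval.
Variables (z : U0 D) (v' : stalk (U0 D) z).
Local Notation lev := (laurent_eval (U0pL D) (v z) v').

Definition zpow (l : int) : stalk (U0 D) z :=
  match l with Posz k => v z ^+ k | Negz k => v' ^+ k.+1 end.

Lemma lev_mono l g : lev (mono l g) = zpow l *: phat g z.
Proof.
rewrite /laurent_eval (@fsum_seq _ [:: l]) //; first by rewrite big_seq1 /mono eqxx.
move=> k; rewrite inE /mono => /negbTE ->; rewrite lpull0.
exact: scaler0.
Qed.

Lemma lev_seq (l : seq int) (a : int -> germs L) : uniq l ->
  (forall k, k \notin l -> a k = 0) -> lev a = \sum_(k <- l) zpow k *: phat (a k) z.
Proof.
move=> ul al; apply: fsum_seq => // k /al ->.
by rewrite lpull0; exact: scaler0.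
Qed.

Lemma lev_homog n p : @gdeg R n p -> homog n (lev p).
Proof.
move=> [/finite_support_seq[l ul pl] pI]; rewrite (lev_seq ul pl).
apply: big_ind; [exact: homog0|by move=> a b; exact: homogD|].
move=> k _; apply: homogZ.
by case: (lpull_H0 (U0pL D) (ideal_powz_H0 (pI k)) z).
Qed.

Lemma lev_gen k : lev (gn k) = lpull (j0L D) (cd k) z.
Proof. by rewrite lev_mono j0L_coord. Qed.

Hypothesis vv' : v z * v' = 1.
Variable z1 : U1 D.
Hypothesis zz1 : j0 D z = j1 D z1.

(** [gluing] only compares fractions. For k with s_k invertible at the point, s_k^n is a multiple of
    p over Proj S', hence also over X x Spec A[v], where it is invertible. *)
Lemma overlap_nonvanishing n p : @gdeg R n p -> nonvanishing n (th p z1) ->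
  nonvanishing n (lev p).
Proof.
move=> np pn; have [k [kN kn _ _]] := coord_U0 z.
have sH : H0 L n (gsec k ^+ n).
  by have := H0X n (gen_sec_H0 hs ht k); rewrite muln1.
have [c cE] := nonvanishing_fraction pn (th_homog z1 (mono0_deg i sH)).
have [C [_ CE]] : exists C : functions D, True /\ pull (j1 D) C z1 = c.
  have [a aE] := open_comor_surj (j1_open D) c.
  by have [C _ Ca] := reg_exists a; exists C; split=> //; rewrite /pull Ca.
have := gluing zz1 (mono0_deg i sH) np pn vv' (c := C).
rewrite CE => /(_ (esym cE)); rewrite (lev_mono 0) => E.
apply: (nonvanishing_unscale (lev_homog np) (c := pull (j0 D) C z)).
rewrite E scale1r lpullX germsX -{1}[n]muln1.
exact: nonvanishingX.
Qed.
End LaurentEval.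

Lemma gen_ratio k k' z (C : functions D) : reg C (j1 D z) ->
  nonvanishing 1 (th (gn k') z) ->
  th (gn k) z = pull (j1 D) C z *: th (gn k') z ->
  \forall d \near j1 D z, forall z0, j0 D z0 = d ->
    lpull (j0L D) (cd k) z0 = pull (j0 D) C z0 *: lpull (j0L D) (cd k') z0 /\
    nonvanishing 1 (lpull (j0L D) (cd k') z0).
Proof.
move=> Cr k'n kE.
have treg k1 : lreg (th (gn k1)) z by case: (proj_sec (U1_proj D) (gdegk k1) z).
have n1 := lreg_near_eq (treg k) (lregZ (comor_reg Cr) (treg k')) kE.
have n2 := nonvanishing_near (treg k') k'n.
apply: (open_near (j1_open D)).
near=> y => z0 zy.
have yn : nonvanishing 1 (th (gn k') y) by near: y.
have yE : th (gn k) y = pull (j1 D) C y *: th (gn k') y by near: y.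
have [v' vv'] : is_unit (v z0) by apply/overlap0; exists y.
rewrite -!(lev_gen v'); split; last exact: (overlap_nonvanishing vv' zy).
by rewrite (gluing zy (gdegk k) (gdegk k') yn vv' (esym yE)).
Unshelve. all: by end_near. Qed.

Lemma ratio_exists k k' z : nonvanishing 1 (th (gn k') z) ->
  exists C : functions D, reg C (j1 D z) /\ th (gn k) z = pull (j1 D) C z *: th (gn k') z.
Proof.
move=> k'n; have [c cE] := nonvanishing_fraction k'n (th_homog z (gdegk k)).
have [a aE] := open_comor_surj (j1_open D) c.
by have [C Cr Ca] := reg_exists a; exists C; split=> //; rewrite /pull Ca aE.
Qed.

(** No datum relates the coordinates to S' over the fibre at infinity. On the overlap the ratio F of
    the coordinates k and k' is inverse to the ratio C of the generators k' and k, and F C = 1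
    extends by density. *)
Lemma gen_coord k z : nonvanishing 1 (th (gn k) z) -> nonvanishing 1 (cd k (j1 D z)).
Proof.
move=> kn; have [k' _ k'n] := coord_cover (j1 D z).
have cr q : lreg (cd q) (j1 D z) by case: (cd_H0 q (j1 D z)).
have [F Fr FE] := fraction_near (cr k) (cd_homog k _) (cr k') k'n.
have [C [Cr CE]] := ratio_exists k' kn.
have CN := gen_ratio Cr kn CE.
suff FC : F (j1 D z) * C (j1 D z) = 1.
  rewrite (nbhs_singleton FE); apply: nonvanishingZ => //.
  by exists (C (j1 D z)).
pose e : germs (L1 D) := fun d => (F d * C d) *: cd k' d - cd k' d.
have e0 : e (j1 D z) = 0.
  apply: (deformation_dense Apid hX hs ht (n := 1)).
  - by apply: lreg_sub => //; apply: lregZ => //; exact: regM.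
  - by apply: homogB => //; exact: homogZ.
  apply: filterS2 CN FE => d CNd FEd [z0 _ z0d]; have [E kn0] := CNd z0 z0d.
  subst d.
  have E2 : lpull (j0L D) (cd k) z0 = pull (j0 D) F z0 *: lpull (j0L D) (cd k') z0.
    by rewrite /lpull {1}FEd lbfunZ.
  rewrite /e (_ : F _ * C _ = 1) ?scale1r ?subrr //.
  apply: (open_comor_inj (j0_open D)); rewrite rmorphM rmorph1 /=.
  apply: (nonvanishing_scale_inj kn0).
  by rewrite -scalerA -[comor (j0 D) z0 (C _) *: _]E -E2 scale1r.
apply: (nonvanishing_scale_inj k'n); rewrite scale1r.
by apply/eqP; rewrite -subr_eq0; apply/eqP.
Qed.

(** The ratio of the generators and that of the coordinates agree on the overlap, hence everywhere
    by density. *)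
Lemma coord_ratio k k' z c : nonvanishing 1 (th (gn k') z) ->
  cd k (j1 D z) = c *: cd k' (j1 D z) -> th (gn k) z = comor (j1 D) z c *: th (gn k') z.
Proof.
move=> k'n cE; have k'n' := gen_coord k'n.
have cr q : lreg (cd q) (j1 D z) by case: (cd_H0 q (j1 D z)).
have [F Fr FE] := fraction_near (cr k) (cd_homog k _) (cr k') k'n'.
have Fc : F (j1 D z) = c.
  by apply: (nonvanishing_scale_inj k'n'); rewrite -cE (nbhs_singleton FE).
have [C [Cr CE]] := ratio_exists k k'n; have CN := gen_ratio Cr k'n CE.
rewrite CE -Fc -[comor _ _ _]/(pull (j1 D) F z); congr (_ *: _).
rewrite /pull (_ : C (j1 D z) = F (j1 D z)) //.
pose e : germs (L1 D) := fun d => C d *: cd k' d - F d *: cd k' d.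
have e0 : e (j1 D z) = 0.
  apply: (deformation_dense Apid hX hs ht (n := 1)).
  - by apply: lreg_sub; exact: lregZ.
  - by apply: homogB; exact: homogZ.
  apply: filterS2 CN FE => d CNd FEd [z0 _ z0d]; have [E kn0] := CNd z0 z0d.
  subst d; rewrite /e (_ : C (j0 D z0) = F (j0 D z0)) ?subrr //.
  apply: (open_comor_inj (j0_open D)); apply: (nonvanishing_scale_inj kn0).
  by rewrite -[LHS]E /lpull {1}FEd lbfunZ.
apply: (nonvanishing_scale_inj k'n').
by apply/eqP; rewrite -subr_eq0; apply/eqP.
Qed.

(** Dividing by u over Proj S' identifies L' with O(1), coordinate k corresponding to [gen k];
    [gen_coord] and [coord_ratio] make generators and ratios match. *)
Lemma J1_exists : exists J1 : lbmor (j1 D) (U1O D) (L' D),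
  (forall k z, lpull J1 (wu k) z = th (gn k) z) /\
  (forall k z, lpull J1 (wt k) z = tau z *: th (gn k) z).
Proof.
have /choice[kk kkP] : forall z, exists k, nonvanishing 1 (th (gn k) z).
  by move=> z; have [k _ kn] := gen_cover Apid hX hs ht z; exists k.
have wn z : nonvanishing 1 (wu (kk z) (j1 D z)).
  by apply: tmul_nonvanishing; [exact: gen_coord|exact: su_U1].
have [|||J1 J1E] := @lbmor_exists _ _ _ (j1 D) (U1O D) (L' D)
    (fun z => wu (kk z) (j1 D z)) (fun z => th (gn (kk z)) z).
- by move=> z; exact: nonvanishing_generator.
- by move=> z; exact: nonvanishing_generator.
- move=> z; exists (wu (kk z)), (th (gn (kk z))); split=> //.
  + by case: (wu_H0 (kk z) (j1 D z)).
  + by case: (proj_sec (U1_proj D) (gdegk (kk z)) z).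
  + apply: filterE => y.
    have [c cE] := nonvanishing_fraction (gen_coord (kkP y)) (cd_homog (kk z) (j1 D y)).
    by exists c; split; [exact: wu_scale|exact: coord_ratio].
have J1u k z : lpull J1 (wu k) z = th (gn k) z.
  have [c cE] := nonvanishing_fraction (gen_coord (kkP z)) (cd_homog k (j1 D z)).
  by rewrite /lpull (wu_scale cE) lbfunZ J1E (coord_ratio (kkP z) cE).
exists J1; split=> // k z; have [_ [Tf [_ TfE _ stE]]] := coord_functions D.
by rewrite /lpull (wt_U1 k (stE z)) lbfunZ -TfE; congr (_ *: _); exact: J1u.
Qed.

Section Overlap.
Variables (J0 : lbmor (j0 D) (U0L D) (L' D)) (J1 : lbmor (j1 D) (U1O D) (L' D)).
Hypothesis J0u : forall k z, lpull J0 (wu k) z = v z *: lpull (j0L D) (cd k) z.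
Hypothesis J1u : forall k z, lpull J1 (wu k) z = th (gn k) z.

Lemma th_gen_power k n z : th (mono ((gexp k)%:Z *+ n) (gsec k ^+ n)) z = th (gn k) z ^+ n.
Proof.
have E : mono ((gexp k)%:Z *+ n) (gsec k ^+ n) = gpow (mono 0 1 : R) (gn k) n.
  by rewrite gpow_mono.
rewrite E; elim: n {E} => [|n IH].
  rewrite -(expr0 (1 : germs L)) [gpow _ _ _]/(mono 0 (1 ^+ 0)).
  by rewrite (th_mono_X z 0 (H0_1 L)).
have gd := gdeg_pow (rees_axioms i L) n (gdegk k).
by rewrite exprS -IH -(thM z (gdegk k) gd).
Qed.

Lemma overlap_eval n p (e : germs (L' D)) z z1 v' : v z * v' = 1 -> j0 D z = j1 D z1 ->
  @gdeg R n p -> homog n (e (j0 D z)) -> lpull J1 e z1 = th p z1 ->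
  lpull J0 e z = v z ^+ n *: laurent_eval (U0pL D) (v z) v' p.
Proof.
move=> vv' zz1 np eh eE; have [k _ kn] := gen_cover Apid hX hs ht z1.
have knn : nonvanishing n (th (gn k) z1 ^+ n).
  by have := nonvanishingX n kn; rewrite muln1.
have [c cE] := nonvanishing_fraction knn (th_homog z1 np).
have [a aE] := open_comor_surj (j1_open D) c; have [C _ Ca] := reg_exists a.
have whn : homog n (wu k (j1 D z1) ^+ n).
  by have := homogX n (proj2 (wu_H0 k (j1 D z1))); rewrite muln1.
have eC : e (j1 D z1) = C (j1 D z1) *: wu k (j1 D z1) ^+ n.
  rewrite zz1 in eh; apply: (lbfun_homog_inj (phi := J1) (n := n)) => //.
  - exact: (open_comor_inj (j1_open D)).
  - exact: homogZ.
  rewrite -[LHS]/(lpull J1 e z1) eE cE lbfunZ rmorphXn Ca aE; congr (_ *: _ ^+ _).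
  by rewrite -J1u.
have eC0 : e (j0 D z) = C (j0 D z) *: wu k (j0 D z) ^+ n by rewrite zz1.
have bd : @gdeg R n (mono ((gexp k)%:Z *+ n) (gsec k ^+ n)).
  have := gdeg_pow (rees_axioms i L) n (gdegk k).
  by rewrite muln1 gpow_mono.
have bn : nonvanishing n (th (mono ((gexp k)%:Z *+ n) (gsec k ^+ n)) z1).
  by rewrite th_gen_power.
have := gluing zz1 np bd bn vv' (c := C).
rewrite /pull Ca aE th_gen_power => /(_ (esym cE)) <-.
rewrite /lpull eC0 lbfunZ rmorphXn -[lbfun J0 z (wu k _)]/(lpull J0 (wu k) z) J0u.
rewrite exprZn scalerA mulrC -scalerA; congr (_ *: (_ *: _)).
have -> : (gexp k)%:Z *+ n = (gexp k * n)%N%:Z.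
  by rewrite pmulrn -mulrzl intz mulrC.
rewrite j0L_coord exprZn -exprM lev_mono /zpow.
by congr (_ *: _); rewrite lpullX germsX.
Qed.
End Overlap.
End DeformationBundle.

(** * Finiteness of the extended Rees algebra *)

Section ReesFiniteness.
Variables (A : comNzRingType) (X Y : lrs A) (i : mor Y X) (L : line_bundle X).
Variables (N M : nat) (s : 'I_N.+1 -> germs L) (t : 'I_M -> germs L).
Hypothesis Apid : principal_ideals A.
Hypothesis hX : scheme X.
Hypothesis hs : induces_closed_immersion s.
Hypothesis ht : generates_ideal i t.
Local Notation R := (rees i L).
Local Notation V := (int -> germs L).
Local Notation r := (N.+1 + M)%N.
Local Notation gsec := (gen_sec s t).
Local Notation gn := (gen i s t).

Definition rees_x (k : nat) (a : R) : R := gmul (gn k) a.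
Definition rees_ops : set (V -> V) :=
  degree0_ops (A := A) (V := V) 1 (fun _ => @tau_mul A X Y i L).

Lemma rees_xE k (a : R) : rees_x k a = fun m => gsec k * a (m - (gen_exp N k)%:Z).
Proof. exact: convol_mono. Qed.

Lemma rees_xB k (a b : R) : rees_x k (a - b) = rees_x k a - rees_x k b.
Proof.
rewrite !rees_xE; apply: funext => m; rewrite -[RHS]/(_ - _).
exact: mulrBr.
Qed.

Lemma rees_xC k l (a : R) : rees_x k (rees_x l a) = rees_x l (rees_x k a).
Proof. by rewrite !rees_xE; apply: funext => m; rewrite mulrCA addrAC. Qed.

Lemma rees_x_linear k (a : A) (u w : V) :
  rees_x k (a *: u + w) = a *: (rees_x k u : V) + rees_x k w.
Proof.
rewrite !rees_xE; apply: funext => m.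
rewrite -[LHS]/(gsec k * (a *: u (m - (gen_exp N k)%:Z) + w (m - (gen_exp N k)%:Z))).
rewrite mulrDr; congr (_ + _).
by rewrite mulrC [RHS](_ : _ = a *: (u (m - (gen_exp N k)%:Z) * gsec k)) ?germs_mulZ // mulrC.
Qed.

Lemma tau_mul_linear (a : A) (u w : V) :
  tau_mul (i := i) (a *: u + w) = a *: (tau_mul (i := i) u : V) + tau_mul (i := i) w.
Proof. by rewrite !tau_mulE. Qed.

Lemma tau_mulB (u w : R) : tau_mul (u - w) = tau_mul u - tau_mul w.
Proof. by rewrite !tau_mulE. Qed.

Lemma rees_x_tau k (a : R) : rees_x k (tau_mul a) = tau_mul (rees_x k a).
Proof. by rewrite tau_mulE !rees_xE tau_mulE; apply: funext => m; rewrite addrAC. Qed.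

Lemma rees_opsB c (u w : V) : rees_ops c -> c (u - w) = c u - c w.
Proof. by move=> [[a ->]|[k _ ->]]; [exact: scalerBr|exact: tau_mulB]. Qed.

Lemma rees_ops_x c k (a : V) : rees_ops c -> c (rees_x k a) = rees_x k (c a).
Proof.
move=> [[e ->]|[l _ ->]]; last by rewrite rees_x_tau.
have := rees_x_linear k e a 0; rewrite addr0 => ->.
by rewrite (_ : rees_x k 0 = 0) ?addr0 //; exact: convol0r.
Qed.

Lemma rees_scale (e : A) (a : V) : e *: a = gmul (mono 0 (e *: (1 : germs L)) : R) a.
Proof.
rewrite gmulE convol_mono; apply: funext => k; rewrite subr0.
by rewrite germs_mulZ mul1r.
Qed.

Lemma gdegZ n (a : A) (u : V) : @gdeg R n u -> @gdeg R n (a *: u).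
Proof.
move=> [fu uI]; split; last by move=> l; exact: submoduleZ (ideal_powz_submodule i L l n) (uI l).
apply: (sub_finite_set _ fu) => l /= ul u0; apply: ul.
by rewrite -[LHS]/(a *: u l) u0 scaler0.
Qed.

Lemma rees_sub : graded_sub r rees_x rees_ops (@gdeg R).
Proof.
move=> n; split; first exact: gdegB (rees_axioms i L) n.
- move=> c u [[a ->]|[k _ ->]] un; first exact: gdegZ.
  exact: tau_mul_deg.
- move=> k u _ un; rewrite -add1n; apply: (gdegM (rees_axioms i L)) => //.
  exact: gen_deg.
Qed.

Local Notation rspan :=
  (graded_span (A := A) (V := V) r 1 rees_x (fun _ => @tau_mul A X Y i L) (mono 0 1)).

Lemma mono0_rspan n g : sect_span s n g -> rspan n (mono 0 g).
Proof.
move=> gS.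
have : graded_span (A := A) (V := V) N.+1 0 rees_x (fun _ => id) (mono 0 1) n (mono 0 g).
  apply: (@graded_span_map _ _ _ _ _ _ _ _ _ _ _ (mono 0) _ (fun _ => setT)) gS => //.
  - exact: mono0.
  - move=> _ a u w _ _; rewrite monoD; congr (_ + _).
    apply: funext => k; rewrite /mono -[RHS]/(a *: (if k == 0 then u else 0)).
    by case: ifP => _; rewrite ?scaler0.
  - move=> _ k u kN _; rewrite /rees_x /gen /gen_exp kN gmul_mono addr0.
    by rewrite /gen_sec kN.
elim=> {n g gS} [n||n a u w _ IHu _ IHw|n k u kN _ IH|//].
- exact: GSpan0.
- exact: GSpan1.
- exact: GSpanL.
- by apply: GSpanX => //; rewrite (leq_trans kN) // leq_addr.
Qed.

(** The factor e = s_j^n0 raises all degrees to the range where monomials span. Terms with l <= 0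
    are reached from l = 0 by tau; terms with l > 0 lose one t_q tau^(-1) at a time through
    [ideal_powS]. *)
Lemma rees_rspan n0 j : (forall n, (n0 <= n)%N -> forall g, H0 L n g -> sect_span s n g) ->
  (j < N.+1)%N -> forall n (a : R), gdeg n a ->
  rspan (n + n0) (fun k => nat_family s j ^+ n0 * a k).
Proof.
move=> n0P jN; set e := nat_family s j ^+ n0.
have eH : H0 L n0 e.
  have sH : H0 L 1 (nat_family s j).
    by apply: nat_family_ind => [|q]; [exact: H0_0|exact: s_H0].
  by have := H0X n0 sH; rewrite muln1.
have rD n u w : rspan n u -> rspan n w -> rspan n (u + w).
  by move=> uS wS; rewrite -[u]scale1r; exact: GSpanL.
have neg n l g : H0 L n g -> rspan (n + n0) (mono (- l%:Z) (e * g)).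
  elim: l => [|l IH] gH.
    rewrite oppr0; apply: mono0_rspan; apply: n0P; first exact: leq_addl.
    by rewrite addnC; exact: H0M.
  have -> : mono (- l.+1%:Z) (e * g) = tau_mul (i := i) (mono (- l%:Z) (e * g)).
    by rewrite tau_mul_mono -opprD -PoszD addn1.
  by apply: (GSpanY (k := 0)) => //; exact: IH.
have pos n l g : ideal_pow i l n g -> rspan (n + n0) (mono l%:Z (e * g)).
  elim: l n g => [|l IH] n g; first by move=> gH; have := neg n 0%N g gH; rewrite oppr0.
  case: n => [|n]; first by move=> /(ideal_powS0 ht) ->; rewrite mulr0 mono0; exact: GSpan0.
  move=> /(ideal_powS ht)[c [cI ->]]; rewrite mulr_sumr.
  elim/big_ind: _ => [|u w uS wS|q _].
  - by rewrite mono0; exact: GSpan0.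
  - by rewrite monoD; exact: rD.
  have -> : mono l.+1%:Z (e * (t q * c q)) = rees_x (N.+1 + q) (mono l%:Z (e * c q)).
    rewrite /rees_x /gen gmul_mono /gen_exp /gen_sec ltnNge leq_addr /= addKn nat_familyE.
    by rewrite -PoszD add1n mulrCA.
  by rewrite addSn; apply: GSpanX; [rewrite ltn_add2l|exact: IH].
move=> n a; pattern a; move: a; apply: gdeg_ind.
  rewrite (_ : (fun k => _) = 0 :> V); first exact: GSpan0.
  by apply: funext => k; exact: mulr0.
move=> l g a gI na IH.
have -> : (fun k => e * ((mono l g : R) + a) k) =
    mono l (e * g) + (fun k => e * a k).
  apply: funext => k; rewrite -[LHS]/(e * (mono l g k + a k)) mulrDr.
  by rewrite -[RHS]/(mono l (e * g) k + e * a k) /mono; case: ifP; rewrite ?mulr0.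
apply: rD => //; case: l gI => l gI; first exact: pos.
by have := neg n l.+1 g gI; rewrite -NegzE.
Qed.

(** Here g need not be homogeneous: where s_j generates, the whole stalk is the polynomial algebra
    on s_j, in which s_j is a nonzerodivisor. *)
Lemma s_power_regular n0 (g : germs L) :
  (forall j, (j < N.+1)%N -> nat_family s j ^+ n0 * g = 0) -> g = 0.
Proof.
move=> g0; apply: functional_extensionality_dep => x.
have [j jn] := closed_immersion_cover hs x.
have [[h hK Kh] _] := nonvanishing_generator jn.
have reg1 w : s j x * w = 0 -> w = 0.
  move=> sw; rewrite -(Kh w) (_ : h w = 0) ?rmorph0 //; apply: polyX_mul0.
  by apply: (can_inj hK); rewrite rmorphM rmorph0 /= horner_algX Kh.
have /(congr1 (fun s : germs L => s x)) := g0 j (ltn_ord j).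
rewrite nat_familyE -[LHS]/((s j ^+ n0) x * g x) germsX.
elim: n0 {g0} => [|n0 IH]; first by rewrite mul1r.
by rewrite exprS -mulrA => /reg1.
Qed.

(** The multiplications by s_j^n0, jointly injective, embed S' in N + 1 copies of the module that
    the generators and tau span from 1. *)
Lemma rees_acc : graded_acc r rees_x rees_ops (@gdeg R).
Proof.
have [n0 n0P] := sections_span Apid hX hs.
apply: (@graded_acc_embedding A V r 1 N.+1 n0 rees_x (fun _ => @tau_mul A X Y i L)
  (fun j a k => nat_family s j ^+ n0 * a k) (mono 0 1) Apid).
- exact: rees_x_linear.
- by move=> _ a u w; exact: tau_mul_linear.
- move=> j a u w; apply: funext => k.
  rewrite -[LHS]/(nat_family s j ^+ n0 * (a *: u k + w k)) mulrDr.
  rewrite -[RHS]/(a *: (nat_family s j ^+ n0 * u k) + nat_family s j ^+ n0 * w k).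
  by congr (_ + _); rewrite mulrC germs_mulZ mulrC.
- exact: rees_xC.
- by [].
- by move=> k l a; exact: rees_x_tau.
- by move=> j k a; rewrite !rees_xE; apply: funext => m; rewrite mulrCA.
- by move=> j _ a; rewrite !tau_mulE.
- move=> a a0; apply: funext => k; apply: (@s_power_regular n0) => j jN.
  by have /(congr1 (fun f : V => f k)) := a0 j jN.
- by move=> j n a jN; exact: rees_rspan.
Qed.
End ReesFiniteness.

Lemma direct_sumI (A : comNzRingType) (V : lmodType A) (K : nat) (E : 'I_K -> set V)
    (H : set V) : (forall k, submodule (E k)) -> (forall k, E k `<=` H) ->
  (forall x, H x -> exists e : 'I_K -> V, (forall k, E k (e k)) /\ x = \sum_k e k) ->
  (forall e : 'I_K -> V, (forall k, E k (e k)) -> \sum_k e k = 0 -> forall k, e k = 0) ->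
  direct_sum E H.
Proof.
move=> Es EH Egen Efree; split=> // x /Egen[e [eE xE]]; exists e; split=> // e' [e'E xE'].
apply: funext => k; apply/eqP; rewrite -subr_eq0; apply/eqP.
apply: (Efree (fun k => e k - e' k)) => [q|].
  exact: submoduleB.
by rewrite sumrB -xE -xE' subrr.
Qed.

(** * Closed subspaces of Proj S' *)

Section ReesSections.
Variables (A : comNzRingType) (X Y : lrs A) (i : mor Y X) (L : line_bundle X).
Variables (N M : nat) (s : 'I_N.+1 -> germs L) (t : 'I_M -> germs L).
Hypothesis Apid : principal_ideals A.
Hypothesis hX : scheme X.
Hypothesis hs : induces_closed_immersion s.
Hypothesis ht : generates_ideal i t.
Variable D : deformation i s t.
Local Notation R := (rees i L).
Local Notation th := (U1th D).
Local Notation gn := (gen i s t).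
Let Rax := rees_axioms i L.
Let Rproj := U1_proj D.
Let Rinj := @rees_gdeg_inj A X Y i L.
Let gndeg k : gdeg 1 (gn k). Proof. exact: gen_deg. Qed.
Let gncover := @gen_cover A X Y i L N M s t Apid hX hs ht D.

Variables (Z : lrs A) (Q : line_bundle Z) (f : Z -> U1 D) (Th : R -> germs Q).
Variable K : nat -> set R.
Hypothesis f_closed : closed (range f).
Hypothesis f_nbhs : forall x (V : set Z), nbhs x V ->
  exists2 U : set (U1 D), nbhs (f x) U & f @^-1` U `<=` V.
Hypothesis Th_H0 : forall n a, gdeg n a -> H0 Q n (Th a).
Hypothesis ThD : forall n a c, gdeg n a -> gdeg n c -> Th (a + c) = Th a + Th c.
Hypothesis ThM : forall n m a c, gdeg n a -> gdeg m c -> Th (gmul a c) = Th a * Th c.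
Hypothesis Th_nonvanishing : forall n a x, gdeg n a ->
  (nonvanishing n (Th a x) <-> nonvanishing n (th a (f x))).
Hypothesis Th_fraction : forall x (c : stalk Z x), exists n p q,
  [/\ gdeg n p, gdeg n q, nonvanishing n (Th q x) & c *: Th q x = Th p x].
Hypothesis K_ideal : hideal K.
Hypothesis Th_K : forall n a, K n a -> Th a = 0.
Hypothesis Th_kernel : forall n a x, gdeg n a -> Th a x = 0 -> exists m b,
  [/\ gdeg m b, nonvanishing m (th b (f x)) & K (m + n)%N (gmul b a)].
Hypothesis K_range : forall z, range f z \/ exists n a, K n a /\ nonvanishing n (th a z).

(** The a with a p in K form a homogeneous ideal. A point of D_+(q) where all of them vanish would
    be in the image of f by [K_range], and could not be there by [Th_kernel]. *)
Lemma kernel_power n m p q : gdeg n p -> gdeg m q -> (0 < m)%N ->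
  (forall x, nonvanishing m (Th q x) -> Th p x = 0) ->
  exists e, K (e * m + n)%N (gmul (gpow (mono 0 1 : R) q e) p).
Proof.
move=> np mq m0 pq0; apply: contrapT => /forallNP noe.
have [Kd K0 KD KM] := K_ideal.
have Ii : hideal (fun k => [set a | gdeg k a /\ K (k + n)%N (gmul a p)]).
  split=> [k a []//|k|k a b [ka Ka] [kb Kb]|k l a b lb [ka Ka]].
  - by split; [exact: (gdeg0 Rax)|rewrite gmulE convol0l].
  - by split; [exact: (gdegD Rax ka kb)|rewrite (gmulDl Rax np ka kb); exact: KD].
  - split; first exact: (gdegM Rax lb ka).
    by rewrite -(gmulA Rax lb ka np) -addnA; exact: KM.
have [z qz zI] := proj_point Rax Rproj Rinj Ii m0 mq (fun e eI => noe e (proj2 eI)).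
case: (K_range z) => [[x _ xz]|[l [a [Ka an]]]]; last first.
  apply: zI an; split; first exact: Kd.
  by rewrite (gmulC Rax (Kd _ _ Ka) np) addnC; exact: KM.
rewrite -xz in qz zI; have [|l [b [lb bn Kb]]] := Th_kernel (x := x) np.
  by apply: pq0; apply/Th_nonvanishing.
exact: zI bn.
Qed.

(* K n is the kernel in degree n, once n is large: Th embeds Z in Proj S' as the closed
   subspace defined by K. *)
Theorem rees_sections : exists n0, forall n, (n0 <= n)%N ->
  (forall rho, H0 Q n rho -> exists2 p, gdeg n p & Th p = rho) /\
  (forall p, gdeg n p -> Th p = 0 -> K n p).
Proof.
have ThX' := @graded_mapX _ _ _ _ _ Rax _ _ _ gndeg (gncover) _ _ _ _ Th_H0 ThM Th_nonvanishing.
have Th_zero n m p q : gdeg n p -> gdeg m q -> (0 < m)%N ->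
    (forall x, nonvanishing m (Th q x) -> Th p x = 0) ->
    exists e, Th q ^+ e * Th p = 0.
  move=> np mq m0 pq0; have [e eK] := kernel_power np mq m0 pq0; exists e.
  by rewrite -(ThX' _ _ _ mq) -(ThM (gdeg_pow Rax e mq) np); exact: Th_K eK.
have Th_C n c a : @rees_ops A X Y i L c -> gdeg n a -> Th a = 0 -> Th (c a) = 0.
  have op_mul (b : R) : gdeg 0 b -> gdeg n a -> Th a = 0 -> Th (gmul b a) = 0.
    by move=> bd na a0; rewrite (ThM bd na) a0 mulr0.
  move=> [[e ->]|[k _ ->]] na a0; last exact: op_mul (rees_tau_deg i L) na a0.
  by rewrite (rees_scale i); apply: op_mul na a0; apply: mono0_deg; apply: H0Z; exact: H0_1.
have [n1 n1P] := @sections_surjective _ _ _ _ _ Rax _ Rproj Rinj _ _ gndeg gncover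
  _ _ _ _ f_closed f_nbhs Th_H0 ThD ThM Th_nonvanishing Th_fraction Th_zero (@rees_ops A X Y i L)
  (@rees_xB A X Y i L N M s t) (@rees_xC A X Y i L N M s t) (@rees_opsB _ _ _ i L)
  (@rees_ops_x A X Y i L N M s t)
  (rees_sub hs ht) (rees_acc Apid hX hs ht) Th_C.
have Ks : graded_sub (N.+1 + M) (@rees_x A X Y i L N M s t) (@rees_ops A X Y i L) K.
  have [Kd K0 KD KM] := K_ideal.
  have KZ n c a : @rees_ops A X Y i L c -> K n a -> K n (c a).
    move=> [[e ->]|[k _ ->]] Ka; last exact: (KM _ 0%N) (rees_tau_deg i L) Ka.
    by rewrite (rees_scale i); apply: (KM _ 0%N) => //; apply: mono0_deg; apply: H0Z; exact: H0_1.
  move=> n; split; last 2 first.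
  - by move=> c a; exact: KZ.
  - by move=> k a _ Ka; rewrite -add1n; exact: KM.
  split=> [|a b Ka Kb]; first exact: K0.
  apply: KD => //; rewrite -scaleN1r; apply: (KZ n ( *:%R (-1))) => //.
  by left; exists (-1).
have [n2 n2P] := saturated_noetherian (@rees_xB A X Y i L N M s t) (@rees_xC A X Y i L N M s t)
  (@rees_opsB _ _ _ i L) (@rees_ops_x A X Y i L N M s t) (rees_acc Apid hX hs ht)
  (rees_sub hs ht) Ks
  (hideal_deg K_ideal).
exists (maxn n1 n2) => n; rewrite geq_max => /andP[nn1 nn2]; split; first exact: n1P.
move=> p np p0; apply: (proj1 (n2P n nn2)) => //.
have Kmono k e e' : (e <= e')%N -> K (n + e)%N (iter e (@rees_x A X Y i L N M s t k) p) ->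
    K (n + e')%N (iter e' (@rees_x A X Y i L N M s t k) p).
  move=> /subnKC <-; elim: (e' - e)%N => [|d IH]; first by rewrite addn0.
  move=> /IH{}IH; rewrite !addnS iterS.
  by rewrite -add1n; exact: (hidealM K_ideal (gndeg k)).
(* Some power of each generator multiplies p into K; with a common exponent this is the hypothesis
   of [torsion_free]. *)
have /choice[e eP] : forall k, exists e, K (n + e)%N (iter e (@rees_x A X Y i L N M s t k) p).
  move=> k; have [|e eK] := kernel_power np (gndeg k) isT; first by move=> x _; rewrite p0.
  exists e; rewrite muln1 addnC in eK.
  rewrite (_ : iter _ _ _ = gmul (gpow (mono 0 1 : R) (gn k) e) p) //.
  elim: e {eK} => [|e IH]; first by rewrite (gmul1 Rax np).
  by rewrite iterS IH /rees_x (gmulA Rax (gndeg k) (gdeg_pow Rax e (gndeg k)) np).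
exists (\max_(k < N.+1 + M) e k) => k kr; apply: (Kmono k (e k)) => //.
exact: (@leq_bigmax _ (fun k : 'I_(N.+1 + M) => e k) (Ordinal kr)).
Qed.
End ReesSections.

(** * The weight decomposition of the sections *)

Section LineCoefficients.
Variables (A : comNzRingType) (X Z : lrs A) (p : mor Z X) (v : functions Z).
Hypothesis hX : scheme X.
Hypothesis Zline : is_line_over p v.
Variables (L : line_bundle X) (Q : line_bundle Z) (phi : lbmor p Q L).
Local Notation phat := (lpull phi).

Lemma line_regular n z m (w : alg Q z) : homog n w -> v z ^+ m *: w = 0 -> w = 0.
Proof.
have [e eg] := generator_at Q z; move=> /(proj2 eg)[c ->]; rewrite scalerA => vc0.
have en : nonvanishing n (e ^+ n).
  have := nonvanishingX n (generator_nonvanishing eg).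
  by rewrite muln1.
have := nonvanishing_scale0 en vc0.
elim: m {vc0} => [|m IH]; first by rewrite mul1r => ->; rewrite scale0r.
by rewrite exprS -mulrA => /(line_coord_regular hX Zline); exact: IH.
Qed.

Lemma line_scale_H0 n m g : H0 Q n g -> H0 Q n (fun z => v z ^+ m *: g z).
Proof.
move=> gH z; have [gr gh] := gH z; split; last exact: homogZ.
apply: (lregZ (a := fun z => v z ^+ m)) => //.
elim: m => [|m IH]; first exact: reg1.
rewrite (_ : (fun z => _) = fun z => v z * v z ^+ m); last first.
  by apply: functional_extensionality_dep => y; rewrite exprS.
by apply: regM => //; exact: (proj1 Zline).
Qed.

Lemma line_sum_H0 n (a : nat -> germs L) m : (forall k, H0 L n (a k)) ->
  H0 Q n (fun z => \sum_(0 <= k < m) v z ^+ k *: phat (a k) z).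
Proof.
move=> aH; elim: m => [|m IH].
  rewrite (_ : (fun z => _) = (0 : germs Q)); first exact: H0_0.
  by apply: functional_extensionality_dep => z; rewrite big_nil.
rewrite (_ : (fun z => _) = ((fun z => \sum_(0 <= k < m) v z ^+ k *: phat (a k) z) : germs Q)
    + (fun z => v z ^+ m *: phat (a m) z)); last first.
  by apply: functional_extensionality_dep => z; rewrite big_nat_recr.
apply: H0D => //; exact: line_scale_H0 (lpull_H0 phi (aH m)).
Qed.

(** A polynomial in v of degree below m that is divisible by v^m is zero: its constant term vanishes
    on {v = 0}, and one divides by the nonzerodivisor v. *)
Lemma line_coeffs0 n (a : nat -> germs L) (g : germs Q) m : (forall k, H0 L n (a k)) ->
  H0 Q n g ->
  (forall z, \sum_(0 <= k < m) v z ^+ k *: phat (a k) z = v z ^+ m *: g z) ->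
  forall k, (k < m)%N -> a k = 0.
Proof.
elim: m a => [//|m IH] a aH gH E; 
have shift z : \sum_(0 <= k < m.+1) v z ^+ k *: phat (a k) z =
    phat (a 0%N) z + v z *: \sum_(0 <= k < m) v z ^+ k *: phat (a k.+1) z.
  rewrite big_nat_recl // scale1r scaler_sumr; congr (_ + _).
  by apply: eq_bigr => k _; rewrite scalerA exprS.
have vmH k := line_scale_H0 k gH.
have a0 : a 0%N = 0.
  have gH' := H0B (vmH m) (line_sum_H0 m (fun k => aH k.+1)).
  apply: (line_constant_term hX Zline (phi := phi) (aH 0%N) gH') => z.
  rewrite -[X in _ *: X]/(v z ^+ m *: g z -
    \sum_(0 <= k < m) v z ^+ k *: phat (a k.+1) z).
  by rewrite scalerBr scalerA -exprS -E shift addrK.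
case=> [//|k km]; apply: (IH (fun k => a k.+1)) => // z.
apply/eqP; rewrite -subr_eq0; apply/eqP.
have [_ h1] := line_sum_H0 m (fun k => aH k.+1) z; have [_ h2] := vmH m z.
apply: (line_regular (m := 1) (homogB h1 h2)).
rewrite expr1 scalerBr scalerA -exprS -E shift a0 lpull0.
by rewrite -[X in _ - (X + _)]/(0 : alg Q z) add0r subrr.
Qed.

(** The terms of degree below m form a multiple of v^m, so they vanish, and the nonzerodivisor v^m
    cancels. *)
Lemma line_coeffs n (a : nat -> germs L) (g : germs Q) m K : (forall k, H0 L n (a k)) ->
  H0 Q n g ->
  (forall z, v z ^+ m *: g z = \sum_(0 <= k < m + K) v z ^+ k *: phat (a k) z) ->
  forall z, g z = \sum_(0 <= k < K) v z ^+ k *: phat (a (m + k)%N) z.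
Proof.
move=> aH gH E.
have E' z : \sum_(0 <= k < m + K) v z ^+ k *: phat (a k) z =
    \sum_(0 <= k < m) v z ^+ k *: phat (a k) z +
    v z ^+ m *: \sum_(0 <= k < K) v z ^+ k *: phat (a (m + k)%N) z.
  rewrite (big_cat_nat (n := m)) ?leq_addr //=; congr (_ + _).
  rewrite -{1}[m]add0n big_addn addKn scaler_sumr; apply: eq_bigr => k _.
  by rewrite scalerA -exprD addnC.
have dH := H0B gH (line_sum_H0 K (fun k => aH (m + k)%N)).
have a0 := line_coeffs0 (m := m) aH dH.
move=> z; apply/eqP; rewrite -subr_eq0; apply/eqP.
have [_ dh] := dH z; apply: (line_regular (m := m) dh).
rewrite -[X in _ *: X]/(g z - _) scalerBr E E' addrK big_nat big1 // => k /andP[_ km].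
rewrite a0 //; first by rewrite lpull0; exact: scaler0.
move=> y; rewrite -[X in _ = _ *: X]/(g y - _).
by rewrite scalerBr E E' addrK.
Qed.
End LineCoefficients.

Section WeightParts.
Variables (A : comNzRingType) (X Y : lrs A) (i : mor Y X) (L : line_bundle X).
Variables (N M : nat) (s : 'I_N.+1 -> germs L) (t : 'I_M -> germs L).
Hypothesis Apid : principal_ideals A.
Hypothesis hX : scheme X.
Hypothesis hs : induces_closed_immersion s.
Hypothesis ht : generates_ideal i t.
Variable D : deformation i s t.
Local Notation R := (rees i L).
Local Notation v := (U0v D).
Local Notation th := (U1th D).
Local Notation phat := (lpull (U0pL D)).
Local Notation cd := (@proj_coord A X Y i L N M s t D).
Variables (J0 : lbmor (j0 D) (U0L D) (L' D)) (J1 : lbmor (j1 D) (U1O D) (L' D)).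
Hypothesis J0t : forall k z, lpull J0 (wt k) z = lpull (j0L D) (cd k) z.
Hypothesis J0u : forall k z, lpull J0 (wu k) z = v z *: lpull (j0L D) (cd k) z.
Hypothesis J1u : forall k z, lpull J1 (wu k) z = th (gen i s t k) z.

(* E_(l,n): on X x Spec A[v] these are the sections v^(n+l) a with a in the degree n part
   of I^l; over Proj S' they become a tau^(-l). *)
Definition weight_part (n : nat) (l : int) : set (germs (L' D)) :=
  [set e | H0 (L' D) n e /\ exists2 a, ideal_powz i l n a &
    forall z, lpull J0 e z = v z ^+ absz (n%:Z + l) *: phat a z].

Lemma lpull_J0_eq n (e e' : germs (L' D)) : H0 (L' D) n e -> H0 (L' D) n e' ->
  (forall z, lpull J0 e z = lpull J0 e' z) -> e = e'.
Proof.
move=> eH e'H ee'; apply: (deformation_H0_eq Apid hX hs ht eH e'H) => z.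
apply: (lbfun_homog_inj (n := n) (phi := J0) (open_comor_inj (j0_open D) (x := z))) (ee' z).
- by case: (eH (j0 D z)).
- by case: (e'H (j0 D z)).
Qed.

(** The two charts have different stalks, so compatibility is tested on any family e on D that has
    the germs of u1. *)
Lemma glue_sections n (u0 : germs (U0L D)) (u1 : germs (U1O D)) :
  H0 (U0L D) n u0 -> H0 (U1O D) n u1 ->
  (forall z z1, j0 D z = j1 D z1 -> forall e : germs (L' D), (forall d, homog n (e d)) ->
    lpull J1 e z1 = u1 z1 -> lpull J0 e z = u0 z) ->
  exists e, [/\ H0 (L' D) n e, lpull J0 e = u0 & lpull J1 e = u1].
Proof.
move=> u0H u1H compat.
have [e0 e0h e0E] := extend_germs (j0_open D) J0 (fun z => proj2 (u0H z)).
have [e1 e1h e1E] := extend_germs (j1_open D) J1 (fun z => proj2 (u1H z)).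
pose e : germs (L' D) := fun d => if pselect (range (j0 D) d) then e0 d else e1 d.
have eh d : homog n (e d) by rewrite /e; case: pselect.
have ee0 z : e (j0 D z) = e0 (j0 D z) by rewrite /e; case: pselect => // -[]; exists z.
have ee1 z1 : e (j1 D z1) = e1 (j1 D z1).
  case: (pselect (range (j0 D) (j1 D z1))) => [[z _ zz1]|nr]; last by rewrite /e; case: pselect.
  suff: e (j0 D z) = e1 (j0 D z) by rewrite zz1.
  rewrite ee0.
  apply: (lbfun_homog_inj (n := n) (phi := J0) (open_comor_inj (j0_open D) (x := z))) => //.
  rewrite -[LHS]/(lpull J0 e0 z) -[RHS]/(lpull J0 e1 z) e0E.
  by rewrite (compat _ _ zz1 e1 e1h) // e1E.
have J0e : lpull J0 e = u0.
  by rewrite -e0E; apply: functional_extensionality_dep => z; rewrite /lpull ee0.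
have J1e : lpull J1 e = u1.
  by rewrite -e1E; apply: functional_extensionality_dep => z; rewrite /lpull ee1.
exists e; split=> // d; split=> //.
case: (Defs.cover d) => -[z _ <-].
- by apply: (lpull_lreg_open (phi := J0) (j0_open D)) => //; rewrite J0e; case: (u0H z).
- by apply: (lpull_lreg_open (phi := J1) (j1_open D)) => //; rewrite J1e; case: (u1H z).
Qed.

Lemma zpow_mul z (v' : stalk (U0 D) z) n l : v z * v' = 1 -> - n%:Z <= l ->
  v z ^+ n * zpow v' l = v z ^+ absz (n%:Z + l).
Proof.
move=> vv'; case: l => l nl; first by rewrite -PoszD /= exprD.
have /subnKC <- : (l.+1 <= n)%N by lia.
rewrite NegzE PoszD addrAC subrr add0r absz_nat -[zpow _ _]/(v' ^+ l.+1).
by rewrite exprD mulrAC -exprMn vv' expr1n mul1r.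
Qed.

(** v^(n+l) a and a tau^(-l) are glued: on the overlap, [overlap_eval] multiplies v^l a by v^n. *)
Lemma weight_part_exists n l a : - n%:Z <= l -> ideal_powz i l n a ->
  exists e, [/\ H0 (L' D) n e,
    forall z, lpull J0 e z = v z ^+ absz (n%:Z + l) *: phat a z &
    lpull J1 e = th (mono l a)].
Proof.
move=> nl aI; have aH := ideal_powz_H0 aI; have ad := gdeg_mono aI.
have u0H := line_scale_H0 (U0_line D) (absz (n%:Z + l)) (lpull_H0 (U0pL D) aH).
have [z z1 zz1 e eh eE|e [eH eE0 eE1]] := glue_sections u0H (proj_sec (U1_proj D) ad).
  have [v' vv'] : is_unit (v z) by apply/overlap0; exists z1.
  rewrite (overlap_eval Apid hX hs ht J0u J1u vv' zz1 ad (eh _) eE) lev_mono.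
  by rewrite scalerA zpow_mul.
by exists e; split=> // z; rewrite eE0.
Qed.

Lemma weight_part_submodule n l : submodule (weight_part n l).
Proof.
split=> [|a e e' [eH [g gI eE]] [e'H [g' g'I e'E]]].
  split; first exact: H0_0.
  exists 0; first exact: (proj1 (ideal_powz_submodule i L l n)).
  by move=> z; rewrite !lpull0; exact/esym/scaler0.
split; first exact: (proj2 (H0_submodule _ _)).
exists (a *: g + g'); first exact: (proj2 (ideal_powz_submodule i L l n)).
move=> z; rewrite !lpullD !lpullZ.
rewrite -[LHS]/(a%:A *: lpull J0 e z + lpull J0 e' z) eE e'E.
rewrite -[X in _ = _ *: X]/(a%:A *: phat g z + phat g' z).
by rewrite scalerDr !scalerA mulrC.
Qed.

Lemma weight_part_top n : weight_part n (n%:Z + 1) = [set 0].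
Proof.
apply/seteqP; split=> [e [eH [a aI eE]]|e ->] /=; last exact: (proj1 (weight_part_submodule _ _)).
apply: (lpull_J0_eq eH (H0_0 _ _)) => z; rewrite eE.
rewrite (ideal_pow_gt ht (l := n + 1) _ aI) ?addn1 // !lpull0.
exact: scaler0.
Qed.

Lemma weight_parts_free n (e : 'I_n.*2.+1 -> germs (L' D)) :
  (forall k : 'I_n.*2.+1, weight_part n (k%:Z - n%:Z) (e k)) ->
  \sum_k e k = 0 -> forall k, e k = 0.
Proof.
move=> eW e0.
(* The index k stands for n + l. Coefficients are extended by 0 beyond 2n, as [line_coeffs0] takes a
   family over all naturals. *)
have /choice[a aP] : forall k, exists a, H0 L n a /\ forall (kn : (k < n.*2.+1)%N) z,
    lpull J0 (e (Ordinal kn)) z = v z ^+ k *: phat a z.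
  move=> k; case: (pselect (k < n.*2.+1)%N) => [kn|kn]; last first.
    by exists 0; split=> [|/kn//]; exact: H0_0.
  have [_ [a aI aE]] := eW (Ordinal kn).
  exists a; split; first exact: ideal_powz_H0 aI.
  by move=> kn' z; rewrite (bool_irrelevance kn' kn) aE addrC subrK.
have a0 := @line_coeffs0 _ _ _ _ _ hX (U0_line D) _ _ (U0pL D) n a 0 n.*2.+1
  (fun k => proj1 (aP k)) (H0_0 _ _) _.
move=> [k kn]; have [eH _] := eW (Ordinal kn).
apply: (lpull_J0_eq eH (H0_0 _ _)) => z; rewrite (proj2 (aP k) kn) a0 //.
  by rewrite !lpull0; exact: scaler0.
move=> {z}z; transitivity (lpull J0 (\sum_k e k) z).
  rewrite lpull_sum germs_sum big_mkord; apply: eq_bigr => -[q qn] _.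
  by rewrite (proj2 (aP q) qn).
by rewrite e0 lpull0; exact/esym/scaler0.
Qed.

Lemma weight_parts_span : exists n0, forall n, (n0 <= n)%N -> forall r, H0 (L' D) n r ->
  exists e : 'I_n.*2.+1 -> germs (L' D),
    (forall k : 'I_n.*2.+1, weight_part n (k%:Z - n%:Z) (e k)) /\ r = \sum_k e k.
Proof.
have Rax := rees_axioms i L.
have [|||||||||||n0 n0P] := @rees_sections A X Y i L N M s t Apid hX hs ht D (U1 D) (U1O D) id
  th (fun n => [set 0]).
- by rewrite image_id; exact: closedT.
- by move=> x V xV; exists V.
- by move=> n a na; exact: (proj_sec (U1_proj D) na).
- by move=> n a c na nc; exact: (projD (U1_proj D) na nc).
- by move=> n m a c na nc; exact: (projM (U1_proj D) na nc).
- by [].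
- exact: proj_frac (U1_proj D).
- split=> [n _ ->|//|n _ _ -> ->|n m _ b mb ->] /=.
  + exact: (gdeg0 Rax).
  + by rewrite addr0.
  + exact: (gmul0 Rax mb).
- by move=> _ _ ->; exact: th0.
- move=> n a z na a0; have [m [b [mb bn ba]]] := proj_zero (U1_proj D) na a0.
  by exists m, b.
- by move=> z; left; exists z.
exists n0 => n nn0 r rH.
have [p [pfin pI] pr] := proj1 (n0P n nn0) _ (lpull_H0 J1 rH).
(* B bounds the powers of tau occurring in p, so that v^B p has no negative power of v. As r carries
   a factor v^n on the overlap, multiplication by v^(B-n) suffices, hence B >= n. *)
have [B [nB pB]] : exists B : nat, (n <= B)%N /\ forall k : int, k < - B%:Z -> p k = 0.
  have [l _ lP] := finite_support_seq pfin.
  exists (maxn n (\max_(k <- l) absz k)); split=> [|k kB]; first exact: leq_maxl.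
  apply: lP; apply/negP => kl.
  have := @leq_bigmax_seq _ l xpredT absz k kl isT.
  by move: kB; set m := \max_(_ <- _) _; lia.
(* The coefficient of v^k, with k = B + l. Components with l > n vanish, which leaves the B - n +
   (2n + 1) terms below. *)
pose a k := p (k%:Z - B%:Z).
have aH k : H0 L n (a k) by exact: ideal_powz_H0 (pI _).
have E z : v z ^+ (B - n) *: lpull J0 r z =
    \sum_(0 <= k < B - n + n.*2.+1) v z ^+ k *: phat (a k) z.
  have [d dH dE] : exists2 d : germs (U0L D), H0 (U0L D) n d & forall y, d y =
      v y ^+ (B - n) *: lpull J0 r y - \sum_(0 <= k < B - n + n.*2.+1) v y ^+ k *: phat (a k) y.
    by eexists; first exact: H0B (line_scale_H0 (U0_line D) (B - n) (lpull_H0 J0 rH))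
      (line_sum_H0 (U0_line D) (U0pL D) (B - n + n.*2.+1) aH).
  apply/eqP; rewrite -subr_eq0 -dE (line_dense hX (U0_line D) dH) //.
  move=> {}z vu; have [v' vv'] := vu; have [z1 _ zz1] := proj2 (overlap0 z) vu.
  have [_ rh] := rH (j0 D z); rewrite dE.
  rewrite (overlap_eval Apid hX hs ht J0u J1u vv' (esym zz1) (conj pfin pI) rh); last first.
    by rewrite pr.
  rewrite (@lev_seq _ _ _ _ _ _ _ _ _ _ _ _ [seq k%:Z - B%:Z | k <- iota 0 (B - n + n.*2.+1)]).
  - rewrite scalerA -exprD subnK // scaler_sumr big_map /index_iota subn0.
    rewrite -sumrB big1_seq // => k _; rewrite scalerA zpow_mul //; last by lia.
    by rewrite addrCA subrr addr0 absz_nat subrr.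
  - by rewrite map_inj_uniq ?iota_uniq // => x y; lia.
  - move=> k kl; case: (ltrP k (- B%:Z)) => kB; first exact: pB.
    case: (lerP k n%:Z) => kn.
      case/negP: kl; apply/mapP; exists (absz (k + B%:Z)); last by lia.
      by rewrite mem_iota; lia.
    case: k kn {kl kB} (pI k) => // k kn kI.
    exact: (ideal_pow_gt ht _ kI).
(* The left side is divisible by v^(B-n), so the terms with l < -n drop out, and k now stands for n
   + l. *)
have {}E := line_coeffs hX (U0_line D) aH (lpull_H0 J0 rH) E.
have /choice[e eP] : forall k : 'I_n.*2.+1, exists e, H0 (L' D) n e /\
    forall z, lpull J0 e z = v z ^+ absz (n%:Z + (k%:Z - n%:Z)) *: phat (p (k%:Z - n%:Z)) z.
  move=> k; have [|e [eH eE _]] := weight_part_exists (l := k%:Z - n%:Z) _ (pI _).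
    by lia.
  by exists e.
exists e; split.
  by move=> k; have [eH eE] := eP k; split=> //; exists (p (k%:Z - n%:Z)).
apply: (lpull_J0_eq rH).
  by apply: (submodule_sum _ (H0_submodule _ _)) => k _; case: (eP k).
move=> z; rewrite E lpull_sum germs_sum big_mkord; apply: eq_bigr => k _.
rewrite (proj2 (eP k)) addrC subrK /a; congr (_ *: phat (p _) z); lia.
Qed.

Lemma weight_parts_direct_sum : exists n0, forall n, (n0 <= n)%N ->
  direct_sum (fun k : 'I_(n.*2.+1) => weight_part n (k%:Z - n%:Z)) (H0 (L' D) n).
Proof.
have [n0 n0P] := weight_parts_span; exists n0 => n nn0; apply: direct_sumI.
- by move=> k; exact: weight_part_submodule.
- by move=> k e [].
- exact: n0P.
- exact: weight_parts_free.
Qed.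
End WeightParts.

(** * Restriction to the fibre over 1 *)

Section FibreOne.
Variables (A : comNzRingType) (X Y : lrs A) (i : mor Y X) (L : line_bundle X).
Variables (N M : nat) (s : 'I_N.+1 -> germs L) (t : 'I_M -> germs L).
Hypothesis hs : induces_closed_immersion s.
Variable D : deformation i s t.
Local Notation v := (U0v D).
Local Notation phat := (lpull (U0pL D)).
Variable J0 : lbmor (j0 D) (U0L D) (L' D).
Hypothesis J0t : forall k z, lpull J0 (wt k) z = lpull (j0L D) (proj_coord k) z.
Variable D1 : fibre_one D.

Lemma section_ratio k n a : H0 L n a -> exists b : functions X, forall x,
  nonvanishing 1 (gen_sec s t k x) -> a x = b x *: gen_sec s t k x ^+ n.
Proof.
move=> aH; apply: (@dep_choice _ (fun x => stalk X x) (fun x c =>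
  nonvanishing 1 (gen_sec s t k x) -> a x = c *: gen_sec s t k x ^+ n)) => x.
case: (pselect (nonvanishing 1 (gen_sec s t k x))) => [kn|]; last by exists 0.
have [c cE] : exists c, a x = c *: gen_sec s t k x ^+ n.
  apply: (nonvanishing_fraction (n := n)); last by case: (aH x).
  by have := nonvanishingX n kn; rewrite muln1.
by exists c.
Qed.

(** The section sigma sends v to 1 and hence v^m a to a. The pullback by [J0] and [oneL] are
    distinct data that agree on the s_j (x) t, so the computation is made on coefficients relative
    to these. *)
Lemma restriction_one n m (e : germs (L' D)) a : H0 (L' D) n e -> H0 L n a ->
  (forall z, lpull J0 e z = v z ^+ m *: phat a z) -> lpull (oneL D1) e = a.
Proof.
move=> eH aH E; apply: functional_extensionality_dep => x.
pose z : U0 D := sigma D1 x.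
have pz : U0p D z = x := proj1 (sigma_section D1) x.
have [j jn] := closed_immersion_cover hs x.
(* Stated for every y equal to x, since the projection of z is x only up to a proved equality. *)
have kn : forall y, y = x -> nonvanishing 1 (gen_sec s t j y).
  by move=> _ ->; rewrite /gen_sec ltn_ord nat_familyE.
have [b bE] := section_ratio j aH.
have tE : lpull J0 (wt j) z = phat (gen_sec s t j) z.
  by rewrite J0t j0L_coord /gen_exp ltn_ord expr0 scale1r.
have zn : nonvanishing 1 (phat (gen_sec s t j) z) by apply: lbfun_nonvanishing; exact: kn.
have wn : nonvanishing 1 (wt (D := D) j (j0 D z)).
  apply: (lbfun_nonvanishingE (phi := J0)); first by case: (wt_H0 (D := D) j (j0 D z)).
  by rewrite -[lbfun _ _ _]/(lpull J0 (wt j) z) tE.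
have [c cE] : exists c, e (j0 D z) = c *: wt (D := D) j (j0 D z) ^+ n.
  apply: (nonvanishing_fraction (n := n)); last by case: (eH (j0 D z)).
  by have := nonvanishingX n wn; rewrite muln1.
have cb : comor (j0 D) z c = v z ^+ m * comor (U0p D) z (b (U0p D z)).
  have zn' : nonvanishing n (phat (gen_sec s t j) z ^+ n).
    by have := nonvanishingX n zn; rewrite muln1.
  apply: (nonvanishing_scale_inj zn'); rewrite -scalerA.
  have -> : comor (U0p D) z (b (U0p D z)) *: phat (gen_sec s t j) z ^+ n = phat a z.
    by rewrite /lpull (bE _ (kn _ pz)) lbfunZ rmorphXn.
  by rewrite -E /lpull cE lbfunZ rmorphXn -[lbfun J0 z _]/(lpull J0 (wt j) z) tE.
have sE : lpull (oneL D1) (wt j) x = gen_sec s t j x.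
  rewrite /gen_sec ltn_ord nat_familyE.
  have /(congr1 (fun g : germs L => g x)) <- := oneLE D1 j.
  rewrite /wt (_ : proj_coord j = sx D j) //.
  by rewrite /proj_coord ltn_ord nat_familyE.
rewrite (bE x (kn _ erefl)) /lpull.
rewrite -[X in X = _]/(lbfun (oneL D1) x (e (j0 D z))) cE lbfunZ rmorphXn.
rewrite -[lbfun _ _ (wt j _)]/(lpull (oneL D1) (wt j) x) sE; congr (_ *: _).
have -> : comor (comp_mor (j0 D) (sigma D1)) x c = comor (sigma D1) x (comor (j0 D) z c) by [].
have one u w : comor (sigma D1) x u = 1 ->
    comor (sigma D1) x (u ^+ m * w) = comor (sigma D1) x w.
  by move=> u1; rewrite rmorphM rmorphXn /= u1 expr1n mul1r.
rewrite cb one; last exact: (congr1 (fun g : functions X => g x) (sigma_one D1)).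
by have /(congr1 (fun g : functions X => g x)) := proj2 (sigma_section D1) b.
Qed.
End FibreOne.

(** * Weights of the transverse action *)

Section Weights.
Variables (A : comNzRingType) (X Y : lrs A) (i : mor Y X) (L : line_bundle X).
Variables (N M : nat) (s : 'I_N.+1 -> germs L) (t : 'I_M -> germs L).
Hypothesis Apid : principal_ideals A.
Hypothesis hX : scheme X.
Hypothesis hs : induces_closed_immersion s.
Hypothesis ht : generates_ideal i t.
Variable D : deformation i s t.
Local Notation v := (U0v D).
Local Notation phat := (lpull (U0pL D)).
Variable J0 : lbmor (j0 D) (U0L D) (L' D).
Hypothesis J0t : forall k z, lpull J0 (wt k) z = lpull (j0L D) (proj_coord k) z.
Hypothesis J0u : forall k z, lpull J0 (wu k) z = v z *: lpull (j0L D) (proj_coord k) z.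
Variable G : transverse_action D.
Local Notation lam := (GDlam G).
Local Notation weight m e := (has_weight lam (GDprL G) (actL G) m e).

Lemma weight_wt k : (k < N.+1)%N -> weight 0 (wt k).
Proof.
move=> kN w; rewrite scale1r.
have := act_xt G (Ordinal kN) => /(congr1 (fun g : germs (GDL G) => g w)).
by rewrite /wt /proj_coord kN (nat_familyE _ (Ordinal kN)).
Qed.

Lemma weight_wu k : (k < N.+1)%N -> weight 1 (wu k).
Proof.
move=> kN w; rewrite expr1.
have := act_xu G (Ordinal kN) => /(congr1 (fun g : germs (GDL G) => g w)).
by rewrite /wu /proj_coord kN (nat_familyE _ (Ordinal kN)).
Qed.

Lemma weightM m m' e e' : weight m e -> weight m' e' -> weight (m + m') (e * e').
Proof.
move=> em e'm w; rewrite !lpullM -[LHS]/(lpull (actL G) e w * lpull (actL G) e' w) em e'm.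
by rewrite -scalerAl -scalerAr scalerA -exprD.
Qed.

(** A monomial of degree q in the s_k lifts to a product of sections s_k (x) t and s_k (x) u;
    choosing u in m of the q factors yields both the power v^m and the weight m. *)
Lemma polynomial_section q g : sect_span s q g -> forall m, (m <= q)%N -> exists e,
  [/\ H0 (L' D) q e, forall z, lpull J0 e z = v z ^+ m *: phat g z & weight m e].
Proof.
elim=> {q g} [q||q a u w uS IHu wS IHw|q k u kN uS IH|//] m mq.
- exists 0; split; first exact: H0_0.
    by move=> z; rewrite !lpull0; exact/esym/scaler0.
  by move=> w; rewrite !lpull0; exact/esym/scaler0.
- move: mq; rewrite leqn0 => /eqP ->; exists 1; split; first exact: H0_1.
    by move=> z; rewrite !lpull1 expr0 scale1r.
  by move=> w; rewrite !lpull1 expr0 scale1r.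
- have [e [eH eE ew]] := IHu m mq; have [f [fH fE fw]] := IHw m mq.
  exists (a *: e + f); split; first exact: (proj2 (H0_submodule _ _)).
    move=> z; rewrite !lpullD !lpullZ.
    rewrite -[LHS]/(a%:A *: lpull J0 e z + lpull J0 f z) eE fE.
    rewrite -[X in _ = _ *: X]/(a%:A *: phat u z + phat w z).
    by rewrite scalerDr !scalerA mulrC.
  move=> z; rewrite !lpullD !lpullZ.
  rewrite -[LHS]/(a%:A *: lpull (actL G) e z + lpull (actL G) f z) ew fw.
  rewrite -[X in _ = _ *: X]/(a%:A *: lpull (GDprL G) e z + lpull (GDprL G) f z).
  by rewrite scalerDr !scalerA mulrC.
have cE z : lpull (j0L D) (proj_coord k) z = phat (nat_family s k) z.
  by rewrite j0L_coord /gen_exp /gen_sec kN expr0 scale1r.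
case: (leqP m q) => [mq'|qm].
- have [e [eH eE ew]] := IH m mq'; exists (wt k * e); split.
  + by rewrite -add1n; apply: H0M => //; exact: wt_H0.
  + move=> z; rewrite !lpullM -[LHS]/(lpull J0 (wt k) z * lpull J0 e z) J0t eE cE.
    by rewrite -scalerAr.
  + by have := weightM (weight_wt kN) ew.
- have -> : m = q.+1 by apply/eqP; rewrite eqn_leq mq.
  have [e [eH eE ew]] := IH q (leqnn q); exists (wu k * e); split.
  + by rewrite -add1n; apply: H0M => //; exact: wu_H0.
  + move=> z; rewrite !lpullM -[LHS]/(lpull J0 (wu k) z * lpull J0 e z) J0u eE cE.
    by rewrite -scalerAr -scalerAl scalerA -exprSr.
  + by have := weightM (weight_wu kN) ew.
Qed.

(* The action is only prescribed on generating sections of L'.  Multiplication by a power of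
   s_k (x) t, which is invariant, turns e into a polynomial in these sections. *)
Lemma weight_over_U0 n m a e w : (m <= n.*2)%N -> H0 L n a -> H0 (L' D) n e ->
  (forall z, lpull J0 e z = v z ^+ m *: phat a z) -> range (j0 D) (GDpr G w) ->
  lpull (actL G) e w = lam w ^+ m *: lpull (GDprL G) e w.
Proof.
move=> mn aH eH eE [z _ zw]; have [n0 n0P] := sections_span Apid hX hs.
have [k [kN _ _ kn]] := coord_U0 hs z; rewrite zw in kn.
(* K >= n0 puts degree K + n in the range where monomials span, and K >= n gives m <= 2n <= K + n,
   as [polynomial_section] requires. *)
pose K := maxn n0 n.
have sH : H0 L (K + n) (nat_family s k ^+ K * a).
  apply: H0M => //; rewrite -{1}[K]muln1; apply: H0X.
  by rewrite (nat_familyE _ (Ordinal kN)); exact: s_H0.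
have [||f [fH fE fw]] := polynomial_section (n0P _ _ _ sH) (m := m).
- by rewrite (leq_trans (leq_maxl n0 n)) ?leq_addr.
- by rewrite (leq_trans mn) // -addnn leq_add2r leq_maxr.
have fE' : wt k ^+ K * e = f.
  apply: (lpull_J0_eq Apid hX hs ht (J0 := J0) _ fH).
    by apply: H0M => //; rewrite -{1}[K]muln1; apply: H0X; exact: wt_H0.
  move=> y; rewrite fE !lpullM !lpullX.
  rewrite -[LHS]/((lpull J0 (wt k) ^+ K) y * lpull J0 e y) germsX J0t eE.
  rewrite -[X in _ = _ *: X]/((phat (nat_family s k) ^+ K) y * phat a y) germsX.
  by rewrite j0L_coord /gen_exp /gen_sec kN expr0 scale1r -scalerAr.
have {}kn := lbfun_nonvanishing (GDprL G) kn.
have knK : nonvanishing K (lpull (GDprL G) (wt k) w ^+ K).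
  by have := nonvanishingX K kn; rewrite muln1.
apply/eqP; rewrite -subr_eq0; apply/eqP.
apply: (nonvanishing_mul0 (m := n) knK).
  apply: homogB; last apply: homogZ.
    by case: (lpull_H0 (actL G) eH w).
  by case: (lpull_H0 (GDprL G) eH w).
have := fw w; rewrite -fE' !lpullM !lpullX.
rewrite -[LHS]/((lpull (actL G) (wt k) ^+ K) w * lpull (actL G) e w) germsX.
rewrite (weight_wt kN w) expr0 scale1r => E; rewrite mulrBr E.
rewrite -[X in _ *: X - _]/((lpull (GDprL G) (wt k) ^+ K) w * lpull (GDprL G) e w) germsX.
by rewrite -scalerAr subrr.
Qed.

(** The identity known over X x Spec A[v] extends by density: [tau'] remains a nonzerodivisor as a
    constant polynomial in the coordinate of G_m. *)
Lemma weight_part_weight n l e : (- n%:Z <= l <= n%:Z) -> weight_part J0 n l e ->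
  weight (absz (n%:Z + l)) e.
Proof.
move=> /andP[nl ln] [eH [a aI eE]] w; have aH := ideal_powz_H0 aI.
set m := absz _ in eE *; have mn : (m <= n.*2)%N by lia.
have onU0 := weight_over_U0 mn aH eH eE.
case: (Defs.cover (GDpr G w)) => [|[z _ zw]]; first exact: onU0.
have [U [B [th' [tau' [Us Uz treg tU]]]]] := chart_at Apid hX hs ht z.
rewrite zw in Uz; have Gs := proj2 (GD_prod G) U B th' Us.
have [d [dr dh dE]] : exists d : germs (GDL G), [/\ lreg d w, homog n (d w) &
    forall y, d y = lpull (actL G) e y - lam y ^+ m *: lpull (GDprL G) e y].
  have [r1 h1] := lpull_H0 (actL G) eH w; have [r2 h2] := lpull_H0 (GDprL G) eH w.
  exists (fun y => lpull (actL G) e y - lam y ^+ m *: lpull (GDprL G) e y); split=> //.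
    apply: lreg_sub => //; apply: (lregZ (a := fun y => lam y ^+ m)) => //.
    elim: m {eE mn onU0} => [|m IH]; first exact: reg1.
    rewrite (_ : (fun y => _) = fun y => lam y * lam y ^+ m); last first.
      by apply: functional_extensionality_dep => y; rewrite exprS.
    by apply: regM => //; exact: (proj1 (GD_prod G)).
  by apply: homogB => //; exact: homogZ.
apply/eqP; rewrite -subr_eq0 -dE; apply/eqP.
apply: (spec_dense Gs (g := tau'%:P) _ Uz dr dh) => [r tr|].
  apply/polyP => k; rewrite coef0; apply: treg.
  by have /(congr1 (fun q : {poly B} => q`_k)) := tr; rewrite coefCM coef0.
apply: filterE => y Uy tu; rewrite dE onU0 ?subrr //.
apply: (tU _ Uy); apply: (comor_local (m := GDpr G)); move: tu.
rewrite size_polyC; case: eqP => [->|_] /=.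
  by rewrite big_ord0 (spec0 Us Uy) rmorph0.
by rewrite big_ord_recl big_ord0 addr0 expr0 mulr1 coefC.
Qed.
End Weights.

(** * The fibre at infinity *)

Section AlgebraMorphisms.
Variables (A : comNzRingType) (U V : comAlgType A) (f : U -> V).
Hypothesis fB : zmod_morphism f.
Hypothesis fM : monoid_morphism f.
Hypothesis fZ : scalable f.

Definition algebra_map (u : U) : V := f u.

HB.instance Definition _ := GRing.isZmodMorphism.Build U V algebra_map fB.
HB.instance Definition _ := GRing.isMonoidMorphism.Build U V algebra_map fM.
HB.instance Definition _ := GRing.isScalable.Build A U V *:%R algebra_map fZ.

Definition algebra_lrmorphism : {lrmorphism U -> V} := algebra_map.
End AlgebraMorphisms.

Section ClosedImmersionFactor.
Variables (A : comNzRingType) (Z V W : lrs A) (k : mor V W) (h : mor Z W).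
Hypothesis k_closed : closed_immersion k.
Hypothesis h_range : forall z, range k (h z).
Hypothesis h_kernel : forall z y (c : functions W), k y = h z ->
  comor k y (c (k y)) = 0 -> comor h z (c (h z)) = 0.

(** The comorphisms of k are surjective and their kernels are killed by those of h, so a germ at g z
    is sent to the image under h of any lift. *)
Lemma closed_immersion_factor : exists g : mor Z V, mor_eq (comp_mor k g) h.
Proof.
have [_ _ k_nbhs k_surj] := k_closed.
have /choice[g gE] : forall z, exists y, k y = h z.
  by move=> z; have [y _ yE] := h_range z; exists y.
(* Stalks depend on the base point, so elements of the stalk at k (g z) = h z are handled
   as values of families of germs. *)
have compat z (c c' : functions W) : comor k (g z) (c (k (g z))) = comor k (g z) (c' (k (g z))) ->
    comor h z (c (h z)) = comor h z (c' (h z)).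
  move=> cc'; apply/eqP; rewrite -subr_eq0 -rmorphB; apply/eqP.
  apply: (h_kernel (c := fun d => c d - c' d) (gE z)).
  by rewrite rmorphB /= cc' subrr.
have lift_exists z b : exists c : functions W, comor k (g z) (c (k (g z))) = b.
  by have [a <-] := k_surj (g z) b; have [c _ <-] := reg_exists a; exists c.
pose lift z b := projT1 (cid (lift_exists z b)).
have liftE z b : comor k (g z) (lift z b (k (g z))) = b := projT2 (cid (lift_exists z b)).
pose co z b := comor h z (lift z b (h z)).
have coE z (c : functions W) : co z (comor k (g z) (c (k (g z)))) = comor h z (c (h z)).
  by apply: compat; rewrite liftE.
have coB z : zmod_morphism (co z).
  move=> a b; rewrite -{1}(liftE z a) -{1}(liftE z b) -rmorphB.
  by rewrite (coE z (fun d => lift z a d - lift z b d)) rmorphB.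
have coM z : monoid_morphism (co z).
  split; first by have := coE z (fun=> 1); rewrite !rmorph1.
  move=> a b; rewrite -{1}(liftE z a) -{1}(liftE z b) -rmorphM.
  by rewrite (coE z (fun d => lift z a d * lift z b d)) rmorphM.
have coZ z : scalable (co z).
  move=> a b; rewrite -{1}(liftE z b) -linearZ.
  by rewrite (coE z (fun d => a *: lift z b d)) linearZ.
have g_cont : continuous g.
  move=> z S /k_nbhs[U Uz US].
  have : nbhs z (h @^-1` U) by apply: (mfun_continuous (m := h)); rewrite -gE.
  by apply: filterS => y Uy; apply: US; rewrite /preimage /= gE.
pose com z := algebra_lrmorphism (coB z) (coM z) (coZ z).
have com_reg (r : functions V) z : reg r (g z) -> reg (fun y => com y (r (g y))) z.
  move=> rr; have [a aE] := k_surj (g z) (r (g z)); have [c cr ca] := reg_exists a.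
  have cr' : reg (pull k c) (g z) by exact: comor_reg.
  have near_eq := reg_near_eq cr' rr _.
  apply: (reg_ext (reg_sheaf Z) (s := pull h c)); last first.
    by apply: comor_reg; rewrite -gE.
  have {near_eq} := near_eq _; rewrite /pull ca aE => /(_ erefl) near_eq.
  have {}near_eq : \forall y \near z, comor k (g y) (c (k (g y))) = r (g y).
    exact: (g_cont z _ near_eq).
  apply: filterS near_eq => y yE.
  by rewrite -yE -[RHS]/(co y _) coE.
have com_local z b : is_unit (com z b) -> is_unit b.
  rewrite -[com z b]/(co z b) -{1}(liftE z b) coE => /comor_local bu.
  rewrite -(liftE z b); apply: is_unit_rmorph.
  by rewrite gE.
exists (Mor g_cont com_reg com_local); split=> [z|r]; first exact: gE.
apply: functional_extensionality_dep => z.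
rewrite -[LHS]/(co z (comor k (g z) (r (k (g z))))).
exact: coE.
Qed.
End ClosedImmersionFactor.

Section CompositeLineBundleMorphism.
Variables (A : comNzRingType) (Z W V : lrs A) (g : mor W V) (f : mor Z W).
Variables (L : line_bundle Z) (P : line_bundle W) (Q : line_bundle V).
Variables (psi : lbmor g P Q) (phi : lbmor f L P).

Let cfun x : {rmorphism alg Q (comp_mor g f x) -> alg L x} :=
  [the {rmorphism _ -> _} of lbfun phi x \o lbfun psi (f x)].

Fact comp_lbfunZ x (a : stalk V (comp_mor g f x)) w :
  cfun x (a *: w) = comor (comp_mor g f) x a *: cfun x w.
Proof. by rewrite -[LHS]/(lbfun phi x (lbfun psi (f x) (a *: w))) !lbfunZ. Qed.

Fact comp_lbfun_reg (s : germs Q) x :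
  lreg s (comp_mor g f x) -> lreg (fun y => cfun y (s (comp_mor g f y))) x.
Proof. by move=> sr; apply: (lbfun_reg phi (s := lpull psi s)); exact: lbfun_reg. Qed.

Fact comp_lbfun_generator x w : generator homog w -> generator homog (cfun x w).
Proof. by move=> wg; do 2!apply: lbfun_generator. Qed.

Definition comp_lbmor : lbmor (comp_mor g f) L Q :=
  LBMor comp_lbfunZ comp_lbfun_reg comp_lbfun_generator.
End CompositeLineBundleMorphism.

(** Stated for two points so that their equality can be eliminated; scalars and a generator
    determine a morphism on the whole stalk. *)
Lemma germ_rmorph_ext (A : comNzRingType) (W : lrs A) (Q : line_bundle W)
    (S : comNzRingType) d1 d2 (phi : {rmorphism alg Q d1 -> S})
    (psi : {rmorphism alg Q d2 -> S}) (e : germs Q) : d1 = d2 ->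
  (forall c : functions W, phi (c d1)%:A = psi (c d2)%:A) ->
  generator homog (e d1) -> phi (e d1) = psi (e d2) ->
  forall r : germs Q, phi (r d1) = psi (r d2).
Proof.
move=> d12; case: d2 / d12 psi => psi cE eg eE r.
apply: (generator_rmorph_ext eg) => //; last 1 first.
- by move=> c; have [c' _ <-] := reg_exists c.
all: by rewrite ?rmorph0 // => *; rewrite ?rmorphD ?rmorphM.
Qed.

Section LineBundleFactor.
Variables (A : comNzRingType) (Z V W : lrs A) (k : mor V W) (h : mor Z W) (g : mor Z V).
Hypothesis gE : mor_eq (comp_mor k g) h.
Variables (P : line_bundle W) (Q : line_bundle V) (S : line_bundle Z).
Variables (kL : lbmor k Q P) (hL : lbmor h S P).

(** The pullback of a local generator of P by [kL] is sent to its pullback by [hL]; transition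
    coefficients match because the comorphisms compose to those of h. *)
Lemma line_bundle_factor : exists gL : lbmor g S Q,
  forall r, lpull gL (lpull kL r) = lpull hL r.
Proof.
have [gp gs] := gE.
have cE z (c : functions W) : comor g z (comor k (g z) (c (k (g z)))) = comor h z (c (h z)).
  by have /(congr1 (fun s : functions Z => s z)) := gs c.
have /choice[e eP] : forall z, exists e : germs P, lreg e (h z) /\
    \forall d \near h z, generator homog (e d).
  by move=> z; have [e er eg] := locally_trivial P (h z); exists e.
have eg z : generator homog (e z (h z)) by exact: nbhs_singleton (proj2 (eP z)).
have eg' z : generator homog (e z (k (g z))) by rewrite -[k (g z)]/(comp_mor k g z) gp.
have [|||gL gLE] := @lbmor_exists _ _ _ g S Q
    (fun z => lpull kL (e z) (g z)) (fun z => lpull hL (e z) z).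
- by move=> z; exact: lbfun_generator.
- by move=> z; exact: lbfun_generator.
- move=> z; exists (lpull kL (e z)), (lpull hL (e z)); have [er en] := eP z; split.
  + by apply: lbfun_reg; rewrite -[k (g z)]/(comp_mor k g z) gp.
  + exact: lbfun_reg.
  + exact/generator_nonvanishing/lbfun_generator.
  apply: filterS (near_pull en) => y eyg.
  have [c cP] : exists c : functions W, forall d, nonvanishing 1 (e y d) ->
      homog 1 (e z d) -> e z d = c d *: e y d.
    apply: (@dep_choice _ (fun d => stalk W d) (fun d c => nonvanishing 1 (e y d) ->
      homog 1 (e z d) -> e z d = c *: e y d)) => d.
    case: (pselect (nonvanishing 1 (e y d) /\ homog 1 (e z d))) => [[yn zh]|no].
      by have [c ->] := nonvanishing_fraction yn zh; exists c.
    by exists 0 => yn zh; case: no.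
  exists (comor k (g y) (c (k (g y)))); split.
    rewrite /lpull cP ?lbfunZ //; first exact: generator_nonvanishing.
    by rewrite -[k (g y)]/(comp_mor k g y) gp; exact: generator_homog.
  rewrite cE /lpull cP ?lbfunZ //; first exact: generator_nonvanishing.
  exact: generator_homog.
exists gL => r; apply: functional_extensionality_dep => z.
apply: (@germ_rmorph_ext A W P (alg S z) (k (g z)) (h z)
  [the {rmorphism _ -> _} of lbfun gL z \o lbfun kL (g z)] (lbfun hL z) (e z)) => //.
- exact: gp.
- move=> c; rewrite -[LHS]/(lbfun gL z (lbfun kL (g z) _)) !lbfunZ !rmorph1.
  by rewrite cE.
- exact: gLE.
Qed.
End LineBundleFactor.

(** * The induced action on the fibre at infinity *)

Section ActionAtInfinity.
Variables (A : comNzRingType) (X Y : lrs A) (i : mor Y X) (L : line_bundle X).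
Variables (N M : nat) (s : 'I_N.+1 -> germs L) (t : 'I_M -> germs L).
Hypothesis hs : induces_closed_immersion s.
Variables (D : deformation i s t) (G : transverse_action D) (Doo : fibre_infty D).
Variable H : Gm_fibre_infty G Doo.
Local Notation h := (comp_mor (act G) (GKk H)).

Lemma st_unit_U0 d : nonvanishing 1 (st D d) -> range (j0 D) d.
Proof.
case: (Defs.cover d) => [//|[z _ <-]]; have [_ [Tf [_ TfE _ ->]]] := coord_functions D => n.
apply/overlap1; rewrite -TfE; apply: is_unit_rmorph.
by apply: nonvanishing_unit n; case: (su_H0 (D := D) (j1 D z)).
Qed.

Lemma wt_scale_su k d c : st D d = c *: su D d -> wt k d = c *: wu k d.
Proof.
move=> E; rewrite /wu /wt /tsec E tmulZr //; first by case: (coord_H0 (D := D) k d).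
by case: (su_H0 (D := D) d).
Qed.

Lemma wt_st k d : nonvanishing 1 (wt (D := D) k d) -> nonvanishing 1 (st D d).
Proof.
have [c eg] := generator_at (L2 D) d.
have ch : homog 1 c by exact: generator_homog.
have [b bE] := nonvanishing_fraction (generator_nonvanishing eg) (proj2 (st_H0 (D := D) d)).
have kh : homog 1 (proj_coord (D := D) k d) by case: (coord_H0 (D := D) k d).
rewrite /wt /tsec bE tmulZr // => /nonvanishing_unit bu.
apply: nonvanishingZ; last exact: generator_nonvanishing.
by apply: bu; exact: tmul_homog.
Qed.

Lemma st_infty (z : Doo) : ~ nonvanishing 1 (st D (kinf Doo z)).
Proof. by apply/kinf_range; exists z. Qed.

Lemma su_infty d : ~ nonvanishing 1 (st D d) -> nonvanishing 1 (su D d).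
Proof. by case: (su_st_cover d). Qed.

Lemma wt_infty k : lpull (kinfL Doo) (wt k) = 0.
Proof.
apply: functional_extensionality_dep => z.
have [c cE] := nonvanishing_fraction (su_infty (st_infty (z := z)))
  (proj2 (st_H0 (D := D) (kinf Doo z))).
rewrite /lpull (wt_scale_su k cE) lbfunZ (proj2 (kinf_ideal (z := z) c)) ?scale0r //.
by exists 1, c; rewrite mul1r.
Qed.

Lemma weight_coord k : (k < N.+1 + M)%N ->
  exists m, has_weight (GDlam G) (GDprL G) (actL G) m (wt k).
Proof.
move=> kr; case: (ltnP k N.+1) => kN; first by exists 0%N; exact: weight_wt.
have kM : (k - N.+1 < M)%N by rewrite ltn_subLR.
exists 1%N => w; rewrite expr1.
have := act_yt G (Ordinal kM) => /(congr1 (fun g : germs (GDL G) => g w)).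
by rewrite /wt /proj_coord ltnNge kN /= (nat_familyE _ (Ordinal kM)).
Qed.

(** The sections s_k (x) t are invariant and have no common zero where t is invertible. If t were
    invertible at the translate, some s_k (x) t would be nonzero there, hence also at the original
    point, where t vanishes. *)
Lemma action_st w : ~ nonvanishing 1 (st D (act G (GKk H w))).
Proof.
move=> stn; have [z _ zE] := st_unit_U0 stn.
have [k [kN _ _ kn]] := coord_U0 hs z; rewrite zE in kn.
have := lbfun_nonvanishing (actL G) kn.
rewrite -[lbfun _ _ _]/(lpull (actL G) (wt k) (GKk H w)) (weight_wt kN) scale1r.
move/(lbfun_nonvanishingE (phi := GDprL G)) => /(_ _)/wt_st.
rewrite -[GDpr G (GKk H w)]/(comp_mor (GDpr G) (GKk H) w) (proj1 (GKk_pr H) w) => n.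
apply: (st_infty (z := GKpr H w)); apply: n.
by case: (wt_H0 (D := D) k (comp_mor (kinf Doo) (GKpr H) w)).
Qed.

(** Scheme-theoretic stability: with t = e u, the semi-invariant section x_k (x) t = e x_k (x) u
    restricts to 0 on the fibre, hence so does its translate. Choosing k with x_k (x) u invertible
    kills e. *)
Lemma action_kernel w y (c : functions D) : kinf Doo y = h w ->
  comor (kinf Doo) y (c (kinf Doo y)) = 0 -> comor h w (c (h w)) = 0.
Proof.
move=> yE /kinf_ideal; rewrite yE => -[b [e [stE ->]]].
suff e0 : comor h w e = 0.
  by apply: etrans (rmorphM (comor h w) b e) _; exact: etrans (congr1 _ e0) (mulr0 _).
have [k kr kn] := coord_cover (h w).
have un : nonvanishing 1 (wu k (h w)).
  by apply: tmul_nonvanishing => //; apply: su_infty; exact: action_st.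
have un' := lbfun_nonvanishing (comp_lbmor (actL G) (GKkL H)) un.
apply: (nonvanishing_scale0 un'); rewrite -lbfunZ -(wt_scale_su k stE).
have [m /(_ (GKk H w)) mE] := weight_coord kr.
rewrite -[LHS]/(lbfun (GKkL H) w (lpull (actL G) (wt k) (GKk H w))) mE lbfunZ.
rewrite -[lbfun _ _ _]/(lpull (GKkL H) (lpull (GDprL G) (wt k)) w) GKkLE wt_infty lpull0.
exact: scaler0.
Qed.

Lemma action_at_infinity : exists (actoo : mor (GK H) Doo)
    (actooL : lbmor actoo (GKL H) (Linf Doo)),
  mor_eq (comp_mor (kinf Doo) actoo) h /\
  forall r, lpull actooL (lpull (kinfL Doo) r) = lpull (GKkL H) (lpull (actL G) r).
Proof.
have h_range w : range (kinf Doo) (h w) by apply/kinf_range; exact: action_st.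
have [actoo aE] := closed_immersion_factor (kinf_closed Doo) h_range action_kernel.
have [actooL aLE] := line_bundle_factor aE (kinfL Doo) (comp_lbmor (actL G) (GKkL H)).
by exists actoo, actooL; split.
Qed.

Lemma weight_infty (actoo : mor (GK H) Doo) (actooL : lbmor actoo (GKL H) (Linf Doo)) m r :
  (forall r, lpull actooL (lpull (kinfL Doo) r) = lpull (GKkL H) (lpull (actL G) r)) ->
  has_weight (GDlam G) (GDprL G) (actL G) m r ->
  has_weight (GKlam H) (GKprL H) actooL m (lpull (kinfL Doo) r).
Proof.
move=> aE rw w; rewrite aE -GKkLE.
rewrite -[LHS]/(lbfun (GKkL H) w (lpull (actL G) r (GKk H w))) rw lbfunZ rmorphXn.
by have /(congr1 (fun g : functions (GK H) => g w)) <- := GKk_lam H.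
Qed.
End ActionAtInfinity.

(** * Sections on the fibre at infinity as classes modulo tau *)

Section SectionsAtInfinity.
Variables (A : comNzRingType) (X Y : lrs A) (i : mor Y X) (L : line_bundle X).
Variables (N M : nat) (s : 'I_N.+1 -> germs L) (t : 'I_M -> germs L).
Hypothesis Apid : principal_ideals A.
Hypothesis hX : scheme X.
Hypothesis hs : induces_closed_immersion s.
Hypothesis ht : generates_ideal i t.
Variables (D : deformation i s t) (Doo : fibre_infty D).
Variable J1 : lbmor (j1 D) (U1O D) (L' D).
Local Notation R := (rees i L).
Local Notation tau := (U1tau D).
Local Notation th := (U1th D).
Local Notation gn := (gen i s t).
Local Notation roo := (lpull (kinfL Doo)).
Let Rax := rees_axioms i L.
Let Rproj := U1_proj D.
Let gndeg k : gdeg 1 (gn k). Proof. exact: gen_deg. Qed.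

(** The section t has no zero on X x Spec A[v], so the fibre lies in the other chart. *)
Lemma infty_chart : exists f : Doo -> U1 D, forall y, j1 D (f y) = kinf Doo y.
Proof.
suff /choice[f fE] : forall y, exists z, j1 D z = kinf Doo y by exists f.
move=> y.
case: (Defs.cover (kinf Doo y)) => -[z _ zE]; last by exists z.
by case: (st_infty (z := y)); rewrite -zE; exact: st_U0.
Qed.

(** The fibre is embedded in D, not in Proj S', so elements of S' are restricted to it through
    families on D, of arbitrary value outside Proj S'. The element 0, homogeneous of every degree,
    is treated apart. *)
Lemma rees_section_exists : exists eps : R -> germs (L' D), forall n p, gdeg n p ->
  (forall d, homog n (eps p d)) /\ lpull J1 (eps p) = th p.
Proof.
suff /choice[eps epsP] : forall p, exists e : germs (L' D), forall n, gdeg n p ->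
    (forall d, homog n (e d)) /\ lpull J1 e = th p by exists eps => n p; exact: epsP.
move=> p.
case: (pselect (p = 0)) => [->|p0].
  exists 0 => n _; split; first by move=> d; exact: homog0.
  by rewrite lpull0 th0.
case: (pselect (exists n, gdeg n p)) => [[n np]|no]; last by exists 0 => n np; case: no; exists n.
have [e eh eE] := extend_germs (j1_open D) J1 (fun z => th_homog z np).
by exists e => m mp; case: (rees_gdeg_inj np mp) => [<-|//].
Qed.

Variable f : Doo -> U1 D.
Hypothesis fE : forall y, j1 D (f y) = kinf Doo y.
Variable eps : R -> germs (L' D).
Hypothesis epsP : forall n p, gdeg n p ->
  (forall d, homog n (eps p d)) /\ lpull J1 (eps p) = th p.

Definition infty_section (p : R) : germs (Linf Doo) := roo (eps p).
Local Notation Th := infty_section.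
Definition tau_multiples (n : nat) : set R :=
  [set a | exists2 b, gdeg n b & a = tau_mul b].

Lemma eps_eq n p (e : germs (L' D)) y : gdeg n p -> (forall d, homog n (e d)) ->
  lpull J1 e (f y) = th p (f y) -> eps p (kinf Doo y) = e (kinf Doo y).
Proof.
move=> np eh eE; have [ph pE] := epsP np; rewrite -fE;
apply: (lbfun_homog_inj (n := n) (phi := J1) (open_comor_inj (j1_open D) (x := f y))) => //.
by rewrite -[LHS]/(lpull J1 (eps p) (f y)) pE.
Qed.

Lemma infty_section_eq n p (e : germs (L' D)) : gdeg n p -> (forall d, homog n (e d)) ->
  lpull J1 e = th p -> roo e = Th p.
Proof.
move=> np eh eE; apply: functional_extensionality_dep => y.
by rewrite /Th /lpull (eps_eq (y := y) np eh) // eE.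
Qed.

Lemma infty_section_H0 n p : gdeg n p -> H0 (Linf Doo) n (Th p).
Proof.
move=> np y; have [ph pE] := epsP np; split; last exact: lbfun_homog.
apply: lbfun_reg; rewrite -fE; apply: (lpull_lreg_open (phi := J1) (j1_open D)) => //.
by rewrite pE; case: (proj_sec Rproj np (f y)).
Qed.

Lemma infty_sectionD n a c : gdeg n a -> gdeg n c -> Th (a + c) = Th a + Th c.
Proof.
move=> na nc; have [ah aE] := epsP na; have [ch cE] := epsP nc.
rewrite -(infty_section_eq (e := eps a + eps c) (gdegD Rax na nc)) ?lpullD //.
  by move=> d; exact: homogD.
by rewrite aE cE (projD Rproj na nc).
Qed.

Lemma infty_sectionM n m a c : gdeg n a -> gdeg m c -> Th (gmul a c) = Th a * Th c.
Proof.
move=> na mc; have [ah aE] := epsP na; have [ch cE] := epsP mc.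
rewrite -(infty_section_eq (e := eps a * eps c) (gdegM Rax na mc)) ?lpullM //.
  by move=> d; exact: homogM.
by rewrite aE cE (projM Rproj na mc).
Qed.

Lemma eps_nonvanishing n a y : gdeg n a ->
  (nonvanishing n (eps a (kinf Doo y)) <-> nonvanishing n (th a (f y))).
Proof.
move=> na; have [ah aE] := epsP na; rewrite -fE -aE; split; first exact: lbfun_nonvanishing.
exact: lbfun_nonvanishingE.
Qed.

Lemma infty_section_nonvanishing n a y : gdeg n a ->
  (nonvanishing n (Th a y) <-> nonvanishing n (th a (f y))).
Proof.
move=> na; have [ah _] := epsP na; rewrite -(eps_nonvanishing y na); split.
  exact: lbfun_nonvanishingE.
exact: lbfun_nonvanishing.
Qed.

Lemma eps_scale n p q y (C : functions D) : gdeg n p -> gdeg n q ->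
  pull (j1 D) C (f y) *: th q (f y) = th p (f y) ->
  eps p (kinf Doo y) = C (kinf Doo y) *: eps q (kinf Doo y).
Proof.
move=> np nq E; have [qh qE] := epsP nq.
apply: (eps_eq (e := fun d => C d *: eps q d) np) => [d|]; first exact: homogZ.
by rewrite -E -qE /lpull lbfunZ.
Qed.

Lemma infty_section_scale n p q y (C : functions D) : gdeg n p -> gdeg n q ->
  pull (j1 D) C (f y) *: th q (f y) = th p (f y) -> Th p y = pull (kinf Doo) C y *: Th q y.
Proof. by move=> np nq E; rewrite /Th /lpull (eps_scale np nq E) lbfunZ. Qed.

Lemma infty_section_fraction y (c : stalk Doo y) : exists n p q,
  [/\ gdeg n p, gdeg n q, nonvanishing n (Th q y) & c *: Th q y = Th p y].
Proof.
have [_ _ _ k_surj] := kinf_closed Doo.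
have [c1 <-] := k_surj y c; have [C _ <-] := reg_exists c1.
have [n [p [q [np nq qn E]]]] := proj_frac Rproj (pull (j1 D) C (f y)).
exists n, p, q; split=> //; first exact/infty_section_nonvanishing.
by rewrite (infty_section_scale np nq E).
Qed.

Lemma tau_infty : exists Tf : functions D, [/\ pull (j1 D) Tf = tau,
  forall y, pull (kinf Doo) Tf y = 0 &
  forall y, st D (kinf Doo y) = Tf (kinf Doo y) *: su D (kinf Doo y)].
Proof.
have [_ [Tf [_ TfE _ stE]]] := coord_functions D; exists Tf.
have stE' y : st D (kinf Doo y) = Tf (kinf Doo y) *: su D (kinf Doo y).
  by rewrite -fE stE.
split=> // y; apply/kinf_ideal; exists 1, (Tf (kinf Doo y)).
by rewrite mul1r.
Qed.

Lemma tau_multiples_ideal : hideal tau_multiples.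
Proof.
split=> [n _ [b nb ->]|n|n _ _ [a na ->] [b nb ->]|n m _ b mb [a na ->]].
- exact: tau_mul_deg.
- exists 0; first exact: (gdeg0 Rax).
  by rewrite tau_mulE.
- exists (a + b); first exact: (gdegD Rax).
  by rewrite !tau_mulE.
- exists (gmul b a); first exact: (gdegM Rax).
  exact: (gmulCA Rax mb (rees_tau_deg i L) na).
Qed.

Lemma infty_section_tau n a : tau_multiples n a -> Th a = 0.
Proof.
move=> [b nb ->]; have [Tf [TfE Tf0 _]] := tau_infty.
apply: functional_extensionality_dep => y.
rewrite (infty_section_scale (C := Tf) (tau_mul_deg nb) nb) ?Tf0 ?scale0r //.
by rewrite TfE (th_tau_mul _ nb).
Qed.

(* A germ vanishing on the fibre at infinity is a multiple of tau there, which can be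
   written as a fraction of elements of S'. *)
Lemma infty_section_kernel n a y : gdeg n a -> Th a y = 0 -> exists m b,
  [/\ gdeg m b, nonvanishing m (th b (f y)) & tau_multiples (m + n) (gmul b a)].
Proof.
move=> na a0; have [k _ kn] := gen_cover Apid hX hs ht (f y).
(* A denominator of the same degree as a, invertible at f y, which turns a into a germ of
   function. *)
pose g := gpow (mono 0 1 : R) (gn k) n.
have gd : gdeg n g by have := gdeg_pow Rax n (gndeg k); rewrite muln1.
have gnv : nonvanishing n (th g (f y)).
  have := nonvanishingX n kn; rewrite muln1.
  have -> := (@graded_mapX _ _ _ _ _ Rax _ _ _ gndeg
    (@gen_cover _ _ _ _ _ _ _ _ _ Apid hX hs ht D)
    _ _ id th (fun n a => @proj_sec _ _ _ _ _ Rproj n a) (projM Rproj) _ 1 (gn k) n _) => //.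
  by rewrite germsX.
have [c cE] := nonvanishing_fraction gnv (th_homog (f y) na).
have [c1 c1E] := open_comor_surj (j1_open D) c.
have [C _ CE] := reg_exists c1.
have CcE : pull (j1 D) C (f y) = c by rewrite /pull CE.
have aC : pull (j1 D) C (f y) *: th g (f y) = th a (f y) by rewrite CcE.
have C0 : pull (kinf Doo) C y = 0.
  apply: (nonvanishing_scale0 (w := Th g y) (n := n)); first exact/infty_section_nonvanishing.
  by rewrite -(infty_section_scale na gd aC).
have [Tf [TfE _ stE]] := tau_infty.
(* Vanishing on the fibre means divisibility by t/u, which is tau on Proj S'. *)
have [B BE] : exists B : functions D, C (kinf Doo y) = B (kinf Doo y) * Tf (kinf Doo y).
  have /kinf_ideal[b [h [hE CE']]] := C0; have [B _ BE] := reg_exists b; exists B.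
  rewrite BE CE'; congr (_ * _).
  apply: (nonvanishing_scale_inj (su_infty (st_infty (z := y)))).
  by rewrite -hE stE.
have cB : c = pull (j1 D) B (f y) * tau (f y).
  have BE' : C (j1 D (f y)) = B (j1 D (f y)) * Tf (j1 D (f y)) by rewrite fE.
  by rewrite -CcE -TfE /pull BE' rmorphM.
have [m [p [q [mp mq qn E]]]] := proj_frac Rproj (pull (j1 D) B (f y)).
have mgp := gdegM Rax mp gd; have mqa := gdegM Rax mq na.
(* With B = p/q, the elements q a and tau p g have the same germ, so some b invertible at the point
   equalizes them in S'. *)
have [|l [b [lb bn b0]]] := proj_zero Rproj (z := f y)
    (proj2 (gdegB Rax _) _ _ mqa (tau_mul_deg mgp)).
  rewrite (thB _ mqa (tau_mul_deg mgp)) (thM _ mq na) (th_tau_mul _ mgp) (thM _ mp gd) -E cE cB.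
  by rewrite -!scalerAl -scalerAr scalerA mulrC subrr.
exists (l + m)%N, (gmul b q); split.
- exact: (gdegM Rax).
- by rewrite (thM _ lb mq); exact: nonvanishingM.
exists (gmul b (gmul p g)); first by rewrite -addnA; exact: (gdegM Rax).
rewrite -(gmulA Rax lb mq na) -[RHS](gmulCA Rax lb (rees_tau_deg i L) mgp).
apply/eqP; rewrite -subr_eq0 -(gmulBr Rax lb mqa (tau_mul_deg mgp)); apply/eqP.
exact: b0.
Qed.

Lemma tau_multiples_range z : range f z \/
  exists n a, tau_multiples n a /\ nonvanishing n (th a z).
Proof.
case: (pselect (nonvanishing 1 (st D (j1 D z)))) => stn.
  have [k _ kn] := gen_cover Apid hX hs ht z; right; exists 1%N, (tau_mul (gn k)).
  split; first by exists (gn k).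
  rewrite (th_tau_mul _ (gndeg k)); apply: nonvanishingZ => //.
  by apply/overlap1; exact: st_unit_U0.
have [y _ yE] : range (kinf Doo) (j1 D z) by apply/kinf_range.
left; exists y => //; have [j1_inj _ _] := j1_open D.
by apply: j1_inj; rewrite fE.
Qed.

Lemma infty_sections : exists n0, forall n, (n0 <= n)%N ->
  (forall rho, H0 (Linf Doo) n rho -> exists2 p, gdeg n p & Th p = rho) /\
  (forall p, gdeg n p -> Th p = 0 -> tau_multiples n p).
Proof.
have [kinj kcl knb _] := kinf_closed Doo.
apply: (rees_sections Apid hX hs ht (f := f) (Th := Th) (K := tau_multiples)).
- have -> : range f = j1 D @^-1` (range (kinf Doo)).
    apply/seteqP; split=> [z [y _ <-]|z [y _ yE]]; first by exists y.
    exists y => //; have [j1_inj _ _] := j1_open D.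
    by apply: j1_inj; rewrite fE.
  by apply: closed_comp kcl => z _; exact: mfun_continuous.
- move=> y V /knb[U Uy UV]; exists (j1 D @^-1` U).
    by apply: (near_pull (f := j1 D)); rewrite fE.
  by move=> y'; rewrite /preimage /= fE => /UV.
- exact: infty_section_H0.
- exact: infty_sectionD.
- exact: infty_sectionM.
- exact: infty_section_nonvanishing.
- exact: infty_section_fraction.
- exact: tau_multiples_ideal.
- exact: infty_section_tau.
- exact: infty_section_kernel.
- exact: tau_multiples_range.
Qed.
End SectionsAtInfinity.

(** * The graded pieces *)

Section GradedPieces.
Variables (A : comNzRingType) (X Y : lrs A) (i : mor Y X) (L : line_bundle X).
Variables (N M : nat) (s : 'I_N.+1 -> germs L) (t : 'I_M -> germs L).
Hypothesis Apid : principal_ideals A.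
Hypothesis hX : scheme X.
Hypothesis hs : induces_closed_immersion s.
Hypothesis ht : generates_ideal i t.
Variables (D : deformation i s t) (D1 : fibre_one D) (Doo : fibre_infty D).
Local Notation R := (rees i L).
Local Notation v := (U0v D).
Local Notation th := (U1th D).
Local Notation phat := (lpull (U0pL D)).
Local Notation r1 := (lpull (oneL D1)).
Local Notation roo := (lpull (kinfL Doo)).
Variables (J0 : lbmor (j0 D) (U0L D) (L' D)) (J1 : lbmor (j1 D) (U1O D) (L' D)).
Hypothesis J0t : forall k z, lpull J0 (wt k) z = lpull (j0L D) (proj_coord k) z.
Hypothesis J0u : forall k z, lpull J0 (wu k) z = v z *: lpull (j0L D) (proj_coord k) z.
Hypothesis J1u : forall k z, lpull J1 (wu k) z = th (gen i s t k) z.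
Variables (f : Doo -> U1 D) (eps : R -> germs (L' D)).
Hypothesis fE : forall y, j1 D (f y) = kinf Doo y.
Hypothesis epsP : forall n p, gdeg n p ->
  (forall d, homog n (eps p d)) /\ lpull J1 (eps p) = th p.
Variable n : nat.
Local Notation Th := (@infty_section A X Y i L N M s t D Doo eps).
Hypothesis infty_surj : forall rho, H0 (Linf Doo) n rho ->
  exists2 p, gdeg n p & Th p = rho.
Hypothesis infty_kernel : forall p, gdeg n p -> Th p = 0 -> tau_multiples n p.
Local Notation E := (weight_part J0 n).
Implicit Types (e : germs (L' D)) (a : germs L).

(** A section is determined by its restriction to X x Spec A[v], so it is the one glued from v^(n+l)
    a and a tau^(-l). Both restrictions are thus read off from the same a, whence the factorization
    of r_infty through r_1. *)
Lemma weight_part_restrictions l e : - n%:Z <= l -> E l e ->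
  exists2 a, ideal_powz i l n a & r1 e = a /\ roo e = Th (mono l a).
Proof.
move=> nl [eH [a aI eE]]; exists a => //; split.
  exact: (restriction_one hs J0t D1 eH (ideal_powz_H0 aI) eE).
have [e' [e'H e'E J1e']] := weight_part_exists Apid hX hs ht J0u J1u nl aI.
have -> : e = e' by apply: (lpull_J0_eq Apid hX hs ht (J0 := J0) eH e'H) => z; rewrite eE e'E.
by apply: (infty_section_eq fE epsP (gdeg_mono aI) _ J1e') => d; case: (e'H d).
Qed.

Lemma weight_part_lift l a : - n%:Z <= l -> ideal_powz i l n a ->
  exists2 e, E l e & r1 e = a /\ roo e = Th (mono l a).
Proof.
move=> nl aI; have [e [eH eE _]] := weight_part_exists Apid hX hs ht J0u J1u nl aI.
have eW : E l e by split=> //; exists a.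
exists e => //; have [a' _ [<- ->]] := weight_part_restrictions nl eW.
have -> : r1 e = a := restriction_one hs J0t D1 eH (ideal_powz_H0 aI) eE.
by [].
Qed.

Lemma image_weight_part l : - n%:Z <= l -> r1 @` E l = ideal_powz i l n.
Proof.
move=> nl; apply/seteqP; split=> [_ [e eW <-]|a /(weight_part_lift nl)[e eW [ea _]]].
  by have [a aI [-> _]] := weight_part_restrictions nl eW.
by exists e.
Qed.

Lemma infty_section_mono_eq0 l a : ideal_powz i l n a ->
  Th (mono l a) = 0 <-> ideal_powz i (l + 1) n a.
Proof.
move=> aI; split=> [a0|a1].
  have [b [_ bI] /(congr1 (fun g : R => g l))] := infty_kernel (gdeg_mono aI) a0.
  by rewrite tau_mulE /mono eqxx => ->.
apply: (infty_section_tau fE epsP (n := n)); exists (mono (l + 1) a); first exact: gdeg_mono.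
by rewrite tau_mul_mono addrK.
Qed.

Lemma infty_section_sum (K : nat) (p : 'I_K -> R) : (forall k, gdeg n (p k)) ->
  Th (\sum_k p k) = \sum_k Th (p k).
Proof.
have Rax := rees_axioms i L.
move=> pn; suff [] : gdeg n (\sum_k p k) /\ Th (\sum_k p k) = \sum_k Th (p k) by [].
elim/big_ind2: _ => [|x x' y y' [xn <-] [yn <-]|k _].
- split; first exact: (gdeg0 Rax).
  apply: (infty_section_tau fE epsP (n := n)).
  exact: (hideal0 (@tau_multiples_ideal _ _ _ i L)).
- by split; [exact: (gdegD Rax)|exact: (infty_sectionD fE epsP xn yn)].
- by [].
Qed.

Lemma sum_monoE (K : nat) (a : 'I_K -> germs L) (k : 'I_K) :
  (\sum_(l < K) (mono l%:Z (a l) : R)) k%:Z = a k.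
Proof.
have ev (P : pred 'I_K) (F : 'I_K -> R) (m : int) :
    (\sum_(l | P l) F l) m = \sum_(l | P l) F l m.
  by elim/big_rec2: _ => // l x y _ <-.
rewrite ev (bigD1 k) //= big1 ?addr0 => [|l lk].
  by rewrite /mono eqxx.
by rewrite /mono eqz_nat val_eqE eq_sym (negbTE lk).
Qed.

Lemma infty_weight_parts_direct_sum :
  direct_sum (fun l : 'I_n.+1 => roo @` E l%:Z) (H0 (Linf Doo) n).
Proof.
have Rax := rees_axioms i L.
have nl (l : nat) : - n%:Z <= l%:Z :> int by lia.
apply: direct_sumI => [l|l _ [e [eH _] <-]|rho rhoH|e eW e0].
- split; first by exists 0; [exact: (proj1 (weight_part_submodule _ _ _))|exact: lpull0].
  move=> a _ _ [e eW <-] [e' e'W <-]; exists (a *: e + e').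
    exact: (proj2 (weight_part_submodule _ _ _)).
  by rewrite lpullD lpullZ.
- exact: lpull_H0.
- have [p np pE] := infty_surj rhoH; have [pfin pI] := np.
  have /choice[e eP] : forall l : 'I_n.+1, exists e, E l%:Z e /\ roo e = Th (mono l%:Z (p l%:Z)).
    by move=> l; have [e eW [_ ee]] := weight_part_lift (nl l) (pI l%:Z); exists e.
  exists (fun l => roo (e l)); split; first by move=> l; exists (e l) => //; case: (eP l).
  under eq_bigr => l _ do rewrite (proj2 (eP l)).
  rewrite -infty_section_sum => [|l]; last exact: gdeg_mono.
  rewrite -pE; set q := \sum_l _.
  have nq : gdeg n q.
    rewrite /q; elim/big_ind: _ => [|x y|l _]; last exact: gdeg_mono.
    - exact: (gdeg0 Rax).
    - exact: (gdegD Rax).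
  (* Beyond l = n both components vanish, so p and q agree for all l >= 0. *)
  have qE (l : nat) : q l%:Z = p l%:Z.
    case: (ltnP l n.+1) => ln; first exact: (sum_monoE (fun l => p l%:Z) (Ordinal ln)).
    have [_ qI] := nq.
    by rewrite (ideal_pow_gt ht ln (qI l)) (ideal_pow_gt ht ln (pI l)).
  have pq : gdeg n (p - q) by exact: (proj2 (gdegB Rax n)).
  rewrite -[p](subrK q) (infty_sectionD fE epsP pq nq).
  rewrite (infty_section_tau fE epsP (n := n)) ?add0r //.
  (* The quotient of p - q by tau is the shifted family. Its nonzero components sit at k <= 0, where
     I^k is all of S. *)
  exists (fun k => (p - q) (k - 1)); last first.
    by rewrite tau_mulE; apply: funext => k; rewrite addrK.
  have [pqfin pqI] := pq; split.
    apply: (sub_finite_set _ (finite_image (fun k : int => k + 1) pqfin)) => k /= kn.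
    by exists (k - 1) => //; rewrite subrK.
  case=> [[|l]|l]; last 2 first.
  - rewrite -[(p - q) _]/(p (l.+1%:Z - 1) - q (l.+1%:Z - 1)).
    have -> : l.+1%:Z - 1 = l%:Z by lia.
    by rewrite qE subrr; exact: (proj1 (ideal_powz_submodule i L _ n)).
  - exact: ideal_powz_H0 (pqI _).
  - exact: ideal_powz_H0 (pqI _).
- have /choice[a aP] : forall l : 'I_n.+1, exists a, ideal_powz i l%:Z n a /\
      e l = Th (mono l%:Z a).
    move=> l; have [e' e'W <-] := eW l.
    by have [a aI [_ ->]] := weight_part_restrictions (nl l) e'W; exists a.
  have ad (l : 'I_n.+1) : @gdeg R n (mono l%:Z (a l)) by apply: gdeg_mono; case: (aP l).
  have q0 : Th (\sum_(l < n.+1) mono l%:Z (a l)) = 0.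
    by rewrite infty_section_sum // -[RHS]e0; apply: eq_bigr => l _; case: (aP l).
  have nq : @gdeg R n (\sum_(l < n.+1) mono l%:Z (a l)).
    elim/big_ind: _ => [|x y|l _] //; [exact: (gdeg0 Rax)|exact: (gdegD Rax)].
  (* The relation is tau b for some b in S'. Comparing components, a_l = b_(l+1) lies in I^(l+1),
     which is the criterion for the l-th term to vanish on the fibre. *)
  have [b [_ bI] bE] := infty_kernel nq q0.
  move=> l; have [aI ->] := aP l; apply/infty_section_mono_eq0 => //.
  rewrite -(sum_monoE a l) bE tau_mulE; exact: bI.
Qed.

Lemma infty_factor l : - n%:Z <= l -> exists phi : germs L -> germs (Linf Doo),
  forall e, E l e -> phi (r1 e) = roo e.
Proof.
move=> nl; suff /choice[phi phiP] : forall x, exists y, forall e, E l e -> r1 e = x -> roo e = y.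
  by exists phi => e eW; rewrite -(phiP _ e eW).
(* On r_1(E_(l,n)) the value is forced: the class of x tau^(-l) modulo tau. *)
move=> x; exists (Th (mono l x)) => e eW ex.
by have [a _ [ea ->]] := weight_part_restrictions nl eW; rewrite -ex ea.
Qed.
End GradedPieces.

Theorem proposition5p15 (A : comNzRingType) (hA : field_or_Z A)
    (X : lrs A) (hX : scheme X) (hXproj : projective X)
    (L : line_bundle X) (hL : very_ample L)
    (Y : lrs A) (hY : scheme Y) (i : mor Y X) (hi : closed_immersion i)
    (hYi : hyperplane_section i L)
    (N M : nat) (s : 'I_N.+1 -> germs L) (t : 'I_M -> germs L)
    (hs : induces_closed_immersion s) (ht : generates_ideal i t)
    (D : deformation i s t) (G : transverse_action D)
    (D1 : fibre_one D) (Doo : fibre_infty D) (GDoo : Gm_fibre_infty G Doo) :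
  (* the fibre over infinity is stable: the action restricts to it *)
  exists (actoo : mor (GK GDoo) Doo) (actooL : lbmor actoo (GKL GDoo) (Linf Doo)),
    [/\ mor_eq (comp_mor (kinf Doo) actoo) (comp_mor (act G) (GKk GDoo)),
        forall r, lpull actooL (lpull (kinfL Doo) r) =
                  lpull (GKkL GDoo) (lpull (actL G) r)
      & exists n0 : nat, forall n : nat, (n0 <= n)%N ->
        exists (E : int -> set (germs (L' D)))
               (F : nat -> set (germs (Linf Doo)))
               (phi : nat -> germs L -> germs (Linf Doo)),
        let r1 := lpull (oneL D1) in
        let roo := lpull (kinfL Doo) in
        [/\ (* 1 *)
            direct_sum (fun k : 'I_(n.*2.+1) => E (k%:Z - n%:Z)) (H0 (L' D) n)
            /\ (forall l : int, - n%:Z <= l <= n%:Z -> forall r, E l r ->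
                  has_weight (GDlam G) (GDprL G) (actL G) (absz (n%:Z + l)) r),
            (* 2 *)
            direct_sum (fun l : 'I_n.+1 => F l) (H0 (Linf Doo) n)
            /\ (forall l : nat, (l <= n)%N -> forall r, F l r ->
                  has_weight (GKlam GDoo) (GKprL GDoo) actooL (n + l) r),
            (* 3 *)
            forall l : nat, (l <= n)%N ->
              [/\ forall x, (r1 @` E l%:Z) x -> F l (phi l x),
                  forall (a : A) x y, (r1 @` E l%:Z) x -> (r1 @` E l%:Z) y ->
                    phi l (a *: x + y) = a *: phi l x + phi l y
                & forall r, E l%:Z r -> phi l (r1 r) = roo r]
          & (* the induced filtration of H^0(X, L^n) and its graded pieces *)
            [/\ E (n%:Z + 1) = [set 0],
                forall l : int, - n%:Z <= l <= n%:Z ->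
                  r1 @` E (l + 1) `<=` r1 @` E l,
                r1 @` E 0 = H0 L n
              & forall l : nat, (l <= n)%N ->
                  (forall y, F l y -> exists2 x, (r1 @` E l%:Z) x & phi l x = y)
                  /\ (forall x, (r1 @` E l%:Z) x ->
                        (phi l x = 0 <-> (r1 @` E (l%:Z + 1)) x))]]].
Proof.
have Apid := field_or_Z_principal hA.
have [actoo [actooL [actooE actooLE]]] := action_at_infinity hs GDoo.
exists actoo, actooL; split=> //.
have [J0 [J0t J0u]] := J0_exists hs D.
have [J1 [J1u _]] := J1_exists Apid hX hs ht D.
have [f fE] := infty_chart Doo.
have [eps epsP] := rees_section_exists J1.
have [n1 n1P] := weight_parts_direct_sum Apid hX hs ht J0u J1u.
have [n2 n2P] := infty_sections Apid hX hs ht fE epsP.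
exists (maxn n1 n2) => n; rewrite geq_max => /andP[/n1P sumE /n2P[surjoo keroo]].
have nl (l : nat) : - n%:Z <= l%:Z :> int by lia.
have /choice[phi phiE] := fun l : nat =>
  infty_factor Apid hX hs ht D1 J0t J0u J1u fE epsP (nl l).
exists (weight_part J0 n), (fun l => lpull (kinfL Doo) @` weight_part J0 n l%:Z), phi.
move=> r1 roo.
have lift := weight_part_lift Apid hX hs ht D1 J0t J0u J1u fE epsP.
have image l := image_weight_part Apid hX hs ht D1 J0t J0u J1u fE epsP (n := n) (l := l).
split.
- split=> // l ln r rE; exact: (weight_part_weight Apid hX hs ht J0t J0u) rE.
- split.
    exact: (infty_weight_parts_direct_sum Apid hX hs ht D1 J0t J0u J1u fE epsP surjoo keroo).
  move=> l ln _ [e eE <-]; apply: weight_infty actooLE _.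
  have := weight_part_weight Apid hX hs ht J0t J0u (G := G) (l := l%:Z) _ eE.
  by rewrite -PoszD absz_nat; apply; rewrite nl.
- move=> l ln; split.
  + by move=> _ [e eE <-]; exists e => //; rewrite phiE.
  + move=> a _ _ [e eE <-] [e' e'E <-]; rewrite -lpullZ -lpullD !phiE //.
      by rewrite /roo lpullD lpullZ.
    exact: (proj2 (weight_part_submodule _ _ _)).
  + by move=> r rE; rewrite phiE.
- split.
  + exact: (weight_part_top Apid hX hs ht).
  + move=> l /andP[ln _]; rewrite !image //; last by lia.
    exact: ideal_powz_decr.
  + by rewrite image // oppr_le0.
  + move=> l ln; split.
      by move=> _ [e eE <-]; exists (r1 e); [exists e|rewrite phiE].
    have nl1 : - n%:Z <= l%:Z + 1 by lia.
    move=> x; rewrite (image _ (nl l)) (image _ nl1) => xI.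
    have [e eE [ex eoo]] := lift _ _ _ (nl l) xI.
    rewrite -{1}ex phiE // eoo; exact: (infty_section_mono_eq0 fE epsP keroo xI).
Qed.
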